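(* Let $q$ be a prime power, let $n\geq 1$, let ${\mathsf m}:[n]\to[n]$ be a Hessenberg function, and let $T:\mathbb{F}_q^n\to\mathbb{F}_q^n$ be any $\mathbb{F}_q$-linear operator. Then the number of $\mathbb{F}_q$-rational points of the Hessenberg variety $\mathscr{H}({\mathsf m},T)$ is $$|\mathscr{H}({\mathsf m},T)|=\langle F_T(x),\ \omega X_{G({\mathsf m})}(x;q)\rangle .$$
   Context: $[n]=\{1,\dots,n\}$. A Hessenberg function is a weakly increasing ${\mathsf m}:[n]\to[n]$ with ${\mathsf m}(i)\geq i$ for all $i$. For a field $F$ and linear $T:F^n\to F^n$, the Hessenberg variety $\mathscr{H}({\mathsf m},T)$ is the set of complete flags $V_1\subseteq V_2\subseteq\cdots\subseteq V_n=F^n$ ($\dim V_i=i$) with $TV_i\subseteq V_{{\mathsf m}(i)}$ for all $i\in[n]$. The indifference graph $G({\mathsf m})$ has vertex set $[n]$ and edges $\{i,j\}$ with $i<j\leq {\mathsf m}(i)$. For a graph $G$ on $[n]$, its chromatic quasisymmetric function is $X_G(x;t)=\sum_\kappa t^{\mathrm{asc}(\kappa)}x_{\kappa(1)}\cdots x_{\kappa(n)}$, summed over proper colorings $\kappa:[n]\to\{1,2,\dots\}$, where $\mathrm{asc}(\kappa)$ is the number of edges $\{i,j\}$ with $i<j$ and $\kappa(i)<\kappa(j)$; for $G=G({\mathsf m})$ this is a symmetric function, and $X_{G({\mathsf m})}(x;q)$ denotes its specialization at $t=q$. $\omega$ is the involution on symmetric functions with $\omega s_\lambda=s_{\lambda'}$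 ($\lambda'$ the conjugate partition), and $\langle\cdot,\cdot\rangle$ is the Hall scalar product, for which $\{h_\lambda\}$ and $\{m_\lambda\}$ are dual bases. For a partition $\lambda=(\lambda_1,\dots,\lambda_\ell)$ of $n$, let $\mathrm{fl}_\lambda(T)$ be the number of chains $(0)=W_0\subseteq W_1\subseteq\cdots\subseteq W_\ell$ of $T$-invariant subspaces of $\mathbb{F}_q^n$ with $\dim W_i/W_{i-1}=\lambda_i$ for $1\le i\le \ell$. The invariant flag generating function of $T$ is $F_T(x)=\sum_{\lambda\vdash n}\mathrm{fl}_\lambda(T)\,m_\lambda$, where $m_\lambda$ is the monomial symmetric function. *)

(* Defs.v *)
From HB Require Import structures.
From Stdlib Require Import ClassicalEpsilon.
From mathcomp Require Import all_boot all_order all_algebra.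
From mathcomp Require Export mpoly.

Set Implicit Arguments.
Unset Strict Implicit.
Unset Printing Implicit Defensive.

Import GRing.Theory.

Local Open Scope ring_scope.

(* Vertices, colors and flag indices are numbered from 0: the i of [n] is the
   element i - 1 of 'I_n. *)

(* Over a finite field, a space has finitely many subspaces. *)
Section FiniteSubspaces.
Variables (F : finFieldType) (vT : vectType F).
Definition vspace_isCountable : isCountable {vspace vT} :=
  CanIsCountable (@VectorInternalTheory.vs2mxK F vT).
HB.instance Definition _ := vspace_isCountable.
Definition vspace_isFinite : isFinite {vspace vT} :=
  CanIsFinite (@VectorInternalTheory.vs2mxK F vT).
HB.instance Definition _ := vspace_isFinite.
End FiniteSubspaces.

Definition hessenberg_function (n : nat) (m : 'I_n -> 'I_n) : Prop :=
  (forall i j : 'I_n, (i <= j)%N -> (m i <= m j)%N) /\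
  (forall i : 'I_n, (i <= m i)%N).

(* V i is the (i+1)-dimensional member of the flag; dim V_n = n forces
   V_n = F^n. *)
Definition hessenberg_variety (F : finFieldType) (n : nat) (m : 'I_n -> 'I_n)
    (T : 'End('rV[F]_n)) : {set {ffun 'I_n -> {vspace 'rV[F]_n}}} :=
  [set V : {ffun 'I_n -> {vspace 'rV[F]_n}} |
    [&& [forall i : 'I_n, \dim (V i) == i.+1],
        [forall i : 'I_n, forall j : 'I_n, (i <= j)%N ==> (V i <= V j)%VS]
      & [forall i : 'I_n, (T @: V i <= V (m i))%VS]]].

(* A partition of n, padded with zeros to length n so that partitions form a
   finType; it coerces to the sequence of its nonzero parts. *)
Definition partn (n : nat) : predArgType :=
  {t : n.-tuple 'I_n.+1 |
    sorted geq [seq val x | x <- t] && (sumn [seq val x | x <- t] == n)}.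

Definition parts (n : nat) (l : partn n) : seq nat :=
  [seq k <- [seq val x | x <- val l] | 0 < k]%N.
Coercion parts : partn >-> seq.

Definition conj_parts (l : seq nat) : seq nat :=
  [seq count (fun k => j < k)%N l | j <- iota 0 (head 0%N l)].

(* A power series of bounded degree in x_0, x_1, x_2, ... is given by its
   truncations: the N-th polynomial of the family is obtained by setting
   x_N = x_{N+1} = ... = 0.  The ring of symmetric functions is thus the graded
   inverse limit of the rings of symmetric polynomials, and operations on it
   are computed for each N. *)
Definition series (R : nzRingType) : Type := forall N : nat, {mpoly R[N]}.

(* The sum of the distinct monomials whose nonzero exponents, in some order,
   are the parts of l. *)
Definition msym (l : seq nat) : series int := fun N =>
  \sum_(a : 'X_{1..N < (sumn l).+1} |
        perm_eq [seq k <- [seq (a : 'X_{1..N}) i | i <- enum 'I_N] | 0 < k]%N l)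
     'X_[a].

Definition hsym1 (k : nat) : series int := fun N =>
  \sum_(a : 'X_{1..N < k.+1} | mdeg a == k) 'X_[a].

Definition hsym (l : seq nat) : series int := fun N =>
  \prod_(k <- l) hsym1 k N.

Definition cell (l : seq nat) : predArgType :=
  {c : 'I_(size l) * 'I_(sumn l) | (c.2 < nth 0 l c.1)%N}.

Definition semistandard (l : seq nat) (N : nat)
    (t : {ffun cell l -> 'I_N}) : bool :=
  [forall c : cell l, forall d : cell l,
     let: (i, j) := val c in let: (i', j') := val d in
     ((i == i') && (j <= j')%N ==> (t c <= t d)%N) &&
     ((j == j') && (i < i')%N ==> (t c < t d)%N)].

Definition schur (l : seq nat) : series int := fun N =>
  \sum_(t : {ffun cell l -> 'I_N} | semistandard t) \prod_(c : cell l) 'X_(t c).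

(* The coefficients of f in the basis b of the degree n symmetric functions
   (over the integers); a junk value if f is not in the span of b. *)
Definition coords (n : nat) (b : seq nat -> series int) (f : series int) :
    {ffun partn n -> int} :=
  epsilon (inhabits 0) (fun c : {ffun partn n -> int} =>
    forall N : nat, f N = \sum_(l : partn n) c l *: b l N).

(* The degree n component of omega. *)
Definition omega (n : nat) (f : series int) : series int := fun N =>
  \sum_(l : partn n) coords n schur f l *: schur (conj_parts l) N.

(* The degree n component of the bilinear form with <h_l, m_l'> = [l = l']. *)
Definition hall (n : nat) (f g : series int) : int :=
  \sum_(l : partn n) coords n hsym f l * coords n msym g l.

Definition indifference_graph (n : nat) (m : 'I_n -> 'I_n) : rel 'I_n :=
  [rel i j : 'I_n | ((i < j) && (j <= m i) || (j < i) && (i <= m j))%N].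

Definition proper_coloring (n : nat) (G : rel 'I_n) (N : nat)
    (kappa : {ffun 'I_n -> 'I_N}) : bool :=
  [forall i : 'I_n, forall j : 'I_n, G i j ==> (kappa i != kappa j)].

Definition asc (n : nat) (G : rel 'I_n) (N : nat)
    (kappa : {ffun 'I_n -> 'I_N}) : nat :=
  #|[set e : 'I_n * 'I_n |
      [&& (e.1 < e.2)%N, G e.1 e.2 & (kappa e.1 < kappa e.2)%N]]|.

(* The variable t is the indeterminate of {poly int}. *)
Definition chromatic_qsym (n : nat) (G : rel 'I_n) : series {poly int} :=
  fun N =>
  \sum_(kappa : {ffun 'I_n -> 'I_N} | proper_coloring G kappa)
     'X^(asc G kappa) *: \prod_(i < n) 'X_(kappa i).

Definition specialize (q : int) (f : series {poly int}) : series int :=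
  fun N => map_mpoly (horner_eval q) (f N).

(* W_0, ..., W_r with r = size l. *)
Definition inv_flags (F : finFieldType) (n : nat) (T : 'End('rV[F]_n))
    (l : seq nat) : {set {ffun 'I_(size l).+1 -> {vspace 'rV[F]_n}}} :=
  [set W : {ffun 'I_(size l).+1 -> {vspace 'rV[F]_n}} |
    [&& W ord0 == 0%VS,
        [forall i, (T @: W i <= W i)%VS]
      & [forall i : 'I_(size l),
          let W' := W (widen_ord (leqnSn _) i) in
          let W'' := W (lift ord0 i) in
          (W' <= W'')%VS && (\dim W'' == \dim W' + nth 0 l i)%N]]].

Definition inv_flag_gf (F : finFieldType) (n : nat) (T : 'End('rV[F]_n)) :
    series int := fun N =>
  \sum_(l : partn n) #|inv_flags T l|%:Z *: msym l N.

(* Main.v *)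
(* As functions f of m, both sides satisfy the modular law
   (1 + q) f(m1) = q f(m0) + f(m2) whenever the indifference graphs of m0, m1
   and m2 arise by joining a vertex to none, one or both of two neighboring
   vertices that are otherwise twins.  For the chromatic function this follows
   by exchanging the colors of the twins; for the number of flags, by letting a
   single member of the flag vary in a pencil with q + 1 elements.  A function
   satisfying this law is determined by its values on disjoint unions of
   complete graphs, and there it does not depend on the order of the components.

   On the union of complete graphs of sizes l_1, l_2, ... the chromatic function
   is prod [l_i]_q! times e_l, and <F_T, omega e_l> = <F_T, h_l> = fl_l(T).  On
   the other side, a point of the Hessenberg variety is a chain of invariant
   subspaces of type l together with a complete flag in each successive
   quotient, and there are prod [l_i]_q! such flags.

   As omega is defined on Schur functions given by tableaux, omega e_l = h_l
   requires the two Pieri rules; the rule for e_k follows from the one for h_k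
   and a sign-reversing involution. *)
From HB Require Import structures.
From Stdlib Require Import FunctionalExtensionality.
From mathcomp Require Import all_boot all_order all_algebra.
From mathcomp Require Import finfield zify lra ring.
Require Import Defs.

Set Implicit Arguments.
Unset Strict Implicit.
Unset Printing Implicit Defensive.

Import Order.TTheory GRing.Theory Num.Theory.

Local Open Scope ring_scope.

(** * Functions satisfying the modular laws *)

(** Uniqueness takes the form of a vanishing theorem for integer-valued functions. It is applied to
    the difference of the two sides, and before that to single monomial coefficients of the
    chromatic function. The latter stands in for a direct proof of symmetry: [coords] is meaningful
    only on the span of a basis, so the chromatic function must first be shown to lie in the span of
    the [msym]. The obstacle to uniqueness is that the law needs twins. The vertices that separate
    two rows become twins only once the rows they index have been made equal, which takes a
    recursion on later rows. The earlier rows then move inside a box where all instances of the law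
    are available, and zeros on its boundary spread to the whole box. For the order of two
    components, the missing edges of a graph with bipartite complement form a Ferrers shape and
    reversal of the vertices conjugates it. The box argument reduces invariance under reversal to
    squares, which are self-conjugate. *)

Definition upd (m : nat -> nat) (i v : nat) : nat -> nat :=
  fun k => if k == i then v else m k.

Definition upd2 (m : nat -> nat) (i u v : nat) : nat -> nat :=
  upd (upd m i u) i.+1 v.

(* Hessenberg functions are represented by functions on nat, of which only the
   values below n matter. *)
Definition hess (n : nat) (m : nat -> nat) : Prop :=
  (forall i, i < n -> i <= m i < n)%N /\
  (forall i j, i <= j -> j < n -> m i <= m j)%N.

Definition eq_upto (n : nat) (m m' : nat -> nat) : Prop :=
  forall i, (i < n)%N -> m i = m' i.

(* In modular_row the twins are the vertices j + 1 and j + 2 and the edges added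
   join them to i; modular_col is its image under the reversal of the vertices,
   with twins i and i + 1 joined to j + 1.  The hypotheses say that both twins
   have the same neighbors in all three graphs, apart from these edges. *)
Record modular (n q : nat) (f : (nat -> nat) -> int) : Prop := Modular {
  modular_ext : forall m m', eq_upto n m m' -> f m = f m';
  modular_row : forall m i j, (i < n)%N ->
    hess n (upd m i j) -> hess n (upd m i j.+2) -> m j.+1 = m j.+2 ->
    (1 + q%:Z) * f (upd m i j.+1) = q%:Z * f (upd m i j) + f (upd m i j.+2);
  modular_col : forall m i j, (i.+1 < n)%N ->
    hess n (upd2 m i j j) -> hess n (upd2 m i j.+1 j.+1) ->
    (forall k, (k < n)%N -> k != i -> k != i.+1 -> m k != i) ->
    (1 + q%:Z) * f (upd2 m i j j.+1) =
      q%:Z * f (upd2 m i j j) + f (upd2 m i j.+1 j.+1) }.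

(* Successive differences form a geometric progression, so two zeros force
   the whole sequence to vanish. *)
Lemma geometric_vanish (q : nat) (D : nat -> int) (L s : nat) :
  (0 < q)%N -> (0 < s)%N -> (s <= L)%N -> D 0 = 0 -> D s = 0 ->
  (forall t, (0 < t < L)%N ->
     (1 + q%:Z) * D t = q%:Z * D t.+1 + D t.-1) ->
  forall t, (t <= L)%N -> D t = 0.
Proof.
move=> q0 s0 sL D0 Ds rec.
have geo t : (t < L)%N -> q%:Z ^+ t * (D t.+1 - D t) = D 1%N.
  elim: t => [|t IH] tL; first by rewrite expr0 mul1r D0 subr0.
  rewrite -IH; last by lia.
  have := rec t.+1 ltac:(lia) => /= e.
  rewrite exprS -mulrA mulrCA; congr (_ * _); lra.
have qt t : 0 < q%:Z ^+ t by rewrite exprn_gt0 // ltz_nat.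
have lin t : (t <= L)%N ->
   [/\ 0 < D 1%N -> (0 < t)%N -> 0 < D t, D 1%N < 0 -> (0 < t)%N -> D t < 0
     & D 1%N = 0 -> D t = 0].
  elim: t => [|t IH] tL; first by split.
  have [IH1 IH2 IH3] := IH (ltnW tL).
  have e := geo t tL; split => [p _|p _|z].
  - have : 0 < D t.+1 - D t by rewrite -(pmulr_rgt0 _ (qt t)) e.
    by case: t IH1 {IH IH2 IH3 e tL} => [|t] H; rewrite ?D0; [|have := H p isT]; lia.
  - have : D t.+1 - D t < 0 by rewrite -(pmulr_rlt0 _ (qt t)) e.
    by case: t IH2 {IH IH1 IH3 e tL} => [|t] H; rewrite ?D0; [|have := H p isT]; lia.
  - move: e; rewrite z => /eqP; rewrite mulf_eq0 gt_eqF // IH3 // subr0 => /eqP.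
    exact.
have [H1 H2 _] := lin s sL.
have D1 : D 1%N = 0.
  case: (ltrgtP (D 1%N) 0) => // h; first by have := H2 h s0; rewrite Ds.
  by have := H1 h s0; rewrite Ds.
by move=> t tL; have [_ _ ->] := lin t tL.
Qed.

Lemma threshold (P : pred nat) (L : nat) :
  (forall i j, (i <= j)%N -> (j < L)%N -> P j -> P i) ->
  exists2 t, (t <= L)%N & forall i, (i < L)%N -> P i = (i < t)%N.
Proof.
elim: L => [|L IH] H; first by exists 0.
have [|t tL ht] := IH; first by move=> i j ij jL; apply: H => //; lia.
case PL: (P L).
  exists L.+1 => // i iL; rewrite iL; apply: H PL; lia.
exists t => [|i]; first lia.
rewrite ltnS leq_eqVlt => /orP[/eqP->|/ht //]; rewrite PL; lia.
Qed.

(* Monotone choices of the T rows starting at x with values in v, ..., v + k. *)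
Definition in_box (x T v k : nat) (base r : nat -> nat) : Prop :=
  [/\ forall i, ~~ (x <= i < x + T)%N -> r i = base i,
      forall i, (x <= i < x + T)%N -> (v <= r i <= v + k)%N
    & forall i j, (x <= i)%N -> (i <= j)%N -> (j < x + T)%N -> (r i <= r j)%N].

(** Induction on the number of rows, pushing the value [v] out. If only the first row has the value
    [v], the other rows lie in a box with one row and one value less. The column law then passes
    from one row with value [v] to any number of them. The constant configuration serves as the
    second zero of a column; its condition [k <= T] passes to the smaller box because both numbers
    drop by one. *)
Lemma box_vanish (q : nat) (g : (nat -> nat) -> int) (T : nat) :
  (0 < q)%N ->
  forall k x v base,
  (forall r i j, (x <= i < x + T)%N ->
    in_box x T v k base (upd r i j) -> in_box x T v k base (upd r i j.+2) ->
    (1 + q%:Z) * g (upd r i j.+1) = q%:Z * g (upd r i j) + g (upd r i j.+2)) ->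
  (forall r i j, (x <= i)%N -> (i.+1 < x + T)%N ->
    in_box x T v k base (upd2 r i j j) ->
    in_box x T v k base (upd2 r i j.+1 j.+1) ->
    (1 + q%:Z) * g (upd2 r i j j.+1) =
      q%:Z * g (upd2 r i j j) + g (upd2 r i j.+1 j.+1)) ->
  (forall r, in_box x T v k base r -> (0 < k)%N ->
     (forall i, (x <= i < x + T)%N -> (v < r i)%N) -> g r = 0) ->
  (forall r, in_box x T v k base r -> (k <= T)%N ->
     (forall i, (x <= i < x + T)%N -> r i = v) -> g r = 0) ->
  forall r, in_box x T v k base r -> g r = 0.
Proof.
move=> q0; elim: T => [|T IH] k x v base L1 L2 HV HZ r Hr.
  case: k L1 L2 HV HZ Hr => [|k] L1 L2 HV HZ Hr.
    by apply: HZ => // i; lia.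
  by apply: HV => // i; lia.
case: k L1 L2 HV HZ Hr => [|k] L1 L2 HV HZ Hr.
  by apply: HZ => // i hi; have [_ /(_ i hi) h _] := Hr; lia.
(* The column with entries v moves its lower end from 0 to t2. *)
have column r' t2 : (0 < t2 <= T.+1)%N -> in_box x T.+1 v k.+1 base r' ->
    (forall i, (x <= i < x + t2)%N -> (v <= r' i <= v.+1)%N) ->
    (forall i, (x + t2 <= i < x + T.+1)%N -> (v.+1 < r' i)%N) ->
    let d t i := if (x <= i < x + t2)%N then
                   if (i < x + t)%N then v else v.+1 else r' i in
    forall s, (0 < s <= t2)%N -> g (d s) = 0 ->
    forall t, (t <= t2)%N -> g (d t) = 0.
  move=> h2 [B1 B2 B3] lo hi d s hs ds.
  have dbox t : in_box x T.+1 v k.+1 base (d t).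
    split=> [i h|i h|i j h1 h h3]; rewrite /d.
    - by rewrite ifF ?B1 //; lia.
    - by have := B2 i h; do ?[case: ifP => ?]; lia.
    - have := B3 i j h1 h h3; have := hi j; have := lo j.
      by do ?[case: ifP => ?]; lia.
  apply: (geometric_vanish (q := q) (D := fun t => g (d t)) (s := s)) => //.
  - by lia.
  - by lia.
  - apply: HV => [||i hi'] //.
    rewrite /d; have := hi i; do ?[case: ifP => ?]; lia.
  - move=> t ht.
    have E u w t' : (u = if (t.-1 < t')%N then v else v.+1) ->
       (w = if (t < t')%N then v else v.+1) -> (t.-1 <= t' <= t.+1)%N ->
       upd2 (d t) (x + t.-1) u w = d t'.
      move=> -> -> ht'; apply: functional_extensionality => i.
      rewrite /upd2 /upd /d.
      case: (eqVneq i (x + t.-1).+1) => [->|n1].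
        by do ?[case: ifP => ?]; lia.
      case: (eqVneq i (x + t.-1)%N) => [->|n2].
        by do ?[case: ifP => ?]; lia.
      by do ?[case: ifP => ?]; lia.
    have := L2 (d t) (x + t.-1)%N v.
    rewrite (E v v t.+1) ?(E v v.+1 t) ?(E v.+1 v.+1 t.-1); try by first [lia|case: ifP; lia].
    by apply=> //; lia.
(* Subboxes with lower end raised after the first row. *)
have first r' : in_box x T.+1 v k.+1 base r' -> r' x = v ->
    (forall i, (x < i < x + T.+1)%N -> (v < r' i)%N) -> g r' = 0.
  move=> Hr' rx rv.
  have sub s : in_box x.+1 T v.+1 k (upd base x v) s -> in_box x T.+1 v k.+1 base s /\ s x = v.
    move=> [B1 B2 B3]; have sx : s x = v by rewrite B1 /upd ?eqxx //; lia.
    split=> //; split=> [i h|i h|i j h1 h2 h3].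
    - by rewrite B1 /upd; [rewrite ifF|]; lia.
    - by case: (eqVneq i x) => [->|ne]; [lia|have := B2 i ltac:(lia); lia].
    - case: (eqVneq i x) => [->|ne]; last by apply: B3; lia.
      by case: (eqVneq j x) => [->|ne'] //; have := B2 j ltac:(lia); lia.
  apply: (IH k x.+1 v.+1 (upd base x v)).
  - by move=> s i j hi /sub [s1 _] /sub [s2 _]; apply: L1 => //; lia.
  - by move=> s i j hi hj /sub [s1 _] /sub [s2 _]; apply: L2 => //; lia.
  - move=> s /sub [[B1 B2 B3] sx] k0 hs.
    have bx w : (v <= w <= v.+2)%N -> in_box x T.+1 v k.+1 base (upd s x w).
      move=> hw; split=> [i h|i h|i j h1 h2 h3]; rewrite /upd.
      + by rewrite ifF ?B1 //; lia.
      + by have := B2 i h; do ?[case: ifP => ?]; lia.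
      + have := B3 i j h1 h2 h3; have := hs i; have := hs j.
        by do ?[case: ifP => ?]; lia.
    (* Raising the first row to v + 1 or v + 2 leaves no entry [v], so two of the three terms of the
       row law vanish. *)
    have z w : (v < w <= v.+2)%N -> g (upd s x w) = 0.
      move=> hw; apply: HV => // [|i hi]; first by apply: bx; lia.
      by rewrite /upd; have := hs i; case: ifP; lia.
    have := L1 s x v ltac:(lia) (bx v ltac:(lia)) (bx v.+2 ltac:(lia)).
    rewrite (z v.+1) ?(z v.+2) ?mulr0 ?addr0; try lia.
    have -> : upd s x v = s.
      by apply: functional_extensionality => i; rewrite /upd; case: eqP => [->|].
    move/esym/eqP; rewrite mulf_eq0 => /orP[|/eqP//]; lia.
  - move=> s /sub [Hs sx] kT hs.
    have := column s T.+1 ltac:(lia) Hs.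
    have H1 i : (x <= i < x + T.+1)%N -> (v <= s i <= v.+1)%N.
      by move=> hi; have := hs i; case: (eqVneq i x) => [->|]; lia.
    (* Here [s] is one [v] followed by entries v + 1: the member [d 1] of a column whose last member
       is constant and vanishes by [HZ]. *)
    move=> /(_ H1 ltac:(lia) T.+1 ltac:(lia)) col.
    have <- : (fun i => if (x <= i < x + T.+1)%N then if (i < x + 1)%N then v else v.+1 else s i) = s.
      apply: functional_extensionality => i; case: ifP => // hi; case: ifP => hx.
        by have -> : i = x by lia.
      by rewrite hs //; lia.
    apply: col => //; apply: HZ; first last.
    + by move=> i hi; rewrite !ifT //; lia.
    + by [].
    have [B1 B2 B3] := Hs; split=> [i h|i h|i j h1 h2 h3].
    + by rewrite ifF ?B1 //; lia.
    + by rewrite h; case: ifP; lia.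
    + by rewrite !ifT; lia.
  - have [B1 B2 B3] := Hr'; split=> [i h|i h|i j h1 h2 h3].
    + rewrite /upd; case: eqP => [->|] // ne; apply: B1; lia.
    + by have := rv i ltac:(lia); have := B2 i ltac:(lia); lia.
    + by apply: B3; lia.
have [B1 B2 B3] := Hr.
have cnt w : exists2 t, (t <= T.+1)%N &
    forall i, (i < T.+1)%N -> (r (x + i) <= w)%N = (i < t)%N.
  apply: threshold => i j ij jT; apply: leq_trans; apply: B3; lia.
(* [r] is the member [d t1] of its column, in which [d 0] and [d 1] are known to vanish. *)
have [t1 t1T h1] := cnt v; have [t2 t2T h2] := cnt v.+1.
have h1' i : (x <= i < x + T.+1)%N -> (r i <= v)%N = (i < x + t1)%N.
  by move=> hi; have := h1 (i - x)%N; rewrite subnKC; lia.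
have h2' i : (x <= i < x + T.+1)%N -> (r i <= v.+1)%N = (i < x + t2)%N.
  by move=> hi; have := h2 (i - x)%N; rewrite subnKC; lia.
have [t10|t1p] := posnP t1.
  by apply: HV => // i hi; have := h1' i hi; lia.
have t12 : (t1 <= t2)%N by have := h2 t1.-1; have := h1 t1.-1; lia.
have C1 i : (x <= i < x + t2)%N -> (v <= r i <= v.+1)%N.
  by move=> hi; have := h2' i; have := B2 i; lia.
have C2 i : (x + t2 <= i < x + T.+1)%N -> (v.+1 < r i)%N.
  by move=> hi; have := h2' i; lia.
have <- : (fun i => if (x <= i < x + t2)%N then if (i < x + t1)%N then v else v.+1 else r i) = r.
  apply: functional_extensionality => i; case: ifP => // hi.
  by have := h1' i; have := C1 i hi; case: ifP => ?; lia.
apply: (column r t2 _ _ _ _ 1%N) => //; try lia.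
apply: first.
- split=> [i h|i h|i j k1 k2 k3].
  + by rewrite ifF ?B1 //; lia.
  + by have := B2 i h; do ?[case: ifP => ?]; lia.
  + have := B3 i j k1 k2 k3; have := C2 j; have := C2 i.
    by do ?[case: ifP => ?]; lia.
- by rewrite !ifT //; lia.
- by move=> i hi; have := C2 i; do ?[case: ifP => ?]; lia.
Qed.

(* If the rows x, ..., x + s - 1 are twins as columns, one may assume that they
   are equal: the columns that separate them become twins in turn. *)
Lemma twin_rows_vanish (q n : nat) (f : (nat -> nat) -> int) :
  (0 < q)%N -> modular n q f ->
  forall d x s w, (n - x <= d)%N -> (0 < s)%N -> (x + s <= n)%N ->
  (forall m, hess n m -> eq_upto x m w -> (x + s <= (m x).+1)%N ->
     (forall i, (x <= i < x + s)%N -> m i = m x) -> f m = 0) ->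
  (forall p, (p < x)%N -> (w p < x)%N || (x + s <= (w p).+1)%N) ->
  forall m, hess n m -> eq_upto x m w -> (x + s <= (m x).+1)%N -> f m = 0.
Proof.
move=> q0 [fext frow fcol]; elim=> [|d IHd] x s w nd s0 xsn Hc Hw; first lia.
(* The outer induction moves the block to the right; the two inner ones raise [m x] and lengthen the
   run of leading rows equal to [m x]. *)
suff key e : forall v, (n - v <= e)%N -> forall m, hess n m -> eq_upto x m w ->
    m x = v -> (x + s <= v.+1)%N -> f m = 0.
  by move=> m hm mw mx; apply: (key (n - m x)%N (m x) (leqnn _) m).
elim: e => [|e IHe] v nv.
  by move=> m [h1 _] _ mx; have := h1 x ltac:(lia); lia.
suff key u : forall c, (s - c <= u)%N -> (c <= s)%N -> forall m, hess n m ->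
    eq_upto x m w -> m x = v -> (x + s <= v.+1)%N ->
    (forall i, (x <= i < x + c)%N -> m i = v) -> f m = 0.
  move=> m hm mw mx xv; apply: (key (s - 0)%N 0 (leqnn _) _ m) => // i; lia.
elim: u => [|u IHu] c su cs m hm mw mx xv mc.
  by apply: Hc => //; [rewrite mx|move=> i hi; rewrite mx mc //; lia].
have [cs'|cs'] := leqP s c.
  by apply: Hc => //; [rewrite mx|move=> i hi; rewrite mx mc //; lia].
case: (eqVneq (m (x + c)%N) v) => [mv|mv].
  apply: (IHu c.+1) => //; try lia; move=> i hi.
  by case: (eqVneq i (x + c)%N) => [->//|ne]; apply: mc; lia.
have [h1 h2] := hm.
have mxc : (v < m (x + c))%N by have := h2 x (x + c)%N ltac:(lia) ltac:(lia); lia.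
have [h1xc h1x] := (h1 (x + c)%N ltac:(lia), h1 x ltac:(lia)).
set k := (m (x + c) - v)%N.
have kE : m (x + c)%N = (v + k)%N by lia.
have mw' p : (p < x)%N -> (m p < x)%N || (x + s <= (m p).+1)%N.
  by move=> px; rewrite mw // Hw.
(* Row x + c is the first to differ from [v], so each row up to [v] ends at [v] or earlier, or at v
   + k or later: no such row separates the columns v + 1, ..., v + k. *)
apply: (IHd v.+1 k m) => //; try lia; first last.
- by have := h2 (x + c)%N v.+1 ltac:(lia) ltac:(lia); lia.
- move=> p pv; have [pxc|pxc] := ltnP p (x + c)%N.
    have [px|px] := ltnP p x; last by rewrite mc; lia.
    by have := h2 p x ltac:(lia) ltac:(lia); lia.
  by have := h2 (x + c)%N p ltac:(lia) ltac:(lia); lia.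
(* The columns v + 1, ..., v + k are now twins as rows too. *)
move=> {hm h1 h2 mxc}m' hm m'm _ m'c.
have [h1 h2] := hm.
have m'E i : (i <= v)%N -> m' i = m i by move=> iv; apply: m'm.
(* The box consists of the leading rows of the block that end by v + k; the remaining rows stay
   fixed. *)
have [t tx Ht] : exists2 t, (t <= s)%N &
    forall i, (i < s)%N -> (m' (x + i) <= v + k)%N = (i < t)%N.
  apply: threshold => i j ij jT; apply: leq_trans; apply: h2; lia.
have ct : (c < t)%N by rewrite -Ht // m'E; lia.
have m't i : (x <= i < x + s)%N -> (m' i <= v + k)%N = (i < x + t)%N.
  by move=> hi; have := Ht (i - x)%N; rewrite subnKC; lia.
have box_hess r : in_box x t v k m' r -> hess n r.
  move=> [B1 B2 B3]; split=> [i iN|i j ij jn].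
    case hi: (x <= i < x + t)%N; last by rewrite B1 ?hi // h1.
    by have := B2 i hi; lia.
  case hi: (x <= i < x + t)%N; case hj: (x <= j < x + t)%N.
  - by apply: B3; lia.
  - rewrite (B1 j) ?hj //; have := B2 i hi.
    have [js|js] := ltnP j (x + s)%N; first by have := m't j; lia.
    by have := h2 (x + c)%N j ltac:(lia) jn; rewrite [m' (x + c)%N]m'E; lia.
  - rewrite (B1 i) ?hi //; have := B2 j hj.
    by have := h2 i x ltac:(lia) ltac:(lia); rewrite [m' x]m'E; lia.
  - by rewrite !B1 ?hi ?hj //; apply: h2.
have box_w r : in_box x t v k m' r -> eq_upto x r w.
  by move=> [B1 _ _] i ix; rewrite B1 ?m'E ?mw //; lia.
have m'box : in_box x t v k m' m'.
  split=> // [i hi|i j xi ij jt]; last by apply: h2; lia.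
  have := m't i; have := h2 x i ltac:(lia) ltac:(lia).
  rewrite [m' x]m'E; lia.
apply: (box_vanish q0 (g := f) (T := t) (k := k) (x := x) (v := v)) m'box.
- move=> r i j hi R0 R2; apply: frow; try lia; try exact: box_hess.
  have [_ /(_ i hi)] := R0; rewrite /upd eqxx => b1 _.
  have [B1 /(_ i hi)] := R2; rewrite /upd eqxx => b2 _.
  have rE p : (v < p)%N -> r p = m' p.
    by move=> vp; rewrite -B1 /upd ?ifF //; lia.
  by rewrite !rE ?m'c //; lia.
- move=> r i j xi it R0 R2; apply: fcol; try lia; try exact: box_hess.
  have [B1 B2 _] := R0; move=> p pn pi pi1.
  have rE : upd2 r i j j p = r p by rewrite /upd2 /upd !ifF //; lia.
  rewrite -rE; have [px|px] := ltnP p x.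
    by rewrite B1 ?m'E //; have := mw' p px; lia.
  have [pt|pt] := ltnP p (x + t)%N; first by have := B2 p; lia.
  rewrite B1; last lia.
  by have := h2 (x + c)%N p ltac:(lia) pn; rewrite [m' (x + c)%N]m'E; lia.
- move=> r R k0 hr; have rv := hr x ltac:(lia).
  have hR := box_hess r R; have [hR1 _] := hR; have := hR1 x ltac:(lia) => rx.
  by apply: (IHe (r x)) => //; [lia|exact: box_w|lia].
- move=> r R kt hr; apply: (IHu t) => //; try lia; first exact: box_hess.
    exact: box_w.
  by apply: hr; lia.
Qed.

(** The rows before [x] already form complete graphs. Making the rows x, ..., m x equal either
    closes a further complete graph or raises [m x], so the pair of [x] and [m x] grows
    lexicographically. *)
Lemma cliques_vanish (q n : nat) (f : (nat -> nat) -> int) :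
  (0 < q)%N -> modular n q f ->
  (forall m, hess n m -> (forall i, (i < n)%N -> m (m i) = m i) -> f m = 0) ->
  forall m, hess n m -> f m = 0.
Proof.
move=> q0 Mf Hc.
suff key d : forall x m, (n - x <= d)%N -> (x <= n)%N -> hess n m ->
    (forall i, (i < x)%N -> (m i < x)%N /\ m (m i) = m i) -> f m = 0.
  by move=> m hm; apply: (key n 0 m) => //; lia.
elim: d => [|d IHd] x m nd xn hm mx.
  by apply: Hc => // i iN; have [|//] := mx i _; lia.
have [nx|nx] := leqP n x; first by apply: Hc => // i iN; have [|//] := mx i _; lia.
suff key e : forall a m', (n - a <= e)%N -> hess n m' -> eq_upto x m' m ->
    m' x = a -> f m' = 0.
  by apply: (key (n - m x)%N (m x)).
elim: e => [|e IHe] a m' na hm' m'm m'x.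
  by have [h _] := hm'; have := h x nx; lia.
have [h1 h2] := hm'; have h1x := h1 x nx.
apply: (twin_rows_vanish q0 Mf (d := n - x) (x := x) (s := (a - x).+1) (w := m)) => //; try lia; first last.
  by move=> p px; have [] := mx p px; lia.
move=> m2 hm2 m2m am2 m2c.
case: (eqVneq (m2 x) a) => [e1|e1]; last first.
  have [g1 _] := hm2; have := g1 x nx => g1x.
  by apply: (IHe (m2 x)) => //; lia.
apply: (IHd a.+1) => //; try lia; move=> i ia.
have [ix|ix] := ltnP i x.
  have [? e2] := mx i ix; rewrite (m2m i ix) (m2m (m i)) //; lia.
by rewrite (m2c i) ?e1 //; [rewrite (m2c a) ?e1 //; lia|lia].
Qed.

(* The Hessenberg function of the indifference graph with vertices numbered
   backwards. *)
Definition rev_hess (n : nat) (m : nat -> nat) (i : nat) : nat :=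
  \max_(c < n | (n.-1 - i <= m (n.-1 - c))%N) c.

Lemma hess_ext (n : nat) (m m' : nat -> nat) :
  eq_upto n m m' -> hess n m -> hess n m'.
Proof.
move=> e [h1 h2]; split=> [i iN|i j ij jn]; first by rewrite -e // h1.
by rewrite -!e ?h2 //; lia.
Qed.

(** This adjunction determines [rev_hess] below [n]; reversed functions are identified through it
    and not through the maximum. *)
Lemma leq_rev_hess (n : nat) (m : nat -> nat) (i c : nat) :
  hess n m -> (i < n)%N -> (c < n)%N ->
  (c <= rev_hess n m i)%N = (n.-1 - i <= m (n.-1 - c))%N.
Proof.
move=> [h1 h2] iN cN; apply/idP/idP => [|h]; last first.
  by rewrite /rev_hess (leq_bigmax_cond (Ordinal cN)).
have Pi : (n.-1 - i <= m (n.-1 - Ordinal iN))%N.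
  by have /andP[] := h1 (n.-1 - i)%N ltac:(lia).
rewrite /rev_hess; have [|c0 P0 ->] := @eq_bigmax_cond 'I_n
  [pred c | (n.-1 - i <= m (n.-1 - val c))%N] (fun c => val c).
  by apply/card_gt0P; exists (Ordinal iN).
move=> cc0; apply: leq_trans (P0) _; apply: h2; last lia.
by have := ltn_ord c0; lia.
Qed.

Lemma rev_hessE (n : nat) (m m' : nat -> nat) :
  hess n m -> (forall i, (i < n)%N -> (m' i < n)%N) ->
  (forall i c, (i < n)%N -> (c < n)%N ->
     (c <= m' i)%N = (n.-1 - i <= m (n.-1 - c))%N) ->
  eq_upto n (rev_hess n m) m'.
Proof.
move=> hm m'n h i iN; apply/eqP; rewrite eqn_leq.
have rn : (rev_hess n m i < n)%N.
  rewrite /rev_hess; elim/big_ind: _ => [|x y|[c cn] _ /=]; lia.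
rewrite h // -leq_rev_hess // leqnn /=.
by rewrite leq_rev_hess // ?m'n // -h ?m'n.
Qed.

Lemma rev_hess_hess (n : nat) (m : nat -> nat) :
  hess n m -> hess n (rev_hess n m).
Proof.
move=> hm; have [h1 h2] := hm.
have rn i : (i < n)%N -> (rev_hess n m i < n)%N.
  by move=> iN; rewrite /rev_hess; elim/big_ind: _ => [|x y|[c cn] _ /=]; lia.
split=> [i iN|i j ij jn].
  rewrite rn // leq_rev_hess // andbT.
  by have /andP[] := h1 (n.-1 - i)%N ltac:(lia).
have iN : (i < n)%N by lia.
rewrite leq_rev_hess ?rn //.
have := leq_rev_hess hm iN (rn i iN); rewrite leqnn; lia.
Qed.

Lemma rev_hess_eq_upto (n : nat) (m m' : nat -> nat) :
  eq_upto n m m' -> rev_hess n m =1 rev_hess n m'.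
Proof.
by move=> e i; apply: eq_bigl => c; rewrite e //; have := ltn_ord c; lia.
Qed.

Lemma rev_hessK (n : nat) (m : nat -> nat) :
  hess n m -> eq_upto n (rev_hess n (rev_hess n m)) m.
Proof.
move=> hm; apply: rev_hessE; first exact: rev_hess_hess.
  by move=> i iN; have [h1 _] := hm; have := h1 i iN; lia.
move=> i c iN cN; rewrite leq_rev_hess //; try lia.
by congr (_ <= m _)%N; lia.
Qed.

Lemma modular_rev (n q : nat) (f : (nat -> nat) -> int) :
  modular n q f -> modular n q (fun m => f (rev_hess n m)).
Proof.
move=> [fext frow fcol]; split.
- by move=> m m' e; apply: fext => i _; apply: rev_hess_eq_upto.
- move=> m i j iN R0 R2 mj.
  have [A0 B0] := R0; have [A2 B2] := R2.
  have Ai := A0 i iN; have Ai2 := A2 i iN.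
  rewrite /upd eqxx in Ai Ai2.
  have lo p : (p < i)%N -> (m p <= j)%N.
    by move=> pi; have := B0 p i ltac:(lia) iN; rewrite /upd eqxx ifF //; lia.
  have hi p : (i < p)%N -> (p < n)%N -> (j.+2 <= m p)%N.
    by move=> ip pn; have := B2 i p ltac:(lia) pn; rewrite /upd eqxx ifF //; lia.
  have R1 : hess n (upd m i j.+1).
    split=> [p pn|p p' pp pn].
      by have := A0 p pn; rewrite /upd; case: ifP => ?; lia.
    have := B0 p p' pp pn; have := lo p; have := hi p'; rewrite /upd.
    by do ?[case: ifP => ?]; lia.
  set M := rev_hess n (upd m i j).
  have [M1 M2] : hess n M by apply: rev_hess_hess.
  have Mr := leq_rev_hess R0.
  (* Reversal sends the twins j + 1 and j + 2 to i' + 1 and i', and the vertex [i] to j' + 1. *)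
  pose i' := (n - j - 3)%N; pose j' := (n - 2 - i)%N.
  have D : (i'.+1 < n)%N by lia.
  have E0 : eq_upto n (rev_hess n (upd m i j)) (upd2 M i' j' j').
    apply: rev_hessE => // [k kn|k c kn cn].
      by rewrite /upd2 /upd; have := M1 k kn; do ?[case: ifP => ?]; lia.
    rewrite {1}/upd2 {1 2}/upd; have := lo (n.-1 - c)%N; have := hi (n.-1 - c)%N.
    case: ifP => k1; [|case: ifP => k2; last by rewrite Mr].
      by rewrite /upd; do ?[case: ifP => ?]; lia.
    by rewrite /upd; do ?[case: ifP => ?]; lia.
  have E1 : eq_upto n (rev_hess n (upd m i j.+1)) (upd2 M i' j' j'.+1).
    apply: rev_hessE => // [k kn|k c kn cn].
      by rewrite /upd2 /upd; have := M1 k kn; do ?[case: ifP => ?]; lia.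
    rewrite {1}/upd2 {1 2}/upd; have := lo (n.-1 - c)%N; have := hi (n.-1 - c)%N.
    case: ifP => k1; [|case: ifP => k2; last rewrite Mr //].
    - by rewrite /upd; do ?[case: ifP => ?]; lia.
    - by rewrite /upd; do ?[case: ifP => ?]; lia.
    - by rewrite /upd; do ?[case: ifP => ?]; lia.
  have E2 : eq_upto n (rev_hess n (upd m i j.+2)) (upd2 M i' j'.+1 j'.+1).
    apply: rev_hessE => // [k kn|k c kn cn].
      by rewrite /upd2 /upd; have := M1 k kn; do ?[case: ifP => ?]; lia.
    rewrite {1}/upd2 {1 2}/upd; have := lo (n.-1 - c)%N; have := hi (n.-1 - c)%N.
    case: ifP => k1; [|case: ifP => k2; last rewrite Mr //].
    - by rewrite /upd; do ?[case: ifP => ?]; lia.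
    - by rewrite /upd; do ?[case: ifP => ?]; lia.
    - by rewrite /upd; do ?[case: ifP => ?]; lia.
  rewrite (fext _ _ E0) (fext _ _ E1) (fext _ _ E2); apply: fcol => //.
  - by apply: hess_ext E0 _; apply: rev_hess_hess.
  - by apply: hess_ext E2 _; apply: rev_hess_hess.
  - move=> k kn _ _; apply/eqP => Mk.
    have := Mr k i' kn ltac:(lia); have := Mr k i'.+1 kn D.
    rewrite -/M Mk leqnn ltnn.
    have -> : (n.-1 - i')%N = j.+2 by lia.
    have -> : (n.-1 - i'.+1)%N = j.+1 by lia.
    by rewrite /upd !ifF ?mj => [<-||] //; lia.
- move=> m i j iN R0 R2 mi.
  have [A0 B0] := R0; have [A2 B2] := R2.
  have Ai := A0 i.+1 iN; have Ai2 := A2 i.+1 iN.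
  rewrite /upd2 /upd eqxx in Ai Ai2.
  have lo p : (p < i)%N -> (m p <= j)%N.
    by move=> pi; have := B0 p i ltac:(lia) ltac:(lia); rewrite /upd2 /upd eqxx !ifF //; lia.
  have hi p : (i.+1 < p)%N -> (p < n)%N -> (j.+1 <= m p)%N.
    by move=> ip pn; have := B2 i.+1 p ltac:(lia) pn; rewrite /upd2 /upd eqxx !ifF //; lia.
  have R1 : hess n (upd2 m i j j.+1).
    split=> [p pn|p p' pp pn].
      by have := A0 p pn; rewrite /upd2 /upd; do ?[case: ifP => ?]; lia.
    have := B0 p p' pp pn; have := lo p; have := hi p'; rewrite /upd2 /upd.
    by do ?[case: ifP => ?]; lia.
  set M := rev_hess n (upd2 m i j j).
  have [M1 M2] : hess n M by apply: rev_hess_hess.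
  have Mr := leq_rev_hess R0.
  (* Reversal sends the twins [i] and i + 1 to j' + 2 and j' + 1, and the vertex j + 1 to i'. *)
  pose i' := (n - 2 - j)%N; pose j' := (n - 3 - i)%N.
  have E0 : eq_upto n (rev_hess n (upd2 m i j j)) (upd M i' j').
    apply: rev_hessE => // [k kn|k c kn cn].
      by rewrite /upd; have := M1 k kn; do ?[case: ifP => ?]; lia.
    rewrite {1}/upd; have := lo (n.-1 - c)%N; have := hi (n.-1 - c)%N.
    case: ifP => k1; last by rewrite Mr.
    by rewrite /upd2 /upd; do ?[case: ifP => ?]; lia.
  have E1 : eq_upto n (rev_hess n (upd2 m i j j.+1)) (upd M i' j'.+1).
    apply: rev_hessE => // [k kn|k c kn cn].
      by rewrite /upd; have := M1 k kn; do ?[case: ifP => ?]; lia.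
    rewrite {1}/upd; have := lo (n.-1 - c)%N; have := hi (n.-1 - c)%N.
    case: ifP => k1; last rewrite Mr //.
      by rewrite /upd2 /upd; do ?[case: ifP => ?]; lia.
    by rewrite /upd2 /upd; do ?[case: ifP => ?]; lia.
  have E2 : eq_upto n (rev_hess n (upd2 m i j.+1 j.+1)) (upd M i' j'.+2).
    apply: rev_hessE => // [k kn|k c kn cn].
      by rewrite /upd; have := M1 k kn; do ?[case: ifP => ?]; lia.
    rewrite {1}/upd; have := lo (n.-1 - c)%N; have := hi (n.-1 - c)%N.
    case: ifP => k1; last rewrite Mr //.
      by rewrite /upd2 /upd; do ?[case: ifP => ?]; lia.
    by rewrite /upd2 /upd; do ?[case: ifP => ?]; lia.
  rewrite (fext _ _ E0) (fext _ _ E1) (fext _ _ E2); apply: frow; first lia.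
  - by apply: hess_ext E0 _; apply: rev_hess_hess.
  - by apply: hess_ext E2 _; apply: rev_hess_hess.
  - apply/eqP; rewrite eqn_leq M2 ?andTb; try lia.
    have cn : (M j'.+2 < n)%N by have := M1 j'.+2 ltac:(lia); lia.
    rewrite Mr ?cn //; last lia.
    have := Mr j'.+2 (M j'.+2) ltac:(lia) cn; rewrite -/M leqnn.
    have := mi (n.-1 - M j'.+2)%N ltac:(lia); rewrite /upd2 /upd.
    by do ?[case: ifP => ?]; lia.
Qed.

Lemma modularB (n q : nat) (f g : (nat -> nat) -> int) :
  modular n q f -> modular n q g -> modular n q (fun m => f m - g m).
Proof.
move=> [f1 f2 f3] [g1 g2 g3]; split.
- by move=> m m' e; rewrite (f1 m m') // (g1 m m').
- by move=> m i j *; rewrite !mulrBr f2 // g2 //; ring.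
- by move=> m i j *; rewrite !mulrBr f3 // g3 //; ring.
Qed.

(* The complement of such a graph is bipartite, with parts {0, ..., b - 1} and
   {b, ..., n - 1}. *)
Lemma rev_bipartite (q n : nat) (f : (nat -> nat) -> int) :
  (0 < q)%N -> (0 < n)%N -> modular n q f ->
  forall b, (b + b <= n)%N ->
  forall m, hess n m -> (b <= (m 0).+1)%N ->
    (forall i, (b <= i < n)%N -> m i = n.-1) -> f (rev_hess n m) = f m.
Proof.
move=> q0 n0 Mf; elim/ltn_ind => b IHb bn m0 hm0 m0b m0n.
have Mg := modularB Mf (modular_rev Mf).
pose g m := f m - f (rev_hess n m).
suff key e : forall v, (n.-1 - v)%N = e -> (b <= v.+1)%N -> forall m,
    hess n m -> (v <= m 0)%N -> (forall i, (b <= i < n)%N -> m i = n.-1) ->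
    g m = 0.
  apply/esym/eqP; rewrite -subr_eq0; apply/eqP.
  by apply: (key _ (m0 0%N)).
elim/ltn_ind: e => e IHe v nv bv m hm mv mn.
have [h1 h2] := hm; have h10 := h1 0%N n0.
(* The missing edges form a Ferrers shape with at most [b] rows and n - 1 - v columns. If this
   allows fewer columns than rows, reversal exchanges them and the induction on [b] applies. *)
have [vn|vn] := leqP (n - b)%N v.
  have b0 : (0 < b)%N by lia.
  have hr := rev_hess_hess hm; have Rm := leq_rev_hess hm.
  have e1 : f (rev_hess n (rev_hess n m)) = f m.
    by apply: (modular_ext Mf); apply: rev_hessK.
  rewrite /g -{1}e1; apply/eqP; rewrite subr_eq0; apply/eqP.
  apply: (IHb (n.-1 - m 0)%N) => //; try lia.
    have [->|mn0] := posnP (n.-1 - m 0)%N; first lia.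
    have := Rm 0%N (n.-1 - m 0%N).-1 n0 ltac:(lia).
    by rewrite (mn (n.-1 - _)%N); lia.
  move=> i hi; apply/eqP; rewrite eqn_leq Rm; try lia.
  by have [/(_ i) r1 _] := hr; rewrite subnn; lia.
have bh r : in_box 0%N b v (n.-1 - v) m r -> hess n r.
  move=> [B1 B2 B3]; split=> [i iN|i j ij jn].
    have [ib|ib] := ltnP i b; first by have := B2 i ib; lia.
    by rewrite B1 ?mn; lia.
  have [jb|jb] := ltnP j b; first by apply: B3; lia.
  rewrite (B1 j) ?mn; try lia.
  have [ib|ib] := ltnP i b; first by have := B2 i ib; lia.
  by rewrite B1 ?mn; lia.
have mbox : in_box 0%N b v (n.-1 - v) m m.
  split=> // [i hi|i j _ ij jb]; last by apply: h2; lia.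
  by have := h2 0%N i; have := h1 i; lia.
apply: (box_vanish q0 (g := g) (T := b) (x := 0%N)) mbox.
- move=> r i j hi R0 R2; have [A0 A1 _] := R2.
  apply: (modular_row Mg); try lia; try exact: bh.
  have := A1 i hi; rewrite /upd eqxx => ?.
  have [_ /(_ i hi) + _] := R0; rewrite /upd eqxx => ?.
  have rE p : (b <= p)%N -> r p = m p.
    by move=> bp; rewrite -A0 /upd ?ifF //; lia.
  by rewrite !rE ?mn; lia.
- move=> r i j _ it R0 R2; apply: (modular_col Mg); try lia; try exact: bh.
  have [B1 B2 _] := R0; move=> p pn pi pi1.
  have <- : upd2 r i j j p = r p by rewrite /upd2 /upd !ifF //; lia.
  by have [/B2|pb] := ltnP p b; [|rewrite B1 ?mn]; lia.
- move=> r R k0 hr; have [B1 B2 _] := R.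
  apply: (IHe (n.-1 - v.+1)%N _ v.+1) => //; try lia.
  + exact: bh.
  + by have [b0|bp] := posnP b; [rewrite B1 ?mn; lia|apply: hr].
  + by move=> i hi; rewrite B1 ?mn; lia.
(* Together with [vn], [kb] forces n - 1 - v = b: the missing edges form a square, and the graph is
   its own reversal. *)
- move=> r R kb hr; have [B1 B2 _] := R.
  apply/eqP; rewrite subr_eq0; apply/eqP; apply: (modular_ext Mf) => i iN.
  apply/esym; apply: (rev_hessE (bh r R)) => // [k kn|k c kn cn].
    by have [h _] := bh r R; have := h k kn; lia.
  have rE p : (p < n)%N -> r p = if (p < b)%N then v else n.-1.
    by move=> pn; case: ifP => pb; [apply: hr|rewrite B1 ?mn]; lia.
  by rewrite !rE; try lia; do ?[case: ifP => ?]; lia.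
Qed.

(** * Disjoint unions of complete graphs *)

Fixpoint cliques (l : seq nat) (i : nat) : nat :=
  if l is k :: l' then if (i < k)%N then k.-1 else (k + cliques l' (i - k))%N
  else i.

Lemma cliques_cat (l l' : seq nat) (i : nat) :
  cliques (l ++ l') i = if (i < sumn l)%N then cliques l i
                        else (sumn l + cliques l' (i - sumn l))%N.
Proof.
elim: l i => [|k l IH] i /=; first by rewrite subn0.
rewrite IH; do ?[case: ifP => ?]; try lia.
by rewrite addnA subnDA.
Qed.

Lemma hess_cliques (l : seq nat) : hess (sumn l) (cliques l).
Proof.
elim: l => [|k l [h1 h2]] //=; split=> [i iN|i j ij jn].
  by case: ifP => ik; [lia|have := h1 (i - k)%N; lia].
case: ifP => ik; case: ifP => jk; try lia.
by rewrite leq_add2l h2; lia.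
Qed.

(** The complement of two disjoint complete graphs is complete bipartite, and reversal exchanges
    their sizes. Taking [b] as the smaller size meets the condition [b + b <= n] of
    [rev_bipartite]. *)
Lemma two_cliques_swap (q a b : nat) (f : (nat -> nat) -> int) :
  (0 < q)%N -> modular (a + b) q f -> f (cliques [:: a; b]) = f (cliques [:: b; a]).
Proof.
move=> q0; wlog ba : a b / (b <= a)%N.
  move=> W Mf; have [ba|ab] := leqP b a; first exact: (W a b).
  by apply/esym; apply: (W b a); [lia|rewrite addnC].
move=> Mf; have [n0|n0] := posnP (a + b)%N.
  by apply: (modular_ext Mf) => i; rewrite n0.
have hb : hess (a + b) (cliques [:: b; a]).
  by have := hess_cliques [:: b; a]; rewrite /= addn0 addnC.
have ha : hess (a + b) (cliques [:: a; b]).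
  by have := hess_cliques [:: a; b]; rewrite /= addn0.
rewrite -(rev_bipartite q0 n0 Mf (_ : (b + b <= a + b)%N) hb); try lia.
- apply: (modular_ext Mf) => i iN; apply/esym; apply: rev_hessE => //.
    by move=> k kn; have [h _] := ha; have := h k kn; lia.
  by move=> k c kn cn /=; do ?[case: ifP => ?]; lia.
- by move=> /=; do ?[case: ifP => ?]; lia.
- by move=> i hi /=; do ?[case: ifP => ?]; lia.
Qed.

(** Both laws pass to the segment because no row outside it ends inside it: earlier rows end before
    [x], and later ones at or after their own index. *)
Lemma modular_segment (q n x w : nat) (m : nat -> nat)
    (f : (nat -> nat) -> int) :
  hess n m -> (x + w <= n)%N -> (forall p, (p < x)%N -> (m p < x)%N) ->
  modular n q f ->
  modular w q (fun g => f (fun k => if (k < x)%N then m k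
                   else if (k < x + w)%N then (x + g (k - x))%N else m k)).
Proof.
move=> [h1 h2] xw mx [fext frow fcol].
set E := fun (g : nat -> nat) k => if (k < x)%N then m k
                   else if (k < x + w)%N then (x + g (k - x))%N else m k.
have hE g : hess w g -> hess n (E g).
  move=> [g1 g2]; split=> [i iN|i j ij jn]; rewrite /E.
    by have := h1 i iN; have := g1 (i - x)%N; do ?[case: ifP => ?]; lia.
  have := h1 j; have := h2 i j ij jn; have := mx i; have := g1 (i - x)%N.
  by have := g2 (i - x)%N (j - x)%N; do ?[case: ifP => ?]; lia.
have Eu g i j : (i < w)%N -> E (upd g i j) = upd (E g) (x + i) (x + j).
  move=> iw; apply: functional_extensionality => k; rewrite /E /upd.
  by do ?[case: ifP => ?]; lia.
change (modular w q (fun g => f (E g))); split; cbv beta.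
- move=> g g' e; apply: fext => k _; rewrite /E; do ?[case: ifP => //] => k1 k2.
  by rewrite e //; lia.
- move=> g i j iw; rewrite !Eu // => R0 R2 gj.
  move: (hE _ R0) (hE _ R2); rewrite !Eu // !addnS => R0' R2'.
  apply: frow => //; first lia.
  have [r _] := R2; have := r i iw; rewrite /upd eqxx => hj.
  have Ej k : (k < w)%N -> E g (x + k)%N = (x + g k)%N.
    by move=> kw; rewrite /E ifF ?ifT ?addKn //; lia.
  by rewrite -!addnS !Ej ?gj //; lia.
- move=> g i j iw; rewrite /upd2 !Eu //; try lia.
  move=> R0 R2 gi; move: (hE _ R0) (hE _ R2).
  rewrite !Eu ?addnS; try lia; move=> R0' R2'.
  apply: fcol => //; first lia.
  move=> k kn k1 k2; rewrite /E; case: ifP => kx; first by have := mx k; lia.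
  case: ifP => kw; last by have := h1 k kn; lia.
  by have := gi (k - x)%N; lia.
Qed.

Lemma adjacent_swap_perm (T : eqType) (A : Type) (phi : seq T -> A) :
  (forall b x y c, phi (b ++ x :: y :: c) = phi (b ++ y :: x :: c)) ->
  forall s t, perm_eq s t -> phi s = phi t.
Proof.
move=> sw s t st; suff key b : phi (b ++ s) = phi (b ++ t) by exact: (key [::]).
elim: s t st b => [|x s IH] t st b.
  by have := perm_size st; case: t {st}.
have xt : x \in t by rewrite -(perm_mem st) mem_head.
case/splitPr: xt st => t1 t2 st.
have -> : phi (b ++ t1 ++ x :: t2) = phi (b ++ x :: t1 ++ t2).
  elim/last_ind: t1 t2 {st} => [|t1 y IHt] t2 //.
  by rewrite !cat_rcons -IHt catA sw -catA.
rewrite -!(cat_rcons x b); apply: IH.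
by rewrite -(perm_cons x) (perm_trans st) // -[x :: t2]cat1s perm_catCA.
Qed.

Lemma cliques_perm (q n : nat) (f : (nat -> nat) -> int) (l l' : seq nat) :
  (0 < q)%N -> modular n q f -> sumn l = n -> perm_eq l l' ->
  f (cliques l) = f (cliques l').
Proof.
move=> q0 Mf ln ll'.
(* The default 0 is there because [adjacent_swap_perm] ranges over sequences of any sum. *)
pose phi s := if sumn s == n then f (cliques s) else 0.
suff: phi l = phi l' by rewrite /phi -(perm_sumn ll') ln eqxx.
apply: adjacent_swap_perm ll' => b x y c; rewrite /phi !sumn_cat /= (addnCA y).
case: eqP => // e; set m := cliques (b ++ x :: y :: c).
have hm : hess n m by have := hess_cliques (b ++ x :: y :: c); rewrite sumn_cat /= e.
have mb p : (p < sumn b)%N -> (m p < sumn b)%N.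
  move=> pb; rewrite /m cliques_cat pb.
  by have [h _] := hess_cliques b; have := h p pb; lia.
have := two_cliques_swap q0 (modular_segment hm (w := x + y) _ mb Mf).
have E u v : (u + v = x + y)%N -> eq_upto n (fun k => if (k < sumn b)%N then m k
     else if (k < sumn b + (x + y))%N then (sumn b + cliques [:: u; v] (k - sumn b))%N
     else m k) (cliques (b ++ u :: v :: c)).
  move=> uv k kn; rewrite /m !cliques_cat /=; have [kb|kb] := ltnP k (sumn b); first by [].
  have [kx|kx] := ltnP k (sumn b + (x + y)); do ?[case: ifP => ?]; try lia.
  have -> : (k - sumn b - x - y = k - sumn b - u - v)%N by lia.
  lia.
by rewrite (modular_ext Mf (E x y _)) // (modular_ext Mf (E y x _)) 1?addnC //; apply; lia.
Qed.

Lemma idempotent_cliques (n : nat) (m : nat -> nat) :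
  hess n m -> (forall i, (i < n)%N -> m (m i) = m i) ->
  exists l, [/\ all (ltn 0) l, sumn l = n & eq_upto n m (cliques l)].
Proof.
move=> [h1 h2] mm.
suff key d : forall x, (n - x <= d)%N -> (x <= n)%N ->
    (forall i, (i < x)%N -> (m i < x)%N) -> exists l,
    [/\ all (ltn 0) l, sumn l = (n - x)%N &
        forall i, (i < n - x)%N -> m (x + i)%N = (x + cliques l i)%N].
  have [|//||l [l0 ln lm]] := key n 0%N; first lia.
    by move=> i; lia.
  exists l; split; rewrite ?ln ?subn0 // => i iN.
  by have := lm i; rewrite !add0n; apply; lia.
elim: d => [|d IH] x nd xn mx.
  by exists [::]; split=> //=; [lia|move=> i; lia].
have [nx|nx] := leqP n x.
  by exists [::]; split=> //=; [lia|move=> i; lia].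
have mxx := h1 x nx.
have mc i : (x <= i <= m x)%N -> m i = m x.
  move=> hi; have := h2 x i ltac:(lia) ltac:(lia).
  by have := h2 i (m x) ltac:(lia) ltac:(lia); rewrite mm //; lia.
have [|||l [l0 ln lm]] := IH (m x).+1; try lia.
  move=> i hi; have [/mx|xi] := ltnP i x; first lia.
  by rewrite mc; lia.
exists (((m x).+1 - x)%N :: l); split=> /=.
- by rewrite l0 andbT; lia.
- by rewrite ln; lia.
- move=> i iN; case: ifP => hi; first by rewrite mc; lia.
  have := lm (i - ((m x).+1 - x))%N ltac:(lia).
  have -> : ((m x).+1 + (i - ((m x).+1 - x)) = x + i)%N by lia.
  by move=> ->; lia.
Qed.

Theorem modular_vanish (q n : nat) (f : (nat -> nat) -> int) :
  (0 < q)%N -> modular n q f ->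
  (forall l, sorted geq l -> all (ltn 0) l -> sumn l = n -> f (cliques l) = 0) ->
  forall m, hess n m -> f m = 0.
Proof.
move=> q0 Mf Hl; apply: (cliques_vanish q0 Mf) => m hm mm.
have [l [l0 ln lm]] := idempotent_cliques hm mm.
rewrite (modular_ext Mf lm).
have ps : perm_eq l (sort geq l) by rewrite perm_sym perm_sort.
rewrite (cliques_perm q0 Mf ln ps) Hl //.
- by apply: sort_sorted => x y; lia.
- by rewrite -(perm_all _ ps).
- by rewrite -(perm_sumn ps).
Qed.

Lemma card_bij (T U : finType) (A : pred T) (B : pred U) (f : T -> U) (g : U -> T) :
  (forall x, A x -> B (f x) /\ g (f x) = x) ->
  (forall y, B y -> A (g y) /\ f (g y) = y) -> #|A| = #|B|.
Proof.
move=> fA gB; apply/eqP; rewrite eqn_leq; apply/andP; split.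
  have fi : {in A &, injective f}.
    by move=> x y xA yA e; rewrite -(proj2 (fA x xA)) e (proj2 (fA y yA)).
  rewrite -(card_in_image fi); apply/subset_leq_card/subsetP => y /imageP[x xA ->].
  exact: (proj1 (fA x xA)).
have gi : {in B &, injective g}.
  by move=> x y xA yA e; rewrite -(proj2 (gB x xA)) e (proj2 (gB y yA)).
rewrite -(card_in_image gi); apply/subset_leq_card/subsetP => y /imageP[x xA ->].
exact: (proj1 (gB x xA)).
Qed.

(** * Strips and the Pieri rules *)

Section Shapes.
Variable n : nat.

(** The type underlying [partn n], so that [val] turns a partition into a shape. Row lengths and the
    number of rows are both at most [n], which is the origin of the size bounds in the Pieri
    rules. *)
Definition shape : predArgType := n.-tuple 'I_n.+1.

HB.instance Definition _ := Finite.on shape.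

Implicit Types t u v w r : shape.

Definition rowlen t (i : nat) : nat := nth 0%N [seq val x | x <- t] i.

(** [inord] sends values above [n] to 0, so the entries of [g] have to be bounded before they can be
    read back. *)
Definition mkshape (g : nat -> nat) : shape := [tuple inord (g i) | i < n].

Definition psize t : nat := (\sum_(i < n) rowlen t i)%N.

Definition nil_shape : shape := mkshape (fun=> 0%N).

(* The skew shape t / u is a horizontal strip. *)
Definition hstrip t u : bool :=
  [forall i : 'I_n, (rowlen u i <= rowlen t i)%N && (rowlen t i.+1 <= rowlen u i)%N].

Definition decr t : bool := [forall i : 'I_n, rowlen t i.+1 <= rowlen t i]%N.

(** Interlacing forces both shapes of a horizontal strip to be decreasing. Adding at most one cell
    per row does not, whence the conjunct [decr t]. *)
Definition vstrip t u : bool :=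
  decr t && [forall i : 'I_n, rowlen u i <= rowlen t i <= (rowlen u i).+1]%N.

Lemma rowlen_out t i : (n <= i)%N -> rowlen t i = 0%N.
Proof. by move=> ni; rewrite /rowlen nth_default // size_map size_tuple. Qed.

Lemma rowlen_le t i : (rowlen t i <= n)%N.
Proof.
have [ni|ni] := leqP n i; first by rewrite rowlen_out.
by rewrite /rowlen (nth_map ord0) ?size_tuple // -ltnS ltn_ord.
Qed.

Lemma rowlen_mkshape (g : nat -> nat) i :
  (i < n)%N -> (g i <= n)%N -> rowlen (mkshape g) i = g i.
Proof.
move=> ni gi; rewrite /rowlen (nth_map ord0) ?size_tuple //.
by rewrite -[i]/(val (Ordinal ni)) -tnth_nth tnth_mktuple /= inordK.
Qed.

Lemma shapeP t u : (forall i, (i < n)%N -> rowlen t i = rowlen u i) -> t = u.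
Proof.
move=> e; apply: eq_from_tnth => i; apply: val_inj.
have := e i (ltn_ord i); rewrite /rowlen !(nth_map ord0) ?size_tuple //.
by rewrite -!tnth_nth.
Qed.

Lemma hstripP t u :
  reflect (forall i, (rowlen u i <= rowlen t i)%N /\ (rowlen t i.+1 <= rowlen u i)%N)
          (hstrip t u).
Proof.
apply: (iffP forallP) => [h i|h i]; last by apply/andP; exact: h.
have [ni|ni] := leqP n i; last by apply/andP: (h (Ordinal ni)).
by rewrite !rowlen_out //; lia.
Qed.

Lemma decrP t :
  reflect (forall i, rowlen t i.+1 <= rowlen t i)%N (decr t).
Proof.
apply: (iffP forallP) => [h i|h i]; last exact: h.
have [ni|ni] := leqP n i; last exact: (h (Ordinal ni)).
by rewrite !rowlen_out //; lia.
Qed.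

Lemma vstripP t u :
  reflect (decr t /\ forall i, rowlen u i <= rowlen t i <= (rowlen u i).+1)%N
          (vstrip t u).
Proof.
apply: (iffP andP) => -[d h]; split=> //; last by apply/forallP => i; exact: h.
move=> i; have [ni|ni] := leqP n i; last exact: (forallP h (Ordinal ni)).
by rewrite !rowlen_out.
Qed.

Lemma decr_le t i j : decr t -> (i <= j)%N -> (rowlen t j <= rowlen t i)%N.
Proof.
move=> /decrP d; elim: j => [|j IH]; first by rewrite leqn0 => /eqP->.
by rewrite leq_eqVlt => /orP[/eqP->//|/IH]; apply: leq_trans.
Qed.

Lemma hstrip_decr t u : hstrip t u -> decr t /\ decr u.
Proof.
move=> /hstripP h; split; apply/decrP => i.
  by have [a b] := h i; lia.
by have [a b] := h i; have [c d] := h i.+1; lia.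
Qed.

Lemma leq_psize t u : (forall i, rowlen u i <= rowlen t i)%N -> (psize u <= psize t)%N.
Proof. by move=> h; apply: leq_sum => i _. Qed.

Lemma eq_of_psize t u :
  (forall i, rowlen u i <= rowlen t i)%N -> (psize t <= psize u)%N -> t = u.
Proof.
move=> h s; apply: shapeP => i ni; apply/eqP; move: s.
rewrite /psize (bigD1 (Ordinal ni)) //= [X in (_ <= X)%N](bigD1 (Ordinal ni)) //=.
set a := (\sum_(_ < _ | _) _)%N; set b := (\sum_(_ < _ | _) _)%N.
have : (b <= a)%N by apply: leq_sum => j _.
by have := h i; lia.
Qed.

Lemma psize_shift t : (\sum_(i < n) rowlen t i.+1 + rowlen t 0 = psize t)%N.
Proof.
rewrite /psize; have := erefl (\sum_(i < n.+1) rowlen t i)%N.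
rewrite {1}big_ord_recl big_ord_recr /= (rowlen_out t (leqnn n)) addn0 => <-.
by rewrite addnC; congr (_ + _)%N; apply: eq_bigr.
Qed.

Lemma psize_nil : psize nil_shape = 0%N.
Proof. by rewrite /psize big1 // => i _; rewrite rowlen_mkshape. Qed.

Lemma rowlen_nil i : rowlen nil_shape i = 0%N.
Proof.
by have [ni|ni] := leqP n i; [rewrite rowlen_out|rewrite rowlen_mkshape].
Qed.

Lemma hstrip_nil u : hstrip nil_shape u = (u == nil_shape).
Proof.
apply/hstripP/eqP => [h|-> i]; last by rewrite !rowlen_nil.
by apply: shapeP => i _; have [] := h i; rewrite rowlen_nil; lia.
Qed.

Lemma hstrip_refl t : decr t -> hstrip t t.
Proof. by move=> /decrP d; apply/hstripP => i; split. Qed.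

Lemma hstrip_psize t u : hstrip t u -> (psize u <= psize t)%N.
Proof. by move/hstripP => h; apply: leq_psize => i; have [] := h i. Qed.

Lemma hstrip_eq t u : hstrip t u -> (psize t <= psize u)%N -> t = u.
Proof. by move/hstripP => h; apply: eq_of_psize => i; have [] := h i. Qed.

Lemma last_row_zero t : decr t -> (psize t < n)%N -> rowlen t n.-1 = 0%N.
Proof.
move=> d pn; apply/eqP; rewrite -leqn0 leqNgt; apply/negP => t0.
have : (\sum_(i < n) 1 <= psize t)%N.
  apply: leq_sum => i _; apply: leq_trans t0 _; apply: decr_le => //.
  by have := ltn_ord i; lia.
by rewrite sum_nat_const card_ord muln1; lia.
Qed.

(* Both sides count interlacing sequences; reflecting each row inside its
   interval of admissible values exchanges the shapes above t, r with those
   below, and the length of the first row records the excess of size. *)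
Lemma card_hstrip_up_down t r s : (s <= n)%N ->
  #|[pred v | [&& hstrip v t, hstrip v r & psize v == s]]| =
  #|[pred w | [&& hstrip t w, hstrip r w & (psize t + psize r <= psize w + s)%N]]|.
Proof.
move=> sn.
(* If [psize r = s], the last row of [r] may be nonempty, but [v = r] and [w = t] are forced. If
   [psize r] is larger, both sets are empty. *)
have [rs|rs|rs] := ltngtP (psize r) s; first last.
- rewrite -rs (eq_card (B := [pred v | (v == r) && hstrip r t])); last first.
    move=> v; rewrite !inE; apply/and3P/andP => [[h1 h2 /eqP e]|[/eqP-> h]].
      have vr : v = r by apply: hstrip_eq h2 _; lia.
      by rewrite -vr.
    by split=> //; apply: hstrip_refl; case: (hstrip_decr h).
  rewrite [RHS](eq_card (B := [pred w | (w == t) && hstrip r t])); last first.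
    move=> w; rewrite !inE; apply/and3P/andP => [[h1 h2 e]|[/eqP-> h]].
      have tw : t = w by apply: hstrip_eq h1 _; lia.
      by rewrite tw.
    by split=> //; apply: hstrip_refl; case: (hstrip_decr h).
  case: (hstrip r t); last by apply: eq_card => v; rewrite !inE ?andbF.
  rewrite (eq_card (B := pred1 r)) ?card1; last by move=> v; rewrite !inE ?andbT.
  by rewrite (eq_card (B := pred1 t)) ?card1 // => v; rewrite !inE ?andbT.
- rewrite !eq_card0 // => v; rewrite !inE; apply/negP => /and3P[h1 h2 h3].
    by have := hstrip_psize h1; lia.
  by have := hstrip_psize h2; have := eqP h3; lia.
case dr: (decr r); last first.
  rewrite !eq_card0 // => v; rewrite !inE; apply/negP => /and3P[_ h _].
    by have [] := hstrip_decr h; rewrite dr.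
  by have [] := hstrip_decr h; rewrite dr.
(* Hence [mn] vanishes at the last index, and reflection produces no row beyond the n-th. *)
have r0 : rowlen r n.-1 = 0%N by apply: last_row_zero => //; lia.
pose mx i := maxn (rowlen t i) (rowlen r i).
pose mn i := minn (rowlen t i) (rowlen r i).
have mxn : mx n = 0%N by rewrite /mx !rowlen_out.
have sm : (\sum_(i < n) mx i.+1 + \sum_(i < n) mn i + mx 0 = psize t + psize r)%N.
  have e : (\sum_(i < n) mx i.+1 + mx 0 = \sum_(i < n) mx i)%N.
    have := erefl (\sum_(i < n.+1) mx i)%N.
    rewrite {1}big_ord_recl big_ord_recr /= mxn addn0 => <-.
    by rewrite addnC; congr (_ + _)%N; apply: eq_bigr.
  rewrite addnAC e /psize -!big_split /=; apply: eq_bigr => i _.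
  by rewrite /mx /mn; lia.
pose F v := mkshape (fun i => mx i.+1 + mn i - rowlen v i.+1)%N.
pose G w := mkshape (fun i => if i is j.+1 then mx i + mn j - rowlen w j
              else mx 0 + (psize w + s - (psize t + psize r)))%N.
have mnn i : (mn i <= n)%N by have := rowlen_le t i; rewrite /mn; lia.
have wE w : (psize w = \sum_(i < n) rowlen w i)%N by [].
apply: (card_bij (f := F) (g := G)) => [v|w] /and3P[/hstripP ht /hstripP hr /=].
- move/eqP=> vs.
  have vi i : (mx i <= rowlen v i)%N.
    by have [] := ht i; have [] := hr i; rewrite /mx; lia.
  have vi' i : (rowlen v i.+1 <= mn i)%N.
    by have [_] := ht i; have [_] := hr i; rewrite /mn; lia.
  have FE i : (i < n)%N -> rowlen (F v) i = (mx i.+1 + mn i - rowlen v i.+1)%N.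
    by move=> ni; rewrite rowlen_mkshape //; have := vi i.+1; have := mnn i; lia.
  have sF : (psize (F v) + psize v = \sum_(i < n) mx i.+1 + \sum_(i < n) mn i + rowlen v 0)%N.
    rewrite -(psize_shift v) addnA; congr (_ + _)%N.
    rewrite wE -!big_split; apply: eq_bigr => i _ /=; rewrite FE //.
    by have := vi i.+1; have := vi' i; lia.
  split.
    apply/and3P; split; last by have := vi 0%N; lia.
    + apply/hstripP => i; have [ni|ni] := leqP n i; first by rewrite !rowlen_out //; lia.
      rewrite FE //; have := vi i.+1; have := vi' i; rewrite /mx /mn; lia.
    + apply/hstripP => i; have [ni|ni] := leqP n i; first by rewrite !rowlen_out //; lia.
      rewrite FE //; have := vi i.+1; have := vi' i; rewrite /mx /mn; lia.
  apply: shapeP => i ni; rewrite rowlen_mkshape //; last first.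
    case: i ni => [|i] ni; first by have := vi 0%N; have := rowlen_le v 0; lia.
    by rewrite FE; try lia; have := vi i.+1; have := vi' i; have := mnn i; lia.
  case: i ni => [|i] ni; first by have := vi 0%N; lia.
  by rewrite FE; try lia; have := vi i.+1; have := vi' i; lia.
- move=> ws.
  have wi i : (mx i.+1 <= rowlen w i)%N.
    by have [_] := ht i; have [_] := hr i; rewrite /mx; lia.
  have wi' i : (rowlen w i <= mn i)%N.
    by have [] := ht i; have [] := hr i; rewrite /mn; lia.
  have sG : (\sum_(i < n) (mx i.+1 + mn i - rowlen w i) + psize w =
             \sum_(i < n) mx i.+1 + \sum_(i < n) mn i)%N.
    rewrite wE -!big_split; apply: eq_bigr => i _ /=.
    by have := wi i; have := wi' i; lia.
  have G0 : (0 < n)%N -> rowlen (G w) 0 = (mx 0 + (psize w + s - (psize t + psize r)))%N.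
    by move=> ni; rewrite rowlen_mkshape //; lia.
  have GE i : rowlen (G w) i.+1 = (mx i.+1 + mn i - rowlen w i)%N.
    have [ni|ni] := leqP n i.+1; last first.
      by rewrite rowlen_mkshape //; have := mnn i; have := wi i; have := wi' i; lia.
    rewrite rowlen_out //; move: ni; rewrite leq_eqVlt => /orP[/eqP ni|ni].
      have in1 : i = n.-1 by lia.
      have mi0 : mn i = 0%N by rewrite /mn in1 r0 minn0.
      by rewrite -ni mxn mi0.
    by rewrite /mn /mx !rowlen_out //; lia.
  have [n0|n0] := posnP n; first by lia.
  have Gs : psize (G w) = s.
    rewrite -psize_shift G0 //; under eq_bigr do rewrite GE.
    set a := (\sum_(i < n) _)%N in sG *.
    set b := (\sum_(i < n) _)%N in sG sm *.
    set c := (\sum_(i < n) _)%N in sG sm *.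
    by lia.
  split.
    apply/and3P; split; last by rewrite Gs.
    + apply/hstripP => i; rewrite GE; have := wi i; have := wi' i.
      case: i => [|i]; first by rewrite G0 // /mx /mn; lia.
      by rewrite GE; have := wi i; have := wi' i; rewrite /mx /mn; lia.
    + apply/hstripP => i; rewrite GE; have := wi i; have := wi' i.
      case: i => [|i]; first by rewrite G0 // /mx /mn; lia.
      by rewrite GE; have := wi i; have := wi' i; rewrite /mx /mn; lia.
  apply: shapeP => i ni; have := wi i; have := wi' i; have := mnn i => h1 h2 h3.
  by rewrite rowlen_mkshape ?GE; lia.
Qed.

(** The Bender-Knuth involution: for fixed [t] and [v] the rows of [u] range independently over
    intervals from [M i] to [L i]. As the ends of the intervals add up to [psize t + psize v],
    reflecting every row exchanges the two strip sizes. *)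
Lemma card_hstrip_swap t v a b :
  #|[pred u | [&& hstrip t u, hstrip u v, psize t == psize u + a
                & psize u == psize v + b]%N]| =
  #|[pred u | [&& hstrip t u, hstrip u v, psize t == psize u + b
                & psize u == psize v + a]%N]|.
Proof.
pose M i := maxn (rowlen v i) (rowlen t i.+1).
pose L i := if i is j.+1 then minn (rowlen t i) (rowlen v j) else rowlen t 0.
pose F u := mkshape (fun i => M i + L i - rowlen u i)%N.
have sML : (\sum_(i < n) M i + \sum_(i < n) L i = psize t + psize v)%N.
  have Ln0 : L n = 0%N.
    by case: (n) (rowlen_out t (leqnn n)) => [//|n'] /= ->; rewrite min0n.
  have -> : (\sum_(i < n) L i = L 0%N + \sum_(i < n) L i.+1)%N.
    have := erefl (\sum_(i < n.+1) L i)%N.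
    rewrite {1}big_ord_recr big_ord_recl /= Ln0 addn0 => ->.
    by congr (_ + _)%N; apply: eq_bigr.
  rewrite addnCA -big_split -(psize_shift t) addnC -[RHS]addnAC; congr (_ + _)%N.
  by rewrite /psize -big_split; apply: eq_bigr => i _ /=; rewrite /M; lia.
have Ln i : (L i <= n)%N.
  by case: i => [|i] /=; rewrite ?geq_min rowlen_le.
have main a' b' u : [&& hstrip t u, hstrip u v, psize t == psize u + a'
    & psize u == psize v + b']%N -> [&& hstrip t (F u), hstrip (F u) v,
    psize t == psize (F u) + b' & psize (F u) == psize v + a']%N /\ F (F u) = u.
  move=> /and4P[/hstripP tu /hstripP uv /eqP ta /eqP ub].
  have h1 i : (M i <= rowlen u i)%N.
    by have [_] := tu i; have [] := uv i; rewrite /M; lia.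
  have h2 i : (rowlen u i <= L i)%N.
    case: i => [|i]; first by have [] := tu 0%N.
    by have [+ _] := tu i.+1; have [_] := uv i; rewrite /L; lia.
  have FE i : (i < n)%N -> rowlen (F u) i = (M i + L i - rowlen u i)%N.
    by move=> ni; rewrite rowlen_mkshape //; have := h1 i; have := Ln i; lia.
  have sF : (psize (F u) + psize u = psize t + psize v)%N.
    rewrite -sML /psize -!big_split; apply: eq_bigr => i _ /=.
    by rewrite FE //; have := h1 i; have := h2 i; lia.
  have g i : (M i <= rowlen (F u) i)%N /\ (rowlen (F u) i <= L i)%N.
    have [ni|ni] := leqP n i; last by rewrite FE //; have := h1 i; have := h2 i; lia.
    by rewrite rowlen_out //; have := h1 i; rewrite rowlen_out //; lia.
  split; last first.
    apply: shapeP => i ni; rewrite rowlen_mkshape // FE //.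
      by have := h1 i; have := h2 i; lia.
    by have := h1 i; have := h2 i; have := Ln i; lia.
  apply/and4P; split.
  - apply/hstripP => i; have [g1 g2] := g i; split; last by move: g1; rewrite /M; lia.
    by apply: leq_trans g2 _; case: i {g1} => [|i] //; rewrite /L; lia.
  - apply/hstripP => i; have [g1 _] := g i; have [_ g2] := g i.+1.
    by split; [move: g1; rewrite /M|move: g2; rewrite /L]; lia.
  - by apply/eqP; lia.
  - by apply/eqP; lia.
by apply: (card_bij (f := F) (g := F)) => u; apply: main.
Qed.

(** Kostka numbers: a tableau of shape [t] and content [l] is a chain of horizontal strips, the head
    of [l] being the size of the outermost one. *)
Fixpoint kostka (l : seq nat) (t : shape) : nat :=
  if l is k :: l' then
    (\sum_(u : shape | hstrip t u && (psize t == psize u + k)) kostka l' u)%N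
  else (t == nil_shape).

Lemma kostka_swap b x y c t :
  kostka (b ++ x :: y :: c) t = kostka (b ++ y :: x :: c) t.
Proof.
elim: b t => [|k b IH] t; last by rewrite /=; apply: eq_bigr => u _; rewrite IH.
have E x' y' : kostka (x' :: y' :: c) t = (\sum_(v : shape)
   #|[pred u | [&& hstrip t u, hstrip u v, psize t == psize u + x'
                 & psize u == psize v + y']]| * kostka c v)%N.
  rewrite /= (exchange_big_dep xpredT) //=; apply: eq_bigr => v _.
  rewrite sum_nat_const; congr (_ * _)%N; apply: eq_card => u.
  by rewrite /in_mem /= -andbA; congr andb; rewrite andbCA.
by rewrite !cat0s !E; apply: eq_bigr => v _; rewrite card_hstrip_swap.
Qed.

Lemma kostka_perm l l' t : perm_eq l l' -> kostka l t = kostka l' t.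
Proof.
move=> p; apply: (adjacent_swap_perm (phi := kostka^~ t)) p => b x y c.
exact: kostka_swap.
Qed.

Lemma decr_nil : decr nil_shape.
Proof. by apply/decrP => i; rewrite !rowlen_nil. Qed.

Lemma kostka_neq0 l t : (0 < kostka l t)%N -> decr t /\ psize t = sumn l.
Proof.
elim: l t => [|k l IH] t /=.
  by case: eqP => // -> _; rewrite psize_nil; split=> //; exact: decr_nil.
rewrite lt0n sum_nat_eq0 negb_forall => /existsP[u].
rewrite negb_imply -lt0n => /andP[/andP[h /eqP ->] /IH[_ ->]].
by rewrite addnC; case: (hstrip_decr h).
Qed.

Lemma kostka_nil l t : kostka (0%N :: l) t = kostka l t.
Proof.
rewrite /=; case dt: (decr t).
  rewrite (big_pred1 t) // => u; rewrite addn0.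
  apply/andP/eqP => [[h /eqP e]|->]; last by rewrite hstrip_refl.
  by apply/esym/hstrip_eq => //; rewrite e.
rewrite big1 => [|u /andP[/hstrip_decr[d _]]]; last by rewrite d in dt.
by apply/esym/eqP; rewrite -leqn0 leqNgt; apply/negP => /kostka_neq0[]; rewrite dt.
Qed.

Lemma kostka_filter l t : kostka l t = kostka [seq k <- l | 0 < k]%N t.
Proof.
elim: l t => [|[|k] l IH] t //; first by rewrite kostka_nil IH.
by rewrite /=; apply: eq_bigr => u _; rewrite IH.
Qed.

Lemma psize_widen w m : (n <= m)%N -> (\sum_(k < m) rowlen w k = psize w)%N.
Proof.
move=> nm; rewrite /psize (big_ord_widen _ (rowlen w) nm) [RHS]big_mkcond.
by apply: eq_bigr => o _; case: ifP => // /negbT; rewrite -leqNgt => /rowlen_out.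
Qed.

(** If [t / u] is a horizontal strip, row j + 1 of [t] is no longer than row [j] of [u]. Comparing
    the sums of these tails shows that the first i + 1 rows of [t] exceed the first [i] rows of [u]
    by at least the size of the strip. *)
Lemma kostka_dominance l t i :
  (0 < kostka l t)%N -> (sumn (take i l) <= \sum_(j < i) rowlen t j)%N.
Proof.
elim: l t i => [|k l IH] t [|i] //=.
rewrite lt0n sum_nat_eq0 negb_forall => /existsP[u].
rewrite negb_imply -lt0n => /andP[/andP[/hstripP h /eqP e] /IH IHu].
have {IHu} := IHu i.
suff: (k + \sum_(j < i) rowlen u j <= \sum_(j < i.+1) rowlen t j)%N.
  by move=> A B; apply: leq_trans A; rewrite leq_add2l.
have := psize_widen t (leq_addl i.+1 n); have := psize_widen u (leq_addl i n).
rewrite !big_split_ord /= => eu et.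
have aux A B T U p q : (A + U = p -> B + T = q -> q = p + k -> T <= U ->
  k + A <= B)%N by lia.
apply: aux eu et e _; apply: leq_sum => j _.
by have [_] := h (i + j)%N; rewrite addSn.
Qed.

(* Row by row, removing a strip as large as the first row is only possible
   by deleting that row. *)
Lemma kostka_diag l t : (psize t <= n)%N -> sorted geq l -> (size l <= n)%N ->
  (forall i, rowlen t i = nth 0%N l i) -> kostka l t = 1%N.
Proof.
elim: l t => [|k l IH] t tn sl ln tl /=.
  by rewrite (_ : t = nil_shape) ?eqxx //; apply: shapeP => i _; rewrite tl nth_nil rowlen_nil.
have ps := psize_shift t; rewrite tl /= in ps.
pose u0 := mkshape (fun i => rowlen t i.+1).
have u0E i : rowlen u0 i = rowlen t i.+1.
  have [ni|ni] := leqP n i; first by rewrite !rowlen_out //; lia.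
  by rewrite rowlen_mkshape // rowlen_le.
have su0 : (psize u0 + k = psize t)%N.
  by rewrite -ps; congr (_ + _)%N; apply: eq_bigr => i _; rewrite u0E.
have td i : (rowlen t i.+1 <= rowlen t i)%N.
  rewrite !tl; have [il|il] := ltnP i.+1 (size (k :: l)); last by rewrite nth_default.
  have tr : transitive geq by move=> y x z /=; lia.
  have rf : reflexive geq by move=> x /=.
  by apply: (sorted_leq_nth tr rf 0%N sl) => //; rewrite inE //=; exact: ltnW il.
rewrite (big_pred1 u0) => [|u].
  apply: IH => //; [lia|exact: path_sorted sl|exact: ltnW ln|].
  by move=> i; rewrite u0E tl.
apply/andP/eqP => [[/hstripP h /eqP e]|->].
  apply: eq_of_psize => [i|]; last by lia.
  by rewrite u0E; have [] := h i.
split; last by rewrite su0.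
by apply/hstripP => i; rewrite u0E.
Qed.

Lemma sumr_card (R : comNzRingType) (T : finType) (P : pred T) (c : R) :
  \sum_(i | P i) c = #|P|%:R * c.
Proof. by rewrite mulr_natl -sumr_const; apply: eq_bigl. Qed.

(* If u / t is a vertical strip and r / u a horizontal one with r <> t, then
   in the last row where r exceeds t the cell following the row of t may be
   moved freely between the two strips. *)
Lemma strip_cancel t r : decr t -> (psize t < psize r)%N ->
  \sum_(u : shape | vstrip u t && hstrip r u) (-1) ^+ (psize u) = 0 :> int.
Proof.
move=> dt tr.
case: (boolP [exists i : 'I_n, rowlen t i < rowlen r i]%N) => [|H]; last first.
  suff : (psize r <= psize t)%N by lia.
  apply: leq_sum => i _; move/existsPn: H => /(_ i); lia.
case/existsP => i0 ti0.
have [/= i1 Hi1 mi1] := @arg_maxnP _ i0 [pred i : 'I_n | rowlen t i < rowlen r i]%N (fun i => i : nat) ti0.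
have mi j : (i1 < j)%N -> (rowlen r j <= rowlen t j)%N.
  have [nj|nj] := leqP n j; first by rewrite !rowlen_out.
  move=> ij; rewrite leqNgt; apply/negP => h.
  by have := mi1 (Ordinal nj) h; rewrite /=; lia.
(* In row [i1] the map u -> 2 t + 1 - u exchanges the two lengths t and t + 1 that a vertical strip
   allows. *)
pose F u := mkshape (fun i => if i == i1 then ((rowlen t i).*2.+1 - rowlen u i)%N else rowlen u i).
have FE u i : (i < n)%N -> vstrip u t -> rowlen (F u) i =
    if i == i1 then ((rowlen t i).*2.+1 - rowlen u i)%N else rowlen u i.
  move=> ni /vstripP[_ /(_ i) ui]; rewrite rowlen_mkshape //.
  case: eqP => [e|_]; last exact: rowlen_le.
  by have := rowlen_le r i; move: Hi1; rewrite -e; lia.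
have FP u : vstrip u t && hstrip r u -> [/\ vstrip (F u) t, hstrip r (F u),
    F (F u) = u & ((-1) ^+ psize (F u) = - (-1) ^+ psize u :> int)].
  move=> /andP[vu /hstripP ru]; have [/decrP du ut] := vstripP _ _ vu.
  have FE' i : rowlen (F u) i =
    if i == i1 then ((rowlen t i).*2.+1 - rowlen u i)%N else rowlen u i.
    have [ni|ni] := leqP n i; last exact: FE.
    by rewrite !rowlen_out // ifF //; have := ltn_ord i1; lia.
  have hF : hstrip r (F u).
    apply/hstripP => i; rewrite FE'; have [a b] := ru i; case: eqP => // ->.
    have := ut i1; have := mi i1.+1 (ltnSn _); have := decrP _ dt i1.
    by move: Hi1; lia.
  have vF : vstrip (F u) t.
    apply/vstripP; split; first by have [] := hstrip_decr hF.
    by move=> i; rewrite FE'; have := ut i; case: eqP; lia.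
  split=> //.
    apply: shapeP => i ni; rewrite FE // FE'; have := ut i; case: eqP => // _; lia.
  rewrite /psize (bigD1 i1) //= [in RHS](bigD1 i1) //= FE' eqxx !exprD.
  rewrite (eq_bigr (fun i : 'I_n => rowlen u i)) => [|i ii]; last first.
    by rewrite FE' ifN.
  rewrite -mulNr; congr (_ * _).
  have [e|e] : rowlen u i1 = rowlen t i1 \/ rowlen u i1 = (rowlen t i1).+1.
  - by have := ut i1; lia.
  - by rewrite e -addnn subSn ?leq_addr // addnK exprS mulN1r.
  - by rewrite e -addnn subSS addnK exprS mulN1r opprK.
set A := \sum_(_ | _) _.
have : A = - A.
  rewrite {1}/A (reindex_onto F F) => [|u /FP[]//]; rewrite -sumrN.
  apply: congr_big => // [u|u].
    apply/andP/idP => [[/FP[v h e _] /eqP e']|/FP[-> -> -> _]//].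
    by rewrite -e' v h.
  by case/andP => /FP[_ _ _ e] /eqP e'; rewrite e' in e; rewrite e opprK.
by lia.
Qed.

Lemma vstrip_psize t u : vstrip t u -> (psize u <= psize t)%N.
Proof. by move=> /vstripP[_ h]; apply: leq_psize => i; case/andP: (h i). Qed.

Lemma vstrip_refl t : decr t -> vstrip t t.
Proof. by move=> d; apply/vstripP; split=> // i; rewrite leqnn leqnSn. Qed.

(* srec is the branching rule of Schur polynomials: u is obtained from t by
   removing the cells that carry the variable x. *)
Section SchurRec.
Variable R : comNzRingType.
Implicit Types (xs : seq R) (k : nat).

Fixpoint srec xs t : R :=
  if xs is x :: xs' then
    \sum_(u : shape | hstrip t u) x ^+ (psize t - psize u) * srec xs' u
  else (t == nil_shape)%:R.

(** [hrec] and [erec] are the complete homogeneous and elementary symmetric polynomials, defined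
    like [srec] by splitting off one variable so that they can be compared by induction on the
    variables. *)
Fixpoint hrec xs k : R :=
  if xs is x :: xs' then \sum_(j < k.+1) x ^+ j * hrec xs' (k - j)
  else (k == 0%N)%:R.

Fixpoint erec xs k : R :=
  if xs is x :: xs' then
    erec xs' k + (if k is j.+1 then x * erec xs' j else 0)
  else (k == 0%N)%:R.

(** Split off one variable [x]. On the left one passes from [t] down to [w] and, by induction, up to
    [r]; on the right up to a shape of size [psize t + k] and then down to [r]. In both cases the
    exponent of [x] is [s - psize r], so it remains to count the intermediate shapes, which is
    [card_hstrip_up_down]. *)
Lemma srec_pieri_h xs t k : (psize t + k <= n)%N ->
  hrec xs k * srec xs t =
  \sum_(u : shape | hstrip u t && (psize u == psize t + k)%N) srec xs u.
Proof.
elim: xs t k => [|x xs IH] t k tk /=.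
  rewrite -natrM mulnb; case: eqP => [->|k0] /=; last first.
    rewrite big1 // => u /andP[h /eqP e]; case: eqP => // u0.
    by move: e; rewrite u0 psize_nil; lia.
  rewrite addn0; case: eqP => [->|t0].
    rewrite (big_pred1 nil_shape) ?eqxx // => u.
    apply/andP/eqP => [[h /eqP e]|->]; last by rewrite hstrip_nil.
    by apply: hstrip_eq h _; rewrite e.
  rewrite big1 // => u /andP[h /eqP e]; case: eqP => // u0; case: t0.
  by rewrite u0 in h e; apply/eqP; rewrite -hstrip_nil.
set s := (psize t + k)%N.
transitivity (\sum_(r : shape)
    #|[pred w | [&& hstrip t w, hstrip r w & (psize t + psize r <= psize w + s)%N]]|%:R *
     (x ^+ (s - psize r) * srec xs r)); last first.
  transitivity (\sum_(r : shape)
      #|[pred v | [&& hstrip v t, hstrip v r & psize v == s]]|%:R *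
      (x ^+ (s - psize r) * srec xs r)).
    by apply: eq_bigr => r _; congr (_%:R * _); apply/esym/card_hstrip_up_down.
  rewrite [RHS](exchange_big_dep xpredT) //=; apply: eq_bigr => r _.
  rewrite -sumr_card; apply: congr_big => // [u|u /andP[_ /andP[_ /eqP->]] //].
  by rewrite /= -andbA; congr andb; rewrite andbC.
transitivity (\sum_(w : shape | hstrip t w) \sum_(r : shape | hstrip r w &&
     (psize t + psize r <= psize w + s)%N) x ^+ (s - psize r) * srec xs r);
  last first.
  rewrite (exchange_big_dep xpredT) //=; apply: eq_bigr => r _.
  by rewrite -sumr_card.
rewrite mulr_sumr; apply: eq_bigr => w tw; have wt := hstrip_psize tw.
rewrite mulr_suml.
rewrite (partition_big (fun r => inord (psize w + k - psize r) : 'I_k.+1) xpredT) //=.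
apply: eq_bigr => j _; have jk := ltn_ord j.
rewrite mulrACA -exprD IH; last lia.
rewrite mulr_sumr; apply: congr_big => // [r|r /andP[rw /eqP e]].
  case rw: (hstrip r w) => //=; have wr := hstrip_psize rw.
  apply/eqP/andP => [e|[e /eqP/(congr1 val)/=]].
    split; first lia.
    by apply/eqP/val_inj; rewrite /= inordK; lia.
  by rewrite inordK; lia.
by congr (_ ^+ _ * _); lia.
Qed.

Lemma srec_nil xs : srec xs nil_shape = 1.
Proof.
elim: xs => [|x xs IH] /=; first by rewrite eqxx.
by rewrite (big_pred1 nil_shape) ?subnn ?mul1r // => u; rewrite /= hstrip_nil.
Qed.

Lemma hprod_expand xs l : (sumn l <= n)%N ->
  \prod_(k <- l) hrec xs k = \sum_(t : shape) (kostka l t)%:R * srec xs t.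
Proof.
elim: l => [|k l IH] /= ln.
  rewrite big_nil (bigD1 nil_shape) //= eqxx mul1r srec_nil big1 ?addr0 // => t.
  by move/negPf->; rewrite mul0r.
rewrite big_cons IH; last lia.
rewrite mulr_sumr.
under [RHS]eq_bigr do rewrite natr_sum mulr_suml.
rewrite [RHS](exchange_big_dep xpredT) //=; apply: eq_bigr => u _.
have [k0|/kostka_neq0[_ ku]] := posnP (kostka l u).
  by rewrite k0 mul0r mulr0 big1 // => t _; rewrite mul0r.
by rewrite mulrCA srec_pieri_h ?mulr_sumr // ku; lia.
Qed.

Lemma hrec_rec x xs k :
  hrec (x :: xs) k.+1 = hrec xs k.+1 + x * hrec (x :: xs) k.
Proof.
rewrite /= big_ord_recl subn0 expr0 mul1r mulr_sumr; congr (_ + _).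
by apply: eq_bigr => j _; rewrite exprS mulrA.
Qed.

Lemma hrec0 xs : hrec xs 0 = 1.
Proof. by elim: xs => [|x xs IH] //=; rewrite big_ord_recl big_ord0 addr0 mul1r. Qed.

Lemma erec0 xs : erec xs 0 = 1.
Proof. by elim: xs => [|x xs IH] //=; rewrite addr0. Qed.

(** This is E(-z) H(z) = 1 in each degree: a new variable x multiplies E(-z) by 1 - xz and H(z) by
    the inverse. *)
Lemma erec_hrec xs m :
  \sum_(j < m.+1) (-1) ^+ j * erec xs j * hrec xs (m - j) = (m == 0%N)%:R.
Proof.
elim: xs m => [|x xs IH] m.
  rewrite big_ord_recl /= expr0 !mul1r subn0 big1 ?addr0 // => j _.
  by rewrite mulr0 mul0r.
rewrite -IH; case: m => [|m]; first by rewrite !big_ord_recl !big_ord0 !erec0 !hrec0.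
set h := hrec (x :: xs).
transitivity (\sum_(j < m.+2) (-1) ^+ j * erec xs j * h (m.+1 - j)%N -
    x * \sum_(j < m.+1) (-1) ^+ j * erec xs j * h (m - j)%N).
  rewrite [x * _]mulr_sumr -sumrN.
  rewrite [LHS]big_ord_recl [X in X + _ = _]/= [in RHS]big_ord_recl /= addr0 -addrA.
  congr (_ + _); rewrite -big_split; apply: eq_bigr => j _ /=.
  by rewrite !exprS subSS; ring.
rewrite [X in X - _ = _]big_ord_recr [RHS]big_ord_recr /= !subnn hrec0.
rewrite [h 0%N]hrec0 addrAC; congr (_ + _).
rewrite [x * _]mulr_sumr -sumrB; apply: eq_bigr => j _.
by rewrite subSn ?[h _.+1]hrec_rec -/h; [ring|have := ltn_ord j; lia].
Qed.

(** Let [V j] be the right-hand side in degree [j]. Its alternating convolution with the [hrec] is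
    computed by the rule for [hrec] and [strip_cancel], and equals that of the products of
    [erec xs j] with [srec xs t]. As [hrec xs 0 = 1], the two sequences agree by induction. *)
Lemma srec_pieri_e xs t k : decr t -> (psize t + k <= n)%N ->
  erec xs k * srec xs t =
  \sum_(u : shape | vstrip u t && (psize u == psize t + k)%N) srec xs u.
Proof.
move=> dt; elim/ltn_ind: k => k IH tk.
pose V j := \sum_(u : shape | vstrip u t && (psize u == psize t + j)%N) srec xs u.
have cancel : \sum_(j < k.+1) (-1) ^+ j * V j * hrec xs (k - j) =
    (k == 0%N)%:R * srec xs t.
  transitivity (\sum_(j < k.+1) \sum_(u : shape | vstrip u t && (psize u == psize t + j)%N)
    \sum_(r : shape | hstrip r u && (psize r == psize t + k)%N)
      (-1) ^+ (psize u) * (-1) ^+ (psize t) * srec xs r).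
    apply: eq_bigr => j _; have jk := ltn_ord j.
    rewrite -mulrA mulr_suml mulr_sumr; apply: eq_bigr => u /andP[_ /eqP uj].
    rewrite [srec _ _ * _]mulrC srec_pieri_h uj; last lia.
    rewrite mulr_sumr; apply: eq_big => [r|r _]; first by congr (_ && (_ == _)); lia.
    by rewrite exprD [_ * _ * (-1) ^+ psize t]mulrAC -expr2 sqrr_sign mul1r.
  transitivity (\sum_(u : shape | vstrip u t && (psize u <= psize t + k)%N)
    \sum_(r : shape | hstrip r u && (psize r == psize t + k)%N)
      (-1) ^+ (psize u) * (-1) ^+ (psize t) * srec xs r).
    rewrite [RHS](partition_big (fun u => inord (psize u - psize t) : 'I_k.+1) xpredT) //=.
    apply: eq_bigr => j _; have jk := ltn_ord j; apply: eq_bigl => u.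
    case vu: (vstrip u t) => //=; have tu := vstrip_psize vu.
    apply/eqP/andP => [e|[e /eqP/(congr1 val)/=]].
      by split; [lia|apply/eqP/val_inj; rewrite /= inordK; lia].
    by rewrite inordK; lia.
  rewrite (exchange_big_dep (fun r => psize r == psize t + k)%N) /=; last first.
    by move=> u r _ /andP[].
  transitivity (\sum_(r : shape | psize r == (psize t + k)%N)
    (\sum_(u : shape | vstrip u t && hstrip r u) (-1) ^+ psize u : int)%:~R *
     ((-1) ^+ psize t * srec xs r)).
    apply: eq_bigr => r /eqP rk; rewrite rmorph_sum mulr_suml; apply: eq_big => [u|u _].
      rewrite rk eqxx andbT; case ru: (hstrip r u); rewrite ?andbF //= !andbT.
      by have := hstrip_psize ru; rewrite rk => ->; rewrite andbT.
    by rewrite rmorphXn rmorphN1 mulrA.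
  case: posnP => [k0|k0]; last first.
    rewrite mul0r big1 // => r /eqP rk; rewrite strip_cancel ?mul0r //; lia.
  rewrite k0 addn0 mul1r (bigD1 t) //= [X in _ + X]big1 ?addr0 => [|r /andP[/eqP rt ne]].
    rewrite (big_pred1 t) ?rmorphXn ?rmorphN1 ?mulrA -?expr2 ?sqrr_sign ?mul1r //.
    move=> u; apply/andP/eqP => [[vu tu]|->]; last first.
      by rewrite vstrip_refl // hstrip_refl.
    by apply/esym/hstrip_eq => //; apply: vstrip_psize.
  rewrite big1 ?mul0r // => u /andP[vu ru]; case/eqP: ne.
  have tu := vstrip_psize vu; have ur := hstrip_psize ru.
  have e : r = u by apply: hstrip_eq ru _; lia.
  rewrite e; apply: eq_of_psize => [i|]; last by lia.
  by have [_ /(_ i) /andP[]] := vstripP _ _ vu.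
have ecancel : \sum_(j < k.+1) (-1) ^+ j * (erec xs j * srec xs t) * hrec xs (k - j) =
    (k == 0%N)%:R * srec xs t.
  rewrite -(erec_hrec xs k) mulr_suml; apply: eq_bigr => j _; ring.
move: cancel; rewrite -ecancel !big_ord_recr /= subnn hrec0 !mulr1.
rewrite (eq_bigr (fun j : 'I_k => (-1) ^+ j * (erec xs j * srec xs t) * hrec xs (k - j))).
  by move/addrI/(congr1 (fun z => (-1) ^+ k * z)); rewrite !mulrA -expr2 sqrr_sign !mul1r => <-.
by move=> j _; rewrite IH //; have := ltn_ord j; lia.
Qed.

End SchurRec.

(** * Conjugate shapes and expansions in Schur polynomials *)

Definition conj_shape t : shape :=
  mkshape (fun j => \sum_(i < n) (j < rowlen t i))%N.

(** Conjugation transposes cells. Together with [leq_of_lt], this form yields the properties of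
    conjugates without further use of the counting formula. *)
Lemma lt_conj_shape t i j : decr t ->
  (i < rowlen (conj_shape t) j)%N = (j < rowlen t i)%N.
Proof.
move=> dt; have [nj|nj] := leqP n j.
  by rewrite rowlen_out // ltn0; have := rowlen_le t i; lia.
have [T Tn HT] : exists2 T, (T <= n)%N &
    forall i, (i < n)%N -> (j < rowlen t i)%N = (i < T)%N.
  by apply: threshold => p p' pp _ h; apply: leq_trans h (decr_le dt pp).
have sT : (\sum_(i < n) (j < rowlen t i) = T)%N.
  rewrite (eq_bigr (fun i : 'I_n => if (i < T)%N then 1 else 0)%N).
    by rewrite -big_mkcond -(big_ord_widen _ (fun=> 1%N) Tn) sum_nat_const card_ord muln1.
  by move=> p _; rewrite HT //; case: ifP.
rewrite rowlen_mkshape // ?sT //.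
have [ni|ni] := leqP n i; last by rewrite HT.
by rewrite rowlen_out //; lia.
Qed.

Lemma leq_of_lt a b : (forall c, (c < a)%N -> (c < b)%N) -> (a <= b)%N.
Proof. by case: a => // a; apply. Qed.

Lemma conj_shape_decr t : decr t -> decr (conj_shape t).
Proof.
move=> dt; apply/decrP => i; apply: leq_of_lt => c; rewrite !lt_conj_shape //; lia.
Qed.

Lemma conj_shapeK t : decr t -> conj_shape (conj_shape t) = t.
Proof.
move=> dt; have dc := conj_shape_decr dt; apply: shapeP => i _.
by apply/eqP; rewrite eqn_leq; apply/andP; split; apply: leq_of_lt => c;
  rewrite !lt_conj_shape.
Qed.

Lemma rowlen_sum t i : rowlen t i = (\sum_(j < n) (j < rowlen t i))%N.
Proof.
rewrite (eq_bigr (fun j : 'I_n => if (j < rowlen t i)%N then 1 else 0)%N).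
  by rewrite -big_mkcond -(big_ord_widen _ (fun=> 1%N) (rowlen_le t i)) sum_nat_const card_ord muln1.
by move=> p _; case: ifP.
Qed.

Lemma psize_conj t : decr t -> psize (conj_shape t) = psize t.
Proof.
move=> dt; rewrite /psize.
rewrite (eq_bigr _ (fun (i : 'I_n) _ => rowlen_sum (conj_shape t) i)).
rewrite [RHS](eq_bigr _ (fun (i : 'I_n) _ => rowlen_sum t i)) exchange_big /=.
by apply: eq_bigr => i _; apply: eq_bigr => j _; rewrite lt_conj_shape.
Qed.

Lemma vstrip_conj t u : decr t -> decr u ->
  vstrip (conj_shape t) (conj_shape u) = hstrip t u.
Proof.
move=> dt du; apply/vstripP/hstripP => [[_ h] i|h]; last first.
  split; first exact: conj_shape_decr.
  move=> j; apply/andP; split; apply: leq_of_lt => c.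
    by rewrite !lt_conj_shape //; have [a _] := h c; lia.
  rewrite lt_conj_shape //; case: c => [|c]; first by [].
  by rewrite ltnS lt_conj_shape //; have [_ a] := h c; lia.
split; apply: leq_of_lt => c; rewrite -!(lt_conj_shape _ _ dt) -!(lt_conj_shape _ _ du).
  by have /andP[] := h c; lia.
by have /andP[] := h c; lia.
Qed.

(** Conjugation turns the vertical strips of the Pieri rule into horizontal ones, so the
    coefficients are the same Kostka numbers as for products of [hrec]. *)
Lemma eprod_expand (R : comNzRingType) (xs : seq R) l : (sumn l <= n)%N ->
  \prod_(k <- l) erec xs k =
  \sum_(t : shape) (kostka l t)%:R * srec xs (conj_shape t).
Proof.
have conj_nil : conj_shape nil_shape = nil_shape.
  apply: shapeP => j jn; rewrite rowlen_nil; apply/eqP; rewrite -leqn0.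
  by apply: leq_of_lt => c; rewrite lt_conj_shape ?decr_nil // rowlen_nil.
elim: l => [|k l IH] /= ln.
  rewrite big_nil (bigD1 nil_shape) //= eqxx mul1r conj_nil srec_nil.
  by rewrite big1 ?addr0 // => t /negPf->; rewrite mul0r.
rewrite big_cons IH; last lia.
rewrite mulr_sumr.
under [RHS]eq_bigr do rewrite natr_sum mulr_suml.
rewrite [RHS](exchange_big_dep xpredT) //=; apply: eq_bigr => u _.
have [k0|/kostka_neq0[du ku]] := posnP (kostka l u).
  by rewrite k0 mul0r mulr0 big1 // => t _; rewrite mul0r.
rewrite mulrCA srec_pieri_e ?mulr_sumr ?conj_shape_decr ?psize_conj ?ku //; last lia.
rewrite (reindex_onto conj_shape conj_shape) /= => [|v /andP[/vstripP[dv _] _]]; last first.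
  exact: conj_shapeK.
apply: eq_bigl => t; apply/andP/andP => [[/andP[h1 h2] /eqP e]|[h1 h2]].
  have dt : decr t by rewrite -e conj_shape_decr //; case/vstripP: h1.
  by rewrite -vstrip_conj // -(psize_conj dt) h1 h2.
have [dt _] := hstrip_decr h1.
by rewrite vstrip_conj // psize_conj // h1 h2 conj_shapeK.
Qed.

Definition ffcons (T : Type) N (x : T) (f : {ffun 'I_N -> T}) : {ffun 'I_N.+1 -> T} :=
  [ffun i => if unlift ord0 i is Some j then f j else x].

Lemma ffcons0 (T : Type) N (x : T) (f : {ffun 'I_N -> T}) : ffcons x f ord0 = x.
Proof. by rewrite ffunE unlift_none. Qed.

Lemma ffcons_lift (T : Type) N (x : T) (f : {ffun 'I_N -> T}) i :
  ffcons x f (lift ord0 i) = f i.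
Proof. by rewrite ffunE liftK. Qed.

Lemma big_ffcons (R : Type) (idx : R) (op : Monoid.com_law idx) (T : finType) N
    (P : pred {ffun 'I_N.+1 -> T}) (F : {ffun 'I_N.+1 -> T} -> R) :
  \big[op/idx]_(f | P f) F f =
  \big[op/idx]_(x : T) \big[op/idx]_(f : {ffun 'I_N -> T} | P (ffcons x f))
    F (ffcons x f).
Proof.
rewrite pair_big_dep /= (reindex (fun p : T * {ffun 'I_N -> T} => ffcons p.1 p.2)) //.
exists (fun f : {ffun 'I_N.+1 -> T} => (f ord0, [ffun i : 'I_N => f (lift ord0 i)])) => [[x f] _|f _] /=.
  rewrite ffcons0; congr pair; apply/ffunP => i.
  by rewrite ffunE ffcons_lift.
by apply/ffunP => i; rewrite ffunE; case: unliftP => [j ->|->]; rewrite ?ffunE.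
Qed.

(** The coefficients depend on the exponents through Kostka numbers only, so [kostka_perm] will give
    the symmetry of [srec]. No exponent exceeds [n] because [psize t <= n]. *)
Lemma srec_monomials (R : comNzRingType) N (x : 'I_N -> R) t : (psize t <= n)%N ->
  srec [seq x i | i <- enum 'I_N] t = \sum_(a : {ffun 'I_N -> 'I_n.+1})
    (kostka [seq val (a i) | i <- enum 'I_N] t)%:R * \prod_i x i ^+ a i.
Proof.
elim: N x t => [|N IH] x t tn.
  have -> : enum 'I_0 = [::] by apply: size0nil; rewrite size_enum_ord.
  rewrite /= (big_pred1 [ffun i => ord0]) ?big_ord0 ?mulr1 // => f.
  by apply/esym/eqP/ffunP => -[].
rewrite enum_ordSl /= -map_comp (big_ffcons _ xpredT).
rewrite (partition_big (fun u => inord (psize t - psize u) : 'I_n.+1) xpredT) //=.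
apply: eq_bigr => k _.
under [RHS]eq_bigr => a _.
  rewrite ffcons0 -map_comp big_ord_recl ffcons0.
  rewrite (eq_bigr (fun i : 'I_N => (x \o lift ord0) i ^+ a i)); last first.
    by move=> i _; rewrite ffcons_lift.
  rewrite (eq_map (g := fun i => val (a i))); last by move=> i /=; rewrite ffcons_lift.
  rewrite natr_sum mulr_suml.
  over.
rewrite [RHS](exchange_big_dep xpredT) //=.
rewrite [RHS](bigID (fun u => hstrip t u && (psize t == psize u + k)%N)) /=.
rewrite [X in _ + X]big1 ?addr0 => [|u /negPf->]; last by rewrite big_pred0.
have kn := ltn_ord k.
apply: congr_big => // [u|u /andP[hu /eqP e]].
  case hu: (hstrip t u) => //=; have ut := hstrip_psize hu.
  apply/eqP/eqP => [/(congr1 val)/=|e]; first by rewrite inordK; lia.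
  by apply/val_inj; rewrite /= inordK; lia.
have ut := hstrip_psize hu; rewrite -e inordK; last lia.
rewrite IH ?mulr_sumr; last lia.
have -> : (hstrip t u && (psize t == psize u + (psize t - psize u))%N) by rewrite hu; apply/eqP; lia.
by apply: eq_bigr => a _; rewrite mulrCA.
Qed.
End Shapes.

(** The exponent bound [K] is separate from [k] so that it can stay fixed while [k] decreases in the
    induction. *)
Lemma hrec_monomials (R : comNzRingType) N (x : 'I_N -> R) (k K : nat) :
  (k <= K)%N ->
  hrec [seq x i | i <- enum 'I_N] k = \sum_(a : {ffun 'I_N -> 'I_K.+1} |
     (\sum_i a i == k)%N) \prod_i x i ^+ a i.
Proof.
elim: N x k => [|N IH] x k kK.
  have -> : enum 'I_0 = [::] by apply: size0nil; rewrite size_enum_ord.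
  rewrite /= big_mkcond (big_pred1 [ffun i => ord0]) => [|f]; last first.
    by apply/esym/eqP/ffunP => -[].
  by rewrite !big_ord0 eq_sym; case: eqP.
rewrite enum_ordSl /= -map_comp big_ffcons.
rewrite (big_ord_widen_cond K.+1 xpredT (fun j => x ord0 ^+ j *
  hrec [seq (x \o lift ord0) i | i <- enum 'I_N] (k - j))); last lia.
rewrite big_mkcond; apply: eq_bigr => j _ /=.
under [RHS]eq_bigl do rewrite big_ord_recl ffcons0.
under [RHS]eq_bigr do rewrite big_ord_recl ffcons0.
rewrite -mulr_sumr; case: ifP => jk.
  rewrite IH; last lia; congr (_ * _); apply: eq_big => [a|a _].
    under [in RHS]eq_bigr do rewrite ffcons_lift.
    by apply/eqP/eqP; lia.
  by apply: eq_bigr => i _; rewrite ffcons_lift.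
rewrite big1 ?mulr0 // => a /eqP; lia.
Qed.

Lemma mcoeff_sum_ffun N K (c : {ffun 'I_N -> 'I_K.+1} -> nat) (m : 'X_{1..N}) :
  (\sum_a (c a)%:R * \prod_i 'X_i ^+ a i : {mpoly int[N]})@_m =
  if [forall i, m i <= K]%N then (c [ffun i => inord (m i)])%:R else 0.
Proof.
rewrite (raddf_sum (mcoeff m)) /=.
have E (a : {ffun 'I_N -> 'I_K.+1}) : ((c a)%:R * \prod_i 'X_i ^+ a i : {mpoly int[N]})@_m =
    if [forall i, m i == a i :> nat] then (c a)%:R else 0.
  have -> : \prod_(i < N) 'X_i ^+ a i = 'X_[ [multinom val (a i) | i < N] ] :> {mpoly int[N]}.
    by rewrite mpolyXE_id; apply: eq_bigr => i _; rewrite mnmE.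
  rewrite mulr_natl mcoeffMn mcoeffX.
  case: eqP => [<-|ne].
    by rewrite ifT //; apply/forallP => i; rewrite mnmE eqxx.
  rewrite mul0rn ifF //; apply/negP => /forallP h; apply: ne.
  by apply/mnmP => i; rewrite mnmE (eqP (h i)).
rewrite (eq_bigr _ (fun a _ => E a)); case: ifP => [/forallP h|/negP h].
  rewrite (bigD1 [ffun i => inord (m i)]) //= ifT; last first.
    by apply/forallP => i; rewrite ffunE inordK ?eqxx // ltnS.
  rewrite big1 ?addr0 // => a /eqP ne; rewrite ifF //; apply/negP => /forallP e.
  case: ne; apply/ffunP => i; rewrite ffunE; apply/val_inj.
  by rewrite /= inordK ?h // (eqP (e i)).
rewrite big1 // => a _; rewrite ifF //; apply/negP => /forallP e; apply: h.
by apply/forallP => i; rewrite (eqP (e i)) -ltnS.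
Qed.

Lemma mcoeff_sum_bmultinom N b (P : pred 'X_{1..N}) (m : 'X_{1..N}) :
  (\sum_(a : 'X_{1..N < b} | P a) 'X_[a] : {mpoly int[N]})@_m =
  ((mdeg m < b)%N && P m)%:R.
Proof.
rewrite (raddf_sum (mcoeff m)) /=; under eq_bigr do rewrite mcoeffX.
case mb: (mdeg m < b)%N => /=; last first.
  rewrite big1 // => a _; case: eqP => // e.
  by move: (bmdeg a); rewrite e mb.
rewrite big_mkcond (bigD1 (BMultinom mb)) //= eqxx big1 ?addr0; first by case: (P m).
move=> a ne; case: ifP => // _; case: eqP => // e; case/eqP: ne.
exact: val_inj.
Qed.

Lemma hsym1E N k : hsym1 k N = hrec [seq 'X_i | i <- enum 'I_N] k.
Proof.
rewrite (hrec_monomials (fun i => 'X_i) (leqnn k)) /hsym1; apply/mpolyP => m.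
rewrite (mcoeff_sum_bmultinom k.+1 (fun a => mdeg a == k)).
rewrite big_mkcond.
rewrite (eq_bigr (fun a : {ffun 'I_N -> 'I_k.+1} => ((\sum_i a i)%N == k)%:R * \prod_i 'X_i ^+ a i)); last first.
  by move=> a _; case: eqP; rewrite ?mul1r ?mul0r.
rewrite mcoeff_sum_ffun mdegE; case: ifP => [/forallP h|/forallP h].
  under [in RHS]eq_bigr do rewrite ffunE inordK ?ltnS //.
  by case: eqP => [->|]; rewrite ?ltnSn ?andbF.
case: eqP => [e|]; last by rewrite andbF.
by case: h => i; rewrite -e (bigD1 i) //= leq_addr.
Qed.

Lemma coef_prod_erec (R : comNzRingType) (xs : seq R) (k : nat) :
  (\prod_(x <- xs) (x%:P * 'X + 1))`_k = erec xs k.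
Proof.
elim: xs k => [|x xs IH] k; first by rewrite big_nil coef1.
rewrite big_cons mulrDl mul1r coefD -mulrA coefCM coefXM IH addrC.
by case: k => [|k] /=; rewrite ?mulr0 ?IH.
Qed.

(** Both sides are the coefficient of degree [k] in the product of the factors 1 + xX, which
    distributes over subsets of the variables. *)
Lemma erecE (R : comNzRingType) N (x : 'I_N -> R) (k : nat) :
  erec [seq x i | i <- enum 'I_N] k =
  \sum_(A : {set 'I_N} | #|A| == k) \prod_(i in A) x i.
Proof.
rewrite -coef_prod_erec big_map big_enum /= bigA_distr coef_sum [RHS]big_mkcond.
apply: eq_bigr => A _.
rewrite -big_mkcond /= big_split /= -rmorph_prod prodr_const coefCM coefXn.
by rewrite eq_sym; case: eqP; rewrite ?mulr1 ?mulr0.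
Qed.

(** * Tableaux as chains of horizontal strips *)

Section Tableaux.
Variable n : nat.
Implicit Types t u : shape n.

(** The shape left after the removal of [k] strips; index 0 is the starting shape, so [s] is shifted
    by one. *)
Definition chain_at N t (s : {ffun 'I_N -> shape n}) (k : nat) : shape n :=
  if k is k'.+1 then (if insub k' is Some i then s i else nil_shape n) else t.

Arguments chain_at : simpl never.

Definition is_chain N t (s : {ffun 'I_N -> shape n}) : bool :=
  [forall i : 'I_N, hstrip (chain_at t s i) (chain_at t s i.+1)] &&
  (chain_at t s N == nil_shape n).

Lemma chain_at_ffcons N t u (s : {ffun 'I_N -> shape n}) k : (k <= N)%N ->
  chain_at t (ffcons u s) k.+1 = chain_at u s k.
Proof.
move=> kN; rewrite {1}/chain_at; case: insubP => [i _ ik|]; last by rewrite ltnS kN.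
case: k kN ik => [|k] kN ik; rewrite /chain_at.
  by rewrite (_ : i = ord0) ?ffcons0 //; apply: val_inj.
rewrite insubT -(_ : lift ord0 (Ordinal kN) = i) ?ffcons_lift //.
exact: val_inj.
Qed.

Lemma srec_chain (R : comNzRingType) N (x : 'I_N -> R) t :
  srec [seq x i | i <- enum 'I_N] t =
  \sum_(s : {ffun 'I_N -> shape n} | is_chain t s)
    \prod_(i < N) x i ^+ (psize (chain_at t s i) - psize (chain_at t s i.+1)).
Proof.
elim: N x t => [|N IH] x t.
  have -> : enum 'I_0 = [::] by apply: size0nil; rewrite size_enum_ord.
  rewrite /= big_mkcond (big_pred1 [ffun i => nil_shape n]) => [|f]; last first.
    by apply/esym/eqP/ffunP => -[].
  rewrite big_ord0 /is_chain /=; case: eqP => [->|]; rewrite ?andbF //.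
  by rewrite andbT ifT //; apply/forallP => -[].
rewrite enum_ordSl /= -map_comp big_ffcons [LHS]big_mkcond; apply: eq_bigr => u _ /=.
have E (s : {ffun 'I_N -> shape n}) : is_chain t (ffcons u s) = hstrip t u && is_chain u s.
  rewrite /is_chain chain_at_ffcons // andbA; congr andb.
  apply/forallP/andP => [h|[h1 /forallP h2] i].
    split; first by have := h ord0; rewrite chain_at_ffcons.
    apply/forallP => i; have := h (lift ord0 i); rewrite lift0 !chain_at_ffcons //.
    exact: ltnW.
  case: (unliftP ord0 i) => [j ->|->]; last by rewrite chain_at_ffcons.
  by rewrite lift0 !chain_at_ffcons // ltnW.
rewrite (eq_bigl _ _ E); case: (hstrip t u) => /=; last by rewrite big_pred0.
rewrite (IH (x \o lift ord0)) mulr_sumr; apply: eq_bigr => s _.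
rewrite big_ord_recl chain_at_ffcons //; congr (_ * _); apply: eq_bigr => i _.
by rewrite lift0 !chain_at_ffcons // ltnW.
Qed.

(** A decreasing sequence has its zeros at the end, so their removal shifts no other entry. *)
Lemma nth_filter_pos (s : seq nat) i :
  sorted geq s -> nth 0%N [seq k <- s | 0 < k]%N i = nth 0%N s i.
Proof.
elim: s i => [|x s IH] i //= ps.
have ss := path_sorted ps.
case: ltnP => x0; first by case: i => [|i] //=; rewrite IH.
have [x00 z] : x = 0%N /\ forall k, k \in s -> k = 0%N.
  split=> [|k ks]; first lia.
  have tr : transitive geq by move=> a b c /=; lia.
  by have /allP/(_ k ks) := order_path_min tr ps; rewrite /=; lia.
rewrite (_ : [seq k <- s | 0 < k]%N = [::]) ?nth_nil; last first.
  by apply/eqP; rewrite -size_eq0 size_filter -leqn0 leqNgt -has_count;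
     apply/hasPn => k /z ->.
case: i => [|i] //=; have [si|si] := leqP (size s) i; first by rewrite nth_default.
by rewrite (z (nth 0%N s i)) ?mem_nth.
Qed.

Lemma sorted_decr t : sorted geq [seq val x | x <- t] = decr t.
Proof.
apply/(sortedP 0%N)/decrP => h i; last by move=> _; apply: h.
have [ni|ni] := leqP n i.+1; first by rewrite (rowlen_out _ ni).
by apply: h; rewrite size_map size_tuple.
Qed.

Variables (t : shape n) (l : seq nat) (N : nat).
Hypotheses (dt : decr t) (ln : (sumn l <= n)%N) (sl : (size l <= n)%N)
  (lt : forall i, nth 0%N l i = rowlen t i).

Implicit Type T : {ffun cell l -> 'I_N}.

Lemma cellP i j : (j < rowlen t i)%N ->
  exists c : cell l, val (val c).1 = i /\ val (val c).2 = j.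
Proof.
rewrite -lt => h.
have il : (i < size l)%N by rewrite ltnNge; apply/negP => /(nth_default 0%N) e; rewrite e in h.
have js : (j < sumn l)%N.
  apply: leq_trans h _; rewrite sumnE (big_nth 0%N) big_mkord.
  by rewrite (bigD1 (Ordinal il)) //= leq_addr.
by exists (exist _ (Ordinal il, Ordinal js) h).
Qed.

Lemma cell_lt (c : cell l) : (val (val c).2 < rowlen t (val (val c).1))%N.
Proof. by rewrite -lt; exact: (valP c). Qed.

Lemma cell_inj (c d : cell l) : val (val c).1 = val (val d).1 ->
  val (val c).2 = val (val d).2 -> c = d.
Proof.
move=> e1 e2; apply: val_inj; case: (val c) (val d) e1 e2 => [a b] [a' b'] /=.
by move=> /val_inj-> /val_inj->.
Qed.

(** Outside the diagram the entry is [N], larger than any color, so that having an entry below [N]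
    characterizes the cells. *)
Definition entry T (i j : nat) : nat :=
  if [pick c : cell l | (val (val c).1 == i) && (val (val c).2 == j)] is Some c
  then T c else N.

Lemma entry_cell T (c : cell l) : entry T (val (val c).1) (val (val c).2) = T c.
Proof.
rewrite /entry; case: pickP => [d /andP[/eqP e1 /eqP e2]|/(_ c)].
  by rewrite (cell_inj e1 e2).
by rewrite !eqxx.
Qed.

Lemma entry_lt T i j : (entry T i j < N)%N = (j < rowlen t i)%N.
Proof.
apply/idP/idP => [|/cellP[c [<- <-]]]; last by rewrite entry_cell.
rewrite /entry; case: pickP => [d /andP[/eqP <- /eqP <-] _|_]; last by rewrite ltnn.
exact: cell_lt.
Qed.

Lemma semistandardP T :
  reflect ((forall i j j', (j <= j')%N -> (j' < rowlen t i)%N ->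
              (entry T i j <= entry T i j')%N) /\
           (forall i i' j, (i < i')%N -> (j < rowlen t i')%N ->
              (entry T i j < entry T i' j)%N))
          (semistandard T).
Proof.
apply: (iffP forallP) => [h|[h1 h2] c].
  split=> [i j j' jj jt|i i' j ii jt].
    have [c [c1 c2]] := cellP (leq_ltn_trans jj jt); have [d [d1 d2]] := cellP jt.
    rewrite -{1}c1 -c2 -d1 -d2 !entry_cell; have /forallP/(_ d) := h c.
    case: c c1 c2 => -[a b] hc /= c1 c2; case: d d1 d2 => -[a' b'] hd /= d1 d2.
    case/andP => /implyP H _; apply: H; rewrite c2 d2 jj andbT.
    by apply/eqP/val_inj; rewrite /= c1 d1.
  have [c [c1 c2]] := cellP (leq_trans jt (decr_le dt (ltnW ii))); have [d [d1 d2]] := cellP jt.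
  rewrite -{1}c1 -{1}c2 -d1 -d2 !entry_cell; have /forallP/(_ d) := h c.
  case: c c1 c2 => -[a b] hc /= c1 c2; case: d d1 d2 => -[a' b'] hd /= d1 d2.
  case/andP => _ /implyP H; apply: H; rewrite c1 d1 ii andbT.
  by apply/eqP/val_inj; rewrite /= c2 d2.
apply/forallP => d; have := cell_lt d; have := cell_lt c.
have := entry_cell T c; have := entry_cell T d.
case: c => -[a b] hc; case: d => -[a' b'] hd /= <- <- k1 k2.
apply/andP; split; apply/implyP => /andP[/eqP e h].
  by rewrite e; apply: h1.
by rewrite e; apply: h2.
Qed.

Definition tab_shape T (c : nat) : shape n :=
  mkshape n (fun i => \sum_(j < n) (entry T i j < c))%N.

Lemma lt_tab_shape T c i j : semistandard T -> (c <= N)%N ->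
  (j < rowlen (tab_shape T c) i)%N = (entry T i j < c)%N.
Proof.
move=> /semistandardP[h1 h2] cN.
have out : (n <= i)%N || (n <= j)%N -> (entry T i j < c)%N = false.
  move=> o; apply/negP => h; have : (entry T i j < N)%N by lia.
  rewrite entry_lt; case/orP: o => o; first by rewrite rowlen_out.
  by have := rowlen_le t i; lia.
have [ni|ni] := leqP n i; first by rewrite rowlen_out // out ?ni.
have [Tn TnN HT] : exists2 Tn, (Tn <= n)%N &
    forall j, (j < n)%N -> (entry T i j < c)%N = (j < Tn)%N.
  apply: threshold => p p' pp _ h; apply: (leq_ltn_trans _ h); apply: h1 => //.
  by rewrite -(entry_lt T); lia.
have sT : (\sum_(j < n) (entry T i j < c) = Tn)%N.
  rewrite (eq_bigr (fun j : 'I_n => if (j < Tn)%N then 1 else 0)%N).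
    by rewrite -big_mkcond -(big_ord_widen _ (fun=> 1%N) TnN) sum_nat_const card_ord muln1.
  by move=> p _; rewrite HT //; case: ifP.
rewrite rowlen_mkshape // ?sT //.
have [nj|nj] := leqP n j; last by rewrite HT.
by rewrite out ?nj ?orbT //; lia.
Qed.

(** The largest entries are removed first: after k + 1 steps the entries below N - (k + 1)
    remain. *)
Definition tab_chain T : {ffun 'I_N -> shape n} :=
  [ffun k : 'I_N => tab_shape T (N.-1 - k)].

Lemma chain_at_tab T k : semistandard T -> (k <= N)%N ->
  chain_at t (tab_chain T) k = tab_shape T (N - k).
Proof.
move=> sT; rewrite /chain_at; case: k => [_|k kN].
  apply: shapeP => i ni; apply/eqP; rewrite eqn_leq subn0.
  by apply/andP; split; apply: leq_of_lt => j; rewrite lt_tab_shape // entry_lt.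
by rewrite insubT ffunE /=; congr tab_shape; lia.
Qed.

Lemma tab_chain_is_chain T : semistandard T -> is_chain t (tab_chain T).
Proof.
move=> sT; have [h1 h2] := semistandardP _ sT; apply/andP; split.
  apply/forallP => k; have kN := ltn_ord k.
  rewrite !chain_at_tab //; last exact: ltnW.
  apply/hstripP => i; split; apply: leq_of_lt => j; rewrite !lt_tab_shape ?leq_subr //.
    lia.
  move=> e; have := h2 i i.+1 j (ltnSn i); rewrite -(entry_lt T i.+1 j); lia.
rewrite chain_at_tab // subnn; apply/eqP; apply: shapeP => i ni.
rewrite rowlen_nil; apply/eqP; rewrite -leqn0.
by apply: leq_of_lt => j; rewrite lt_tab_shape.
Qed.

(** The number of members of the chain that contain the cell; its entry in the tableau is [N] minus
    this number. *)
Definition height (s : {ffun 'I_N -> shape n}) (i j : nat) : nat :=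
  (\sum_(k < N) (j < rowlen (chain_at t s k) i))%N.

Lemma lt_height s i j k : is_chain t s -> (k <= N)%N ->
  (k < height s i j)%N = (j < rowlen (chain_at t s k) i)%N.
Proof.
move=> /andP[/forallP h /eqP sN] kN.
have step p : (p < N)%N ->
    (rowlen (chain_at t s p.+1) i <= rowlen (chain_at t s p) i)%N.
  by move=> pN; have /hstripP/(_ i)[] := h (Ordinal pN).
have mono p p' : (p <= p')%N -> (p' <= N)%N ->
    (rowlen (chain_at t s p') i <= rowlen (chain_at t s p) i)%N.
  elim: p' => [|p' IH]; first by rewrite leqn0 => /eqP->.
  rewrite leq_eqVlt => /orP[/eqP->//|pp] pN.
  by apply: leq_trans (step _ pN) (IH pp (ltnW pN)).
have [K KN HK] : exists2 K, (K <= N)%N &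
    forall p, (p < N)%N -> (j < rowlen (chain_at t s p) i)%N = (p < K)%N.
  by apply: threshold => p p' pp pN h'; apply: leq_trans h' (mono _ _ pp (ltnW pN)).
have -> : height s i j = K.
  rewrite /height (eq_bigr (fun p : 'I_N => if (p < K)%N then 1 else 0)%N).
    by rewrite -big_mkcond -(big_ord_widen _ (fun=> 1%N) KN) sum_nat_const card_ord muln1.
  by move=> p _; rewrite HK //; case: ifP.
move: kN; rewrite leq_eqVlt => /orP[/eqP->|kN]; last by rewrite HK.
by rewrite sN rowlen_nil; lia.
Qed.

Lemma height_le s i j : (height s i j <= N)%N.
Proof.
rewrite -[leqRHS]card_ord -sum1_card; apply: leq_sum => k _; exact: leq_b1.
Qed.

(** [T0] supplies the default for [insubd], since ['I_N] may be empty. *)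
Definition chain_tab (T0 : {ffun cell l -> 'I_N}) (s : {ffun 'I_N -> shape n}) :
    {ffun cell l -> 'I_N} :=
  [ffun c : cell l => insubd (T0 c) (N - height s (val (val c).1) (val (val c).2))%N].

Lemma entry_chain_tab T0 s i j : is_chain t s ->
  entry (chain_tab T0 s) i j = (N - height s i j)%N.
Proof.
move=> sc; have H := lt_height i j sc (leq0n N).
have [jt|jt] := ltnP j (rowlen t i); last first.
  have : ~~ (entry (chain_tab T0 s) i j < N)%N by rewrite entry_lt -leqNgt.
  rewrite /chain_at in H; rewrite /entry; case: pickP => [c|_ _]; first by rewrite ltn_ord.
  lia.
have [c [<- <-]] := cellP jt; rewrite entry_cell ffunE.
have [c1 c2] := cellP jt; rewrite val_insubd ifT //.
have := lt_height (val (val c).1) (val (val c).2) sc (leq0n N).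
by rewrite /chain_at cell_lt; have := ltn_ord (T0 c); lia.
Qed.

Lemma chain_tab_semistandard T0 s : is_chain t s -> semistandard (chain_tab T0 s).
Proof.
move=> sc; have [/forallP h _] := andP sc; apply/semistandardP; split.
  move=> i j j' jj jt; rewrite !entry_chain_tab // leq_sub2l //.
  by apply: leq_sum => k _; case: ltnP => //= h'; rewrite (leq_ltn_trans jj h').
move=> i i' j ii jt; rewrite !entry_chain_tab //.
have c0 : (0 < height s i' j)%N by rewrite lt_height.
have cN := height_le s i' j.
have pN : ((height s i' j).-1 < N)%N by lia.
(* This is the last member of the chain that contains the lower cell; by interlacing the next member
   still contains the upper cell, which makes the column strict. *)
have a : (j < rowlen (chain_at t s (height s i' j).-1) i')%N.
  by rewrite -lt_height ?prednK //; lia.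
have hs := h (Ordinal pN); have /hstripP/(_ i)[_ b] := hs.
have [d _] := hstrip_decr hs; move: b; rewrite /= prednK // => b.
have e := leq_trans a (leq_trans (decr_le d ii) b).
by rewrite -lt_height // in e; have := height_le s i j; lia.
Qed.

Lemma chain_tabK T0 s : is_chain t s -> tab_chain (chain_tab T0 s) = s.
Proof.
move=> sc; apply/ffunP => k; rewrite ffunE; have kN := ltn_ord k.
have ss := chain_tab_semistandard T0 sc.
have -> : s k = chain_at t s k.+1.
  by rewrite /chain_at; case: insubP => [i _ /val_inj->|] //; rewrite kN.
apply: shapeP => i ni; apply/eqP; rewrite eqn_leq; apply/andP.
by split; apply: leq_of_lt => j; rewrite lt_tab_shape ?entry_chain_tab -?(lt_height i j sc) //;
  have := height_le s i j; lia.
Qed.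

Lemma tab_chainK T0 T : semistandard T -> chain_tab T0 (tab_chain T) = T.
Proof.
move=> sT; apply/ffunP => c; apply: val_inj; rewrite /= -[LHS]entry_cell -[RHS]entry_cell.
have sc := tab_chain_is_chain sT.
rewrite entry_chain_tab //; have cl := cell_lt c.
move: (val (val c).1) (val (val c).2) cl => i j ij.
have eN : (entry T i j < N)%N by rewrite entry_lt.
have H k : (k <= N)%N -> (k < height (tab_chain T) i j)%N = (entry T i j < N - k)%N.
  by move=> kN; rewrite lt_height // chain_at_tab // lt_tab_shape // leq_subr.
have := H (N - entry T i j)%N ltac:(lia); have := H (N - entry T i j).-1 ltac:(lia).
lia.
Qed.

Lemma psize_tab_shape T c : semistandard T -> (c <= N)%N ->
  psize (tab_shape T c) = #|[pred d : cell l | T d < c]%N|.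
Proof.
move=> sT cN; rewrite /psize.
pose e (d : cell l) := (widen_ord sl (val d).1, widen_ord ln (val d).2).
have ei : injective e by move=> d d' [/val_inj e1 /val_inj e2]; apply: cell_inj; [rewrite e1|rewrite e2].
rewrite -(card_image ei).
rewrite (eq_card (B := [pred p : 'I_n * 'I_n | entry T p.1 p.2 < c]%N)); last first.
  move=> p; rewrite inE; apply/imageP/idP => [[d dT ->]|h].
    by rewrite /= (entry_cell T d).
  have := leq_trans h cN; rewrite entry_lt => /cellP[d [d1 d2]]; exists d.
    by rewrite inE -entry_cell d1 d2.
  by rewrite [p]surjective_pairing; congr pair; apply: val_inj; rewrite /= ?d1 ?d2.
rewrite -sum1_card [RHS]big_mkcond -(pair_bigA _ (fun i j : 'I_n => if (entry T i j < c)%N then 1 else 0)%N).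
apply: eq_bigr => i _; rewrite rowlen_sum; apply: eq_bigr => j _.
by rewrite lt_tab_shape //; case: ifP.
Qed.

(** [srec] spends its first variable on the outermost strip, which in a tableau carries the largest
    entry; hence [rev_ord]. *)
Lemma schur_srec :
  schur l N = srec [seq 'X_(rev_ord i) | i <- enum 'I_N] t :> {mpoly int[N]}.
Proof.
rewrite srec_chain /schur.
have main (T0 : {ffun cell l -> 'I_N}) : \sum_(T : {ffun cell l -> 'I_N} | semistandard T) \prod_(c : cell l) 'X_(T c) =
    \sum_(s : {ffun 'I_N -> shape n} | is_chain t s) \prod_(i < N)
      'X_(rev_ord i) ^+ (psize (chain_at t s i) - psize (chain_at t s i.+1)) :> {mpoly int[N]}.
  rewrite (reindex_onto (chain_tab T0) tab_chain) => [|T]; last exact: tab_chainK.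
  apply: eq_big => [s|s /andP[ss /eqP e]].
    apply/andP/idP => [[ss /eqP <-]|sc]; first exact: tab_chain_is_chain.
    by rewrite chain_tab_semistandard // chain_tabK.
  rewrite -e tab_chainK // ; set T := chain_tab T0 s in ss *.
  rewrite (partition_big T xpredT) //= (reindex_inj rev_ord_inj) /=.
  apply: eq_bigr => k _; have kN := ltn_ord k.
  rewrite (eq_bigr (fun=> 'X_(rev_ord k))) => [|c /eqP->//].
  rewrite !chain_at_tab //; last exact: ltnW.
  rewrite !psize_tab_shape ?leq_subr // prodr_const; congr (_ ^+ _).
  rewrite -(cardID [pred d : cell l | T d < N - k.+1]%N [pred d : cell l | T d < N - k]%N).
  rewrite addnC.
  have -> : #|[predI [pred d : cell l | T d < N - k]%N & [pred d | T d < N - k.+1]%N]| =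
            #|[pred d : cell l | T d < N - k.+1]%N|.
    by apply: eq_card => d; rewrite !inE; lia.
  rewrite addnK; apply: eq_card => d; rewrite !inE.
  by rewrite /in_mem /=; apply/eqnP/idP => /= h; lia.
(* A default tableau exists if [N] is positive or there are no cells. Otherwise both sums are
   empty. *)
have [N0|N0] := posnP N; last exact: main [ffun=> Ordinal N0].
case: (pickP (fun c : cell l => true)) => [c _|c0]; last first.
  exact: (main [ffun c => False_rect _ (Bool.diff_true_false (c0 c))]).
have c0 (k : 'I_N) : False by have := ltn_ord k; lia.
rewrite !big_pred0 // => [s|T]; last by case: (c0 (T c)).
have chain0 k : k = 0%N -> chain_at t s k = t by move=> ->.
apply/negP => /andP[_]; rewrite (chain0 _ N0) => /eqP t0.
by have := cell_lt c; rewrite t0 rowlen_nil.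
Qed.

End Tableaux.

(** * Bases of the symmetric functions *)

Section Unitriangular.
Variables (P : finType) (A : P -> P -> int) (rk : P -> nat).
Hypotheses (diag : forall l, A l l = 1)
  (tri : forall l m, A l m != 0 -> l != m -> (rk l < rk m)%N).

Lemma unitriangular_left_inverse : exists J : P -> P -> int,
  forall l q, \sum_p J l p * A p q = (l == q)%:R.
Proof.
suff row d : forall l, (\max_p rk p - rk l < d)%N ->
    exists J : P -> int, forall q, \sum_p J p * A p q = (l == q)%:R.
  have /fin_all_exists[J HJ] l := row _ l (ltnSn _).
  by exists J.
elim: d => [|d IH] l // dl.
have rB p : (rk p <= \max_p rk p)%N by rewrite leq_bigmax.
have [J HJ] : exists J : P -> P -> int, forall m, (rk l < rk m)%N ->
    forall q, \sum_p J m p * A p q = (m == q)%:R.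
  suff /fin_all_exists[J HJ] m : exists J : P -> int, (rk l < rk m)%N ->
      forall q, \sum_p J p * A p q = (m == q)%:R by exists J.
  case: (ltnP (rk l) (rk m)) => lm; last by exists (fun=> 0).
  by have [|J HJ] := IH m; [have := rB m; lia|exists J].
exists (fun p => (l == p)%:R - \sum_(m | m != l) A l m * J m p) => q.
have E : \sum_p (\sum_(m | m != l) A l m * J m p) * A p q =
    \sum_(m | m != l) A l m * (m == q)%:R.
  under eq_bigr do rewrite mulr_suml.
  rewrite exchange_big /=; apply: eq_bigr => m ml.
  under eq_bigr do rewrite -mulrA.
  rewrite -mulr_sumr; have [->|Am] := eqVneq (A l m) 0; first by rewrite !mul0r.
  by rewrite HJ // tri // eq_sym.
under eq_bigr do rewrite mulrBl.
rewrite sumrB E (bigD1 l) //= eqxx mul1r big1 ?addr0 => [|p /negPf pl]; last first.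
  by rewrite eq_sym pl mul0r.
have [->|lq] := eqVneq l q.
  by rewrite diag big1 ?subr0 // => m /negPf->; rewrite mulr0.
rewrite (bigD1 q) 1?eq_sym //= eqxx mulr1 big1 ?addr0 ?subrr // => m /andP[_ /negPf->].
by rewrite mulr0.
Qed.

Lemma unitriangular_inverse : exists J : P -> P -> int,
  (forall l q, \sum_p J l p * A p q = (l == q)%:R) /\
  (forall l q, \sum_p A l p * J p q = (l == q)%:R).
Proof.
have [J HJ] := unitriangular_left_inverse; exists J; split=> // l q.
(* For square matrices over a commutative ring a left inverse is also a right inverse. *)
pose mx (M : P -> P -> int) := \matrix_(i, j < #|P|) M (enum_val i) (enum_val j).
have mxM (M M' : P -> P -> int) i j :
    (mx M *m mx M') i j = \sum_p M (enum_val i) p * M' p (enum_val j).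
  rewrite mxE [RHS](reindex _ (onW_bij _ (enum_val_bij P))) /=.
  by apply: eq_bigr => k _; rewrite !mxE.
have : mx J *m mx A = 1%:M.
  by apply/matrixP => i j; rewrite mxM HJ mxE (inj_eq enum_val_inj).
move/mulmx1C/matrixP/(_ (enum_rank l) (enum_rank q)).
by rewrite mxM mxE !enum_rankK (inj_eq enum_rank_inj).
Qed.

End Unitriangular.

Section Partitions.
Variable n : nat.
Implicit Types l m p : partn n.

Lemma partn_decr l : decr (val l).
Proof. by rewrite -sorted_decr; case/andP: (valP l). Qed.

Lemma psizeE (t : shape n) : psize t = sumn [seq val x | x <- t].
Proof. by rewrite sumnE (big_nth 0%N) size_map size_tuple big_mkord. Qed.

Lemma partn_psize l : psize (val l) = n.
Proof. by rewrite psizeE; case/andP: (valP l) => _ /eqP. Qed.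

Lemma nth_parts l i : nth 0%N (parts l) i = rowlen (val l) i.
Proof. by rewrite /parts nth_filter_pos // sorted_decr partn_decr. Qed.

Lemma parts_gt0 l : all (ltn 0) (parts l).
Proof. exact: filter_all. Qed.

Lemma parts_sorted l : sorted geq (parts l).
Proof.
apply: sorted_filter; last by case/andP: (valP l).
by move=> x y z /=; lia.
Qed.

Lemma sumn_filter_pos (s : seq nat) : sumn [seq k <- s | 0 < k]%N = sumn s.
Proof. by elim: s => [|[|k] s IH] //=; rewrite IH. Qed.

Lemma sumn_parts l : sumn (parts l) = n.
Proof. by rewrite sumn_filter_pos -psizeE partn_psize. Qed.

Lemma size_parts l : (size (parts l) <= n)%N.
Proof. by rewrite size_filter (leq_trans (count_size _ _)) // size_map size_tuple. Qed.

Lemma partn_inj l m : (forall i, rowlen (val l) i = rowlen (val m) i) -> l = m.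
Proof. by move=> e; apply: val_inj; apply: shapeP => i _; apply: e. Qed.

Lemma parts_inj l m : parts l = parts m -> l = m.
Proof. by move=> e; apply: partn_inj => i; rewrite -!nth_parts e. Qed.

Lemma perm_parts l m : perm_eq (parts l) (parts m) -> l = m.
Proof.
move=> p; apply: parts_inj; apply: (sorted_eq (leT := geq)); rewrite ?parts_sorted //.
  by move=> x y z /=; lia.
by move=> x y /=; lia.
Qed.

Lemma partnP (t : shape n) :
  decr t && (psize t == n) = (sorted geq [seq val x | x <- t] &&
                              (sumn [seq val x | x <- t] == n)).
Proof. by rewrite sorted_decr psizeE. Qed.

Definition partn_of (t : shape n) (h : decr t && (psize t == n)) : partn n :=
  exist _ t (etrans (esym (partnP t)) h).

Lemma big_partn (R : nmodType) (F : shape n -> R) :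
  (forall t, ~~ (decr t && (psize t == n)) -> F t = 0) ->
  \sum_t F t = \sum_(l : partn n) F (val l).
Proof.
move=> F0; rewrite (bigID (fun t : shape n => decr t && (psize t == n))) /=.
rewrite [X in _ + X]big1 ?addr0 => [|t /F0//].
rewrite (reindex_omap val (insub : shape n -> option (partn n))) /= => [|t].
  by apply: eq_bigl => l; rewrite partn_decr partn_psize eqxx valK /= eqxx.
by rewrite partnP => h; rewrite insubT.
Qed.

Definition conj_partn l : partn n :=
  partn_of (introT andP (conj (conj_shape_decr (partn_decr l))
    (introT eqP (etrans (psize_conj (partn_decr l)) (partn_psize l))))).

Lemma conj_partnK : involutive conj_partn.
Proof. by move=> l; apply: val_inj; rewrite /= conj_shapeK // partn_decr. Qed.

Lemma parts_conj l : conj_parts (parts l) = parts (conj_partn l).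
Proof.
have dl := partn_decr l; have dc := conj_shape_decr dl.
have cnt j : count (fun k => j < k)%N (parts l) = rowlen (conj_shape (val l)) j.
  have [nj|nj] := leqP n j.
    rewrite rowlen_out //; apply/eqP; rewrite -leqn0 leqNgt -has_count.
    apply/hasPn => k /(nthP 0%N)[i _ <-]; rewrite nth_parts -leqNgt.
    exact: leq_trans (rowlen_le _ _) nj.
  rewrite rowlen_mkshape //; last first.
    by rewrite -[leqRHS]card_ord -sum1_card; apply: leq_sum => k _; exact: leq_b1.
  rewrite /parts count_filter -sum1_count (big_nth 0%N) size_map size_tuple.
  rewrite big_mkord big_mkcond; apply: eq_bigr => i _; rewrite -/(rowlen (val l) i) /=.
  by case: (ltnP j _) => //= h; rewrite (leq_ltn_trans _ h).
have hd : head 0%N (parts l) = size (parts (conj_partn l)).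
  rewrite -nth0 nth_parts; apply/eqP; rewrite eqn_leq; apply/andP; split.
    apply: leq_of_lt => c; rewrite -lt_conj_shape // => h.
    by rewrite ltnNge; apply/negP => /(nth_default 0%N) e;
       move: h; rewrite -[conj_shape _]/(val (conj_partn l)) -nth_parts e.
  apply: leq_of_lt => c h; rewrite -lt_conj_shape //.
  by rewrite -[conj_shape _]/(val (conj_partn l)) -nth_parts;
     have /allP := parts_gt0 (conj_partn l); apply; apply: mem_nth.
apply: (@eq_from_nth _ 0%N) => [|i]; first by rewrite size_map size_iota hd.
rewrite size_map size_iota => ih.
by rewrite (nth_map 0%N) ?size_iota // nth_iota // add0n cnt nth_parts.
Qed.

(** Reversing the variables permutes the contents, which Kostka numbers do not see. This removes the
    [rev_ord] of [schur_srec]. *)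
Lemma srec_rev (R : comNzRingType) N (x : 'I_N -> R) (t : shape n) :
  (psize t <= n)%N ->
  srec [seq x (rev_ord i) | i <- enum 'I_N] t = srec [seq x i | i <- enum 'I_N] t.
Proof.
move=> tn; rewrite (srec_monomials (x \o @rev_ord N)) // srec_monomials //.
pose h (a : {ffun 'I_N -> 'I_n.+1}) := [ffun i => a (rev_ord i)].
have hK : involutive h by move=> a; apply/ffunP => i; rewrite !ffunE rev_ordK.
rewrite [LHS](reindex_inj (inv_inj hK)); apply: eq_bigr => a _; congr (_%:R * _).
  apply: kostka_perm.
  rewrite (eq_map (g := (fun i => val (a i)) \o @rev_ord N)); last first.
    by move=> i; rewrite /h /= ffunE.
  rewrite map_comp perm_map // uniq_perm ?enum_uniq ?(map_inj_uniq rev_ord_inj) ?enum_uniq //.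
  by move=> i; rewrite mem_enum; apply/mapP; exists (rev_ord i); rewrite ?mem_enum ?rev_ordK.
rewrite [RHS](reindex_inj rev_ord_inj) /=; apply: eq_bigr => i _.
by rewrite ffunE.
Qed.

Let vars N : seq {mpoly int[N]} := [seq 'X_i | i <- enum 'I_N].

Definition elem_sym (l : seq nat) : series int := fun N =>
  \prod_(k <- l) erec (vars N) k.

Definition kostka_mx l m : int := (kostka (parts l) (val m))%:R.

Lemma schurE l N : schur (parts l) N = srec (vars N) (val l).
Proof.
rewrite (schur_srec N (partn_decr l) (eq_leq (sumn_parts l)) (size_parts l) (nth_parts l)).
exact: (srec_rev (fun i => 'X_i) (eq_leq (partn_psize l))).
Qed.

Lemma kostka_out (s : seq nat) (t : shape n) :
  sumn s = n -> ~~ (decr t && (psize t == n)) -> kostka s t = 0%N.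
Proof.
move=> sn; apply: contraNeq; rewrite -lt0n => /kostka_neq0[-> ->].
by rewrite sn eqxx.
Qed.

Lemma natr_scale (R : nzRingType) N (k : nat) (p : {mpoly R[N]}) :
  k%:R * p = k%:R *: p.
Proof. by rewrite mulr_natl scaler_nat. Qed.

Lemma hsymE l N : hsym (parts l) N = \sum_m kostka_mx l m *: schur (parts m) N.
Proof.
rewrite /hsym; under eq_bigr do rewrite hsym1E.
rewrite (hprod_expand (n := n)) ?sumn_parts // big_partn; last first.
  by move=> t h; rewrite (kostka_out (sumn_parts l) h) mul0r.
by apply: eq_bigr => m _; rewrite schurE natr_scale.
Qed.

Lemma elem_symE l N : elem_sym (parts l) N = \sum_m kostka_mx l m *: schur (parts (conj_partn m)) N.
Proof.
rewrite /elem_sym (eprod_expand (n := n)) ?sumn_parts // big_partn; last first.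
  by move=> t h; rewrite (kostka_out (sumn_parts l) h) mul0r.
by apply: eq_bigr => m _; rewrite schurE natr_scale.
Qed.

Definition nonzero_exps N (m : 'X_{1..N}) : seq nat :=
  [seq k <- [seq m i | i <- enum 'I_N] | 0 < k]%N.

Lemma sumn_exps N (m : 'X_{1..N}) : sumn (nonzero_exps m) = mdeg m.
Proof. by rewrite sumn_filter_pos mdegE sumnE big_map big_enum. Qed.

Lemma mcoeff_msym l N (m : 'X_{1..N}) :
  (msym (parts l) N)@_m = (perm_eq (nonzero_exps m) (parts l))%:R.
Proof.
rewrite /msym (mcoeff_sum_bmultinom _ (fun a => perm_eq (nonzero_exps a) (parts l))).
case p: (perm_eq _ _); rewrite ?andbF ?andbT //.
by rewrite -sumn_exps (perm_sumn p) ltnSn.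
Qed.

Lemma partsP (s : seq nat) : sorted geq s -> all (ltn 0) s -> sumn s = n ->
  exists l : partn n, parts l = s.
Proof.
move=> ss s0 sn.
have size_s : (size s <= n)%N.
  rewrite -sn; elim: (s) s0 => [|k r IH] //= /andP[k0 /IH].
  lia.
have le_s i : (nth 0%N s i <= n)%N.
  have [si|si] := leqP (size s) i; first by rewrite nth_default.
  by rewrite -sn sumnE (big_nth 0%N) big_mkord (bigD1 (Ordinal si)) //= leq_addr.
pose t := mkshape n (nth 0%N s).
have tE i : rowlen t i = nth 0%N s i.
  have [ni|ni] := leqP n i; last by rewrite rowlen_mkshape.
  by rewrite rowlen_out // nth_default // (leq_trans size_s).
have dt : decr t.
  apply/decrP => i; rewrite !tE; have [si|si] := leqP (size s) i.+1.
    by rewrite nth_default.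
  by have /(sortedP 0%N)/(_ i si) := ss.
have pt : psize t == n.
  apply/eqP; apply: etrans sn; rewrite /psize sumnE (big_nth 0%N) big_mkord.
  rewrite (big_ord_widen _ (nth 0%N s) size_s) [RHS]big_mkcond.
  apply: eq_bigr => i _; rewrite tE; case: ltnP => // si.
  by rewrite nth_default.
pose l := partn_of (introT andP (conj dt pt)).
exists l.
have eqn i : nth 0%N (parts l) i = nth 0%N s i by rewrite nth_parts /= tE.
have key (r r' : seq nat) : all (ltn 0) r -> all (ltn 0) r' ->
    (forall i, nth 0%N r i = nth 0%N r' i) -> r = r'.
  elim: r r' => [|x r IH] [|y r'] //=.
  - by move=> _ /andP[y0 _] /(_ 0%N) /= e; rewrite -e in y0.
  - by move=> /andP[x0 _] _ /(_ 0%N) /= e; rewrite e in x0.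
  move=> /andP[_ r0] /andP[_ r0'] e; have /= -> := e 0%N; congr cons.
  by apply: IH => // i; apply: (e i.+1).
by apply: key; rewrite ?parts_gt0.
Qed.

Lemma exps_partn N (m : 'X_{1..N}) : mdeg m = n ->
  exists l : partn n, perm_eq (nonzero_exps m) (parts l).
Proof.
move=> mn; pose s := sort geq (nonzero_exps m).
have ps : perm_eq s (nonzero_exps m) by rewrite perm_sort.
have sn : sumn s = n by rewrite (perm_sumn ps) sumn_exps.
have s0 : all (ltn 0) s by rewrite (perm_all _ ps) filter_all.
have ss : sorted geq s by apply: sort_sorted => x y /=; lia.
by have [l e] := partsP ss s0 sn; exists l; rewrite e perm_sym.
Qed.

Lemma schur_msym l N : schur (parts l) N = \sum_m kostka_mx m l *: msym (parts m) N.
Proof.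
rewrite schurE srec_monomials ?partn_psize //; apply/mpolyP => m.
rewrite mcoeff_sum_ffun (raddf_sum (mcoeff m)) /=.
under [RHS]eq_bigr do rewrite mcoeffZ mcoeff_msym.
have zero : mdeg m != n -> kostka [seq m i | i <- enum 'I_N] (val l) = 0%N.
  apply: contraNeq; rewrite -lt0n => /kostka_neq0[_]; rewrite partn_psize => ->.
  by rewrite mdegE sumnE big_map big_enum.
have EL : (if [forall i, (m i <= n)%N] then
    (kostka [seq val ([ffun i => inord (m i)] i : 'I_n.+1) | i <- enum 'I_N] (val l))%:R
    else 0) = (kostka [seq m i | i <- enum 'I_N] (val l))%:R :> int.
  case: forallP => [h|h].
    congr (kostka _ _)%:R; apply: eq_map => i; rewrite ffunE /= inordK ?ltnS //.
  rewrite zero //; apply/negP => /eqP mn; apply: h => i.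
  by rewrite -mn mdegE (bigD1 i) //= leq_addr.
rewrite EL; have [mn|mn] := eqVneq (mdeg m) n; last first.
  rewrite zero // big1 // => p _; case pe: (perm_eq _ _); rewrite ?mulr0 //.
  by move: mn; rewrite -sumn_exps (perm_sumn pe) sumn_parts eqxx.
have [p pe] := exps_partn mn.
rewrite (bigD1 p) //= pe mulr1 big1 ?addr0 => [|p' ne].
  by rewrite kostka_filter -/(nonzero_exps m) (kostka_perm _ pe).
case pe': (perm_eq _ _); rewrite ?mulr0 //; case/eqP: ne.
by apply: perm_parts; rewrite perm_sym in pe'; apply: perm_trans pe' pe.
Qed.

(* Strictly increasing for the dominance order. *)
Definition dominance_rank (l : partn n) : nat := (\sum_(i < n.+1) \sum_(j < i) rowlen (val l) j)%N.

Lemma kostka_mx_diag l : kostka_mx l l = 1.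
Proof.
rewrite /kostka_mx kostka_diag //; [by rewrite partn_psize|exact: parts_sorted
  |exact: size_parts|by move=> i; rewrite nth_parts].
Qed.

Lemma sumn_take_parts l i : sumn (take i (parts l)) = (\sum_(j < i) rowlen (val l) j)%N.
Proof.
elim: i => [|i IH]; first by rewrite take0 big_ord0.
rewrite big_ord_recr /= -IH -nth_parts.
have [si|si] := leqP (size (parts l)) i.
  by rewrite nth_default // addn0 !take_oversize //; lia.
by rewrite (take_nth 0%N) // -cats1 sumn_cat /= addn0.
Qed.

(** By dominance the partial sums of [l] are at most those of [m]. If the rank did not increase, all
    of them would agree, and so would the partitions. *)
Lemma kostka_mx_triangular l m : kostka_mx l m != 0 -> l != m -> (dominance_rank l < dominance_rank m)%N.
Proof.
rewrite pnatr_eq0 -lt0n => k0 lm.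
have dom i : (\sum_(j < i) rowlen (val l) j <= \sum_(j < i) rowlen (val m) j)%N.
  by rewrite -sumn_take_parts kostka_dominance.
rewrite ltnNge; apply: contra lm => h; apply/eqP/partn_inj => i.
have eq_all : forall i, (i < n.+1)%N ->
    (\sum_(j < i) rowlen (val l) j = \sum_(j < i) rowlen (val m) j)%N.
  move=> p pn; apply/eqP; rewrite eqn_leq dom leqNgt; apply/negP => lt.
  move: h; rewrite leqNgt => /negP; apply.
  rewrite /dominance_rank (bigD1 (Ordinal pn)) //= [X in (_ < X)%N](bigD1 (Ordinal pn)) //=.
  by rewrite -addSn leq_add // leq_sum // => q _; apply: dom.
have [ni|ni] := leqP n i; first by rewrite !rowlen_out.
have := eq_all i.+1 ni; rewrite !big_ord_recr /= (eq_all i) //; last exact: ltnW.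
by move/addnI.
Qed.

(** A partition of [n] has at most [n] parts, so the truncation to [n] variables already separates
    the [msym], each being detected by this monomial. *)
Definition part_monomial l : 'X_{1..n} := [multinom rowlen (val l) i | i < n].

Lemma exps_part_monomial l : nonzero_exps (part_monomial l) = parts l.
Proof.
rewrite /nonzero_exps /parts; congr filter.
apply: (@eq_from_nth _ 0%N) => [|i]; first by rewrite size_map size_enum_ord size_map size_tuple.
rewrite size_map size_enum_ord => ni.
by rewrite (nth_map (Ordinal ni)) ?size_enum_ord // mnmE nth_enum_ord.
Qed.

Definition independent (b : partn n -> series int) : Prop :=
  forall c : partn n -> int, (forall N, \sum_l c l *: b l N = 0) -> forall l, c l = 0.

Lemma mcoeff_msym_part l m : (msym (parts l) n)@_(part_monomial m) = (m == l)%:R.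
Proof.
rewrite mcoeff_msym exps_part_monomial; case: eqP => [->|ne]; first by rewrite perm_refl.
by case p: (perm_eq _ _) => //; case: ne; apply: perm_parts.
Qed.

Lemma msym_independent : independent (fun l => msym (parts l)).
Proof.
move=> c /(_ n)/(congr1 (mcoeff (part_monomial _))) H l; have := H l.
rewrite mcoeff0 (raddf_sum (mcoeff (part_monomial l))) /=.
under eq_bigr do rewrite mcoeffZ mcoeff_msym_part.
rewrite (bigD1 l) //= eqxx mulr1 big1 ?addr0 // => m /negPf.
by rewrite eq_sym => ->; rewrite mulr0.
Qed.

Lemma sum_scale_exchange N (a : partn n -> int) (B : partn n -> partn n -> int)
    (b : partn n -> {mpoly int[N]}) :
  \sum_l a l *: (\sum_m B l m *: b m) = \sum_m (\sum_l a l * B l m) *: b m.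
Proof.
under eq_bigr do rewrite scaler_sumr.
rewrite exchange_big; apply: eq_bigr => m _ /=; rewrite scaler_suml.
by apply: eq_bigr => l _; rewrite scalerA.
Qed.

Lemma sum_delta N (l : partn n) (b : partn n -> {mpoly int[N]}) (c : partn n -> int) :
  (forall m, c m = (l == m)%:R) -> \sum_m c m *: b m = b l.
Proof.
move=> e; rewrite (bigD1 l) //= e eqxx scale1r big1 ?addr0 // => m /negPf.
by rewrite e eq_sym => ->; rewrite scale0r.
Qed.

Lemma independent_trans (b b' : partn n -> series int) (B J : partn n -> partn n -> int) :
  (forall l m, \sum_p B l p * J p m = (l == m)%:R) ->
  (forall l N, b' l N = \sum_m B l m *: b m N) -> independent b -> independent b'.
Proof.
move=> BJ b'b ind c c0 l.
have z m : \sum_p c p * B p m = 0.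
  apply: (ind (fun m => \sum_p c p * B p m)) => N.
  by rewrite -sum_scale_exchange -[RHS](c0 N); apply: eq_bigr => p _; rewrite b'b.
transitivity (\sum_m (\sum_p c p * B p m) * J m l); last first.
  by apply: big1 => m _; rewrite z mul0r.
under eq_bigr do rewrite mulr_suml.
rewrite exchange_big /=.
rewrite (eq_bigr (fun p => c p * (p == l)%:R)) => [|p _]; last first.
  by under eq_bigr do rewrite -mulrA; rewrite -mulr_sumr BJ.
rewrite (bigD1 l) //= eqxx mulr1 big1 ?addr0 // => p /negPf->.
by rewrite mulr0.
Qed.

(** An exhibited expansion makes the predicate under [epsilon] satisfiable, and independence
    identifies the chosen coefficients with the exhibited ones. *)
Lemma coordsE (b : seq nat -> series int) (f : series int) (c : partn n -> int) :
  independent (fun l => b (parts l)) ->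
  (forall N, f N = \sum_l c l *: b (parts l) N) ->
  forall l, coords n b f l = c l.
Proof.
move=> ind fc l; pose P (c' : {ffun partn n -> int}) := forall N, f N = \sum_(l : partn n) c' l *: b l N.
have H : P (coords n b f).
  apply: (ClassicalEpsilon.epsilon_spec (inhabits 0) P).
  by exists [ffun l => c l] => N; rewrite fc; apply: eq_bigr => m _; rewrite ffunE.
apply/eqP; rewrite -subr_eq0; apply/eqP; apply: (ind (fun l => coords n b f l - c l)) => N.
under eq_bigr do rewrite scalerBl.
by rewrite sumrB -fc -H subrr.
Qed.

Lemma transition_matrices : exists J : partn n -> partn n -> int,
  (forall l m, \sum_p J l p * kostka_mx p m = (l == m)%:R) /\
  (forall l m, \sum_p kostka_mx l p * J p m = (l == m)%:R).
Proof. exact: (unitriangular_inverse kostka_mx_diag kostka_mx_triangular). Qed.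

Lemma schur_independent : independent (fun l => schur (parts l)).
Proof.
have [J [JK KJ]] := transition_matrices.
apply: (independent_trans (b := fun l => msym (parts l)) (B := fun l m => kostka_mx m l)
   (J := fun l m => J m l)) msym_independent => [l m|l N]; last exact: schur_msym.
by under eq_bigr do rewrite mulrC; rewrite JK eq_sym.
Qed.

Lemma hsym_independent : independent (fun l => hsym (parts l)).
Proof.
have [J [JK KJ]] := transition_matrices.
by apply: (independent_trans KJ) schur_independent; apply: hsymE.
Qed.

Lemma elem_sym_schur l N : elem_sym (parts l) N = \sum_m kostka_mx l (conj_partn m) *: schur (parts m) N.
Proof.
rewrite elem_symE (reindex_inj (inv_inj conj_partnK)) /=.
by apply: eq_bigr => m _; rewrite conj_partnK.
Qed.

Lemma elem_sym_independent : independent (fun l => elem_sym (parts l)).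
Proof.
have [J [JK KJ]] := transition_matrices.
apply: (independent_trans (b := fun l => schur (parts l))
  (B := fun l m => kostka_mx l (conj_partn m)) (J := fun l m => J (conj_partn l) m))
  schur_independent => [l m|l N]; last exact: elem_sym_schur.
by rewrite -KJ [RHS](reindex_inj (inv_inj conj_partnK)).
Qed.

Lemma msym_schur : exists J : partn n -> partn n -> int,
  forall l N, msym (parts l) N = \sum_m J l m *: schur (parts m) N.
Proof.
have [J [JK KJ]] := transition_matrices; exists (fun l m => J m l) => l N.
under eq_bigr do rewrite schur_msym.
rewrite sum_scale_exchange (sum_delta (l := l)) // => m.
by under eq_bigr do rewrite mulrC; rewrite KJ eq_sym.
Qed.

Lemma msym_hsym : exists B : partn n -> partn n -> int,
  forall l N, msym (parts l) N = \sum_m B l m *: hsym (parts m) N.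
Proof.
have [J [JK KJ]] := transition_matrices; have [A HA] := msym_schur.
exists (fun l m => \sum_p A l p * J p m) => l N.
rewrite HA -sum_scale_exchange; apply: eq_bigr => p _; congr (_ *: _).
under eq_bigr do rewrite hsymE.
by rewrite sum_scale_exchange (sum_delta (l := p)).
Qed.

Lemma msym_elem_sym : exists B : partn n -> partn n -> int,
  forall l N, msym (parts l) N = \sum_m B l m *: elem_sym (parts m) N.
Proof.
have [J [JK KJ]] := transition_matrices; have [A HA] := msym_schur.
exists (fun l m => \sum_p A l p * J (conj_partn p) m) => l N.
rewrite HA -sum_scale_exchange; apply: eq_bigr => p _; congr (_ *: _).
under eq_bigr do rewrite elem_sym_schur.
rewrite sum_scale_exchange (sum_delta (l := p)) // => m.
by rewrite JK (inj_eq (inv_inj conj_partnK)).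
Qed.

Lemma elem_sym_msym : exists B : partn n -> partn n -> int,
  forall l N, elem_sym (parts l) N = \sum_m B l m *: msym (parts m) N.
Proof.
exists (fun l m => \sum_p kostka_mx l (conj_partn p) * kostka_mx m p) => l N.
rewrite elem_sym_schur -(sum_scale_exchange _ (fun p m => kostka_mx m p)).
by apply: eq_bigr => p _; rewrite schur_msym.
Qed.

Lemma hsym_msym l N :
  hsym (parts l) N = \sum_m (\sum_p kostka_mx l p * kostka_mx m p) *: msym (parts m) N.
Proof.
rewrite hsymE -(sum_scale_exchange _ (fun p m => kostka_mx m p)).
by apply: eq_bigr => p _; rewrite schur_msym.
Qed.

(** [hsymE] and [elem_symE] have the same Kostka coefficients, on Schur functions of conjugate
    partitions. *)
Lemma omega_elem_sym (d : partn n -> int) (f : series int) :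
  (forall N, f N = \sum_l d l *: elem_sym (parts l) N) ->
  forall N, omega n f N = \sum_l d l *: hsym (parts l) N.
Proof.
move=> fd N; rewrite /omega.
have cs := coordsE (b := schur) (f := f)
  (c := fun m => \sum_l d l * kostka_mx l (conj_partn m)) schur_independent.
under eq_bigr => m _.
  rewrite cs; last by move=> N'; rewrite fd -sum_scale_exchange;
    apply: eq_bigr => l _; rewrite elem_sym_schur.
  rewrite parts_conj; over.
rewrite (reindex_inj (inv_inj conj_partnK)) /=.
under eq_bigr do rewrite conj_partnK.
by rewrite -sum_scale_exchange; apply: eq_bigr => l _; rewrite hsymE.
Qed.

(** [hall] reads its first argument in the basis [hsym] and its second in [msym], while here the
    expansions are known the other way round. The roles may be exchanged because the transition
    matrix [G] from [hsym] to [msym] is the Kostka matrix times its transpose, hence symmetric. *)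
Lemma hall_omega_elem_sym (a d : partn n -> int) (f : series int) :
  (forall N, f N = \sum_l d l *: elem_sym (parts l) N) ->
  hall n (fun N => \sum_(l : partn n) a l *: msym l N) (omega n f) = \sum_l a l * d l.
Proof.
move=> fd; have [B HB] := msym_hsym.
pose G l m := \sum_p kostka_mx l p * kostka_mx m p.
have Gsym l m : G l m = G m l by apply: eq_bigr => p _; rewrite mulrC.
pose x m := \sum_l a l * B l m.
have ax m : a m = \sum_l x l * G l m.
  apply/eqP; rewrite -subr_eq0; apply/eqP.
  apply: (msym_independent (c := fun m => a m - \sum_l x l * G l m)) => N.
  under eq_bigr do rewrite scalerBl.
  rewrite sumrB -sum_scale_exchange; apply/eqP; rewrite subr_eq0; apply/eqP.
  under [RHS]eq_bigr do rewrite -hsym_msym.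
  by rewrite -sum_scale_exchange; apply: eq_bigr => l _; rewrite HB.
have cg := coordsE (b := msym) (f := omega n f) (c := fun m => \sum_l d l * G l m) msym_independent.
have cf := coordsE (b := hsym) (f := fun N => \sum_(l : partn n) a l *: msym l N)
  (c := x) hsym_independent.
rewrite /hall; under eq_bigr => l _.
  rewrite cf; last by move=> N; rewrite -sum_scale_exchange; apply: eq_bigr => p _; rewrite HB.
  rewrite cg; last by move=> N; rewrite (omega_elem_sym fd) -sum_scale_exchange;
    apply: eq_bigr => p _; rewrite hsym_msym.
  rewrite mulr_sumr; over.
rewrite exchange_big /=; apply: eq_bigr => m _.
rewrite ax mulr_suml; apply: eq_bigr => l _.
by rewrite Gsym [d m * _]mulrC mulrA.
Qed.

End Partitions.

(** * The chromatic quasisymmetric function *)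

Definition ord_fun (n : nat) (m : nat -> nat) (i : 'I_n) : 'I_n := insubd i (m i).

Lemma val_ord_fun n m (i : 'I_n) : hess n m -> ord_fun m i = m i :> nat.
Proof. by move=> [h _]; rewrite val_insubd; case/andP: (h i (ltn_ord i)) => _ ->. Qed.

Lemma eq_ord_fun n m m' : eq_upto n m m' -> @ord_fun n m =1 @ord_fun n m'.
Proof. by move=> e i; rewrite /ord_fun e. Qed.

Section Chromatic.
Variable q : nat.

(** The weight 0 for equal colors absorbs the properness condition, so the sum runs over all
    colorings. *)
Definition edge_weight (a b : nat) : int :=
  if a == b then 0 else if (a < b)%N then q%:Z else 1.

Definition color_weight n N (m : nat -> nat) (kappa : {ffun 'I_n -> 'I_N}) : int :=
  \prod_(i < n) \prod_(j < n | (i < j <= m i)%N) edge_weight (kappa i) (kappa j).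

Lemma specialize_chromatic n N (m : nat -> nat) : hess n m ->
  specialize q%:Z (chromatic_qsym (indifference_graph (@ord_fun n m))) N =
  \sum_(kappa : {ffun 'I_n -> 'I_N})
    color_weight m kappa *: \prod_(i < n) 'X_(kappa i).
Proof.
move=> hm; rewrite /specialize /chromatic_qsym raddf_sum [LHS]big_mkcond /=.
apply: eq_bigr => kappa _; rewrite map_mpolyZ rmorph_prod /=.
under eq_bigr do rewrite map_mpolyX.
rewrite /horner_eval hornerXn.
have ig (i j : 'I_n) : (i < j)%N -> indifference_graph (ord_fun m) i j = (j <= m i)%N.
  by move=> ij; rewrite /indifference_graph /= ij val_ord_fun //; case: (ltnP j i) => //; lia.
case: ifP => [/forallP pr|/negP npr].
  congr (_ *: _); rewrite /color_weight pair_big_dep /=.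
  rewrite (eq_bigr (fun e : 'I_n * 'I_n => if (kappa e.1 < kappa e.2)%N then q%:Z else 1)).
    rewrite -big_mkcondr prodr_const /asc; congr (_ ^+ _); apply: eq_card => e.
    rewrite !inE /= /in_mem /=; case: (ltnP e.1 e.2) => //= e12.
    by rewrite ig.
  move=> e /andP[e12 em]; rewrite /edge_weight.
  have /forallP/(_ e.2) := pr e.1; rewrite ig // em /=.
  by move=> /negPf; rewrite -val_eqE => ->.
rewrite (_ : color_weight m kappa = 0) ?scale0r //.
move: npr; rewrite /proper_coloring => /negP; rewrite negb_forall => /existsP[i].
rewrite negb_forall => /existsP[j]; rewrite negb_imply negbK => /andP[g /eqP e].
wlog ij : i j g e / (i < j)%N.
  move=> W; have [|ji|ji] := ltngtP i j; first exact: W.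
    apply: (W j i) => //; move: g; rewrite /indifference_graph /=; lia.
  by move: g; rewrite /indifference_graph /= ji ltnn.
rewrite ig // in g; rewrite /color_weight (bigD1 i) //= (bigD1 j) /=; last by rewrite ij.
by rewrite /edge_weight e eqxx !mul0r.
Qed.

Section Twins.
Variables (n N : nat) (p p' : 'I_n).

Definition swap_colors (kappa : {ffun 'I_n -> 'I_N}) : {ffun 'I_n -> 'I_N} :=
  [ffun i => kappa (perm.fun_of_perm (perm.tperm p p') i)].

Lemma swap_colorsK : involutive swap_colors.
Proof. by move=> kappa; apply/ffunP => i; rewrite !ffunE perm.tpermK. Qed.

Lemma swap_sum_zero (f : {ffun 'I_n -> 'I_N} -> int) :
  (forall kappa, f kappa + f (swap_colors kappa) = 0) -> \sum_kappa f kappa = 0.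
Proof.
move=> h; have : \sum_kappa f kappa + \sum_kappa f kappa = 0; last by lia.
rewrite [X in _ + X](reindex_inj (inv_inj swap_colorsK)) -big_split /=.
by apply: big1 => kappa _.
Qed.

Definition pair_weight (E : pred ('I_n * 'I_n)) (kappa : {ffun 'I_n -> 'I_N}) : int :=
  \prod_(e | E e) edge_weight (kappa e.1) (kappa e.2).

(** Exchanging the twins permutes all edges except the one joining them, so only that factor changes
    when their colors are swapped. *)
Lemma pair_weight_twin (E : pred ('I_n * 'I_n)) kappa :
  E (p, p') -> ~~ E (p', p) ->
  (forall e, e != (p, p') -> e != (p', p) ->
     E (perm.fun_of_perm (perm.tperm p p') e.1,
        perm.fun_of_perm (perm.tperm p p') e.2) = E e) ->
  exists R : int,
    pair_weight E kappa = edge_weight (kappa p) (kappa p') * R /\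
    pair_weight E (swap_colors kappa) = edge_weight (kappa p') (kappa p) * R.
Proof.
move=> Epp Ep'p tw; set s := perm.fun_of_perm (perm.tperm p p') in tw *.
have ss i : s (s i) = i by rewrite /s perm.tpermK.
exists (\prod_(e | E e && (e != (p, p'))) edge_weight (kappa e.1) (kappa e.2)).
rewrite /pair_weight; split; first by rewrite (bigD1 (p, p')).
rewrite (bigD1 (p, p')) //= !ffunE perm.tpermL perm.tpermR; congr (_ * _).
pose h (e : 'I_n * 'I_n) := (s e.1, s e.2).
have hK : involutive h by case=> a b; rewrite /h /= !ss.
rewrite [LHS](reindex_inj (inv_inj hK)) /=.
apply: eq_big => [e|e _]; last by rewrite !ffunE -/s !ss.
have [->|n1] := eqVneq e (p, p').
  by rewrite /h /= /s perm.tpermL perm.tpermR andbF (negPf Ep'p).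
have [->|n2] := eqVneq e (p', p).
  by rewrite /h /= /s perm.tpermL perm.tpermR eqxx andbF (negPf Ep'p).
rewrite tw // andbT; case: (E e) => //=; apply/eqP => e'.
case/eqP: n2; rewrite -(hK e) /h.
have -> : (s e.1, s e.2) = (p, p') by [].
by rewrite /= /s perm.tpermL perm.tpermR.
Qed.

(* Checking the identity for the three positions of the colour of the third
   vertex relative to the two colours of the twins. *)
Lemma twin_identity_row (x y z : nat) :
  let g x y := edge_weight x y *
    ((1 + q%:Z) * edge_weight z x - q%:Z - edge_weight z x * edge_weight z y) in
  g x y + g y x = 0.
Proof.
rewrite /= /edge_weight.
case: (ltngtP x y) => xy; case: (ltngtP z x) => zx; case: (ltngtP z y) => zy; try lia;
  rewrite ?mul0r ?addr0 ?mulr0 //; ring.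
Qed.

Lemma twin_identity_col (x y z : nat) :
  let g x y := edge_weight x y *
    ((1 + q%:Z) * edge_weight y z - q%:Z - edge_weight y z * edge_weight x z) in
  g x y + g y x = 0.
Proof.
rewrite /= /edge_weight.
case: (ltngtP x y) => xy; case: (ltngtP x z) => zx; case: (ltngtP y z) => zy; try lia;
  rewrite ?mul0r ?addr0 ?mulr0 //; ring.
Qed.

Lemma content_swap (a : 'X_{1..N}) kappa :
  (\prod_(i < n) 'X_(swap_colors kappa i) : {mpoly int[N]})@_a =
  (\prod_(i < n) 'X_(kappa i) : {mpoly int[N]})@_a.
Proof.
congr (mcoeff a _); rewrite [RHS](reindex_inj (@perm.perm_inj _ (perm.tperm p p'))) /=.
by apply: eq_bigr => i _; rewrite ffunE.
Qed.
End Twins.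

Definition chromatic_coef n N (a : 'X_{1..N}) (m : nat -> nat) : int :=
  (specialize q%:Z (chromatic_qsym (indifference_graph (@ord_fun n m))) N)@_a.

Definition edges n (m : nat -> nat) (e : 'I_n * 'I_n) : bool := (e.1 < e.2 <= m e.1)%N.

Lemma color_weightE n N m (kappa : {ffun 'I_n -> 'I_N}) :
  color_weight m kappa = pair_weight (edges m) kappa.
Proof. by rewrite /color_weight pair_big_dep. Qed.

Lemma pair_weight_add n N (E E' : pred ('I_n * 'I_n)) u v (kappa : {ffun 'I_n -> 'I_N}) :
  ~~ E (u, v) -> (forall e, E' e = E e || (e == (u, v))) ->
  pair_weight E' kappa = edge_weight (kappa u) (kappa v) * pair_weight E kappa.
Proof.
move=> Euv EE; rewrite /pair_weight (bigD1 (u, v)) /= ?EE ?eqxx ?orbT //; congr (_ * _).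
apply: eq_bigl => e; rewrite EE; case: eqP => [->|_]; last by rewrite orbF andbT.
by rewrite andbF (negPf Euv).
Qed.

Lemma chromatic_coefE n N (a : 'X_{1..N}) m : hess n m ->
  chromatic_coef n a m = \sum_(kappa : {ffun 'I_n -> 'I_N})
    pair_weight (edges m) kappa * (\prod_(i < n) 'X_(kappa i) : {mpoly int[N]})@_a.
Proof.
move=> hm; rewrite /chromatic_coef specialize_chromatic // (raddf_sum (mcoeff a)).
by apply: eq_bigr => kappa _; rewrite /= mcoeffZ color_weightE.
Qed.

Lemma hess_row_mid n m i j : (i < n)%N ->
  hess n (upd m i j) -> hess n (upd m i j.+2) -> hess n (upd m i j.+1).
Proof.
move=> iN [A0 B0] [A2 B2]; split=> [k kn|k l kl ln].
  by have := A0 k kn; have := A2 k kn; rewrite /upd; case: ifP => ?; lia.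
have := B0 k l kl ln; have := B2 k l kl ln; rewrite /upd.
by do ?[case: ifP => ?]; lia.
Qed.

Lemma hess_col_mid n m i j : (i.+1 < n)%N ->
  hess n (upd2 m i j j) -> hess n (upd2 m i j.+1 j.+1) -> hess n (upd2 m i j j.+1).
Proof.
move=> iN [A0 B0] [A2 B2]; split=> [k kn|k l kl ln].
  by have := A0 k kn; have := A2 k kn; rewrite /upd2 /upd; do ?[case: ifP => ?]; lia.
have := B0 k l kl ln; have := B2 k l kl ln; rewrite /upd2 /upd.
by do ?[case: ifP => ?]; lia.
Qed.

Lemma val_tperm n (p p' u : 'I_n) :
  perm.fun_of_perm (perm.tperm p p') u =
  (if u == p :> nat then p' else if u == p' :> nat then p else u) :> nat.
Proof.
case: perm.tpermP => [->|->|/eqP + /eqP]; rewrite ?eqxx //.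
  by case: eqP.
by rewrite -!val_eqE => /negPf-> /negPf->.
Qed.

Lemma modular_chromatic n N (a : 'X_{1..N}) : modular n q (chromatic_coef n a).
Proof.
split.
- move=> m m' e; rewrite /chromatic_coef.
  by have -> : @ord_fun n m = ord_fun m' by apply: functional_extensionality; apply: eq_ord_fun.
- move=> m i j iN R0 R2 mj; have R1 := hess_row_mid iN R0 R2.
  have [A0 B0] := R0; have [A2 B2] := R2.
  have Ai := A0 i iN; have Ai2 := A2 i iN; rewrite /upd eqxx in Ai Ai2.
  have j1 : (j.+1 < n)%N by lia.
  have j2 : (j.+2 < n)%N by lia.
  pose p := Ordinal j1; pose p' := Ordinal j2; pose z := Ordinal iN.
  have lo u : (u < i)%N -> (m u <= j)%N.
    by move=> ui; have := B0 u i (ltnW ui) iN; rewrite /upd eqxx ifF //; lia.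
  have hi u : (i < u)%N -> (u < n)%N -> (j.+2 <= m u)%N.
    by move=> ui un; have := B2 i u (ltnW ui) un; rewrite /upd eqxx ifF //; lia.
  have W1 (kappa : {ffun 'I_n -> 'I_N}) : pair_weight (edges (upd m i j.+1)) kappa =
      edge_weight (kappa z) (kappa p) * pair_weight (edges (upd m i j)) kappa.
    apply: pair_weight_add; first by rewrite /edges /upd /= eqxx; lia.
    by case=> u v; rewrite /edges /upd xpair_eqE -!val_eqE /=; case: ifP => ?; lia.
  have W2 (kappa : {ffun 'I_n -> 'I_N}) : pair_weight (edges (upd m i j.+2)) kappa =
      edge_weight (kappa z) (kappa p') * pair_weight (edges (upd m i j.+1)) kappa.
    apply: pair_weight_add; first by rewrite /edges /upd /= eqxx; lia.
    by case=> u v; rewrite /edges /upd xpair_eqE -!val_eqE /=; case: ifP => ?; lia.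
  rewrite !chromatic_coefE //; apply/eqP; rewrite -subr_eq0 opprD addrA.
  rewrite !mulr_sumr -!sumrB; apply/eqP.
  (* All three weights are now multiples of the one for [upd m i j], a graph in which [p] and [p']
     are interchangeable; each coloring cancels against its swap. *)
  apply: (@swap_sum_zero n N p p') => kappa; rewrite content_swap !W2 !W1.
  have [||e n1 n2|R [-> ->]] := @pair_weight_twin n N p p' (edges (upd m i j)) kappa.
  + by have := hi j.+1; rewrite /edges /upd /=; case: ifP => ?; lia.
  + by rewrite /edges /upd /=; lia.
  + case: e n1 n2 => u v; rewrite /edges !xpair_eqE -!val_eqE /=.
    have := lo u; have := hi u; have := ltn_ord u.
    have e1 : u = j.+1 :> nat -> m u = m j.+1 by move=> ->.
    have e2 : u = j.+2 :> nat -> m u = m j.+2 by move=> ->.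
    rewrite !val_tperm /p /p' /=; move: (ltn_ord v); rewrite /upd /=.
    by do ?[case: ifP => ? /=]; lia.
  rewrite !ffunE perm.tpermL perm.tpermR perm.tpermD; try by rewrite -val_eqE /=; lia.
  have := twin_identity_row (kappa p) (kappa p') (kappa z).
  move: (mcoeff _ _) => c /(congr1 (fun w => c * R * w)); rewrite mulr0 => <-.
  by ring.
- move=> m i j iN R0 R2 mi; have R1 := hess_col_mid iN R0 R2.
  have [A0 B0] := R0; have [A2 B2] := R2.
  have Ai := A0 i.+1 iN; have Ai2 := A2 i.+1 iN; rewrite /upd2 /upd eqxx in Ai Ai2.
  have j1 : (j.+1 < n)%N by lia.
  pose p := Ordinal (ltnW iN); pose p' := Ordinal iN; pose z := Ordinal j1.
  have lo u : (u < i)%N -> (m u <= j)%N.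
    move=> ui; have := B0 u i (ltnW ui) (ltnW iN).
    by rewrite /upd2 /upd eqxx !ifF //; lia.
  have hi u : (i.+1 < u)%N -> (u < n)%N -> (j.+1 <= m u)%N.
    by move=> ui un; have := B2 i.+1 u (ltnW ui) un; rewrite /upd2 /upd eqxx !ifF //; lia.
  have W1 (kappa : {ffun 'I_n -> 'I_N}) : pair_weight (edges (upd2 m i j j.+1)) kappa =
      edge_weight (kappa p') (kappa z) * pair_weight (edges (upd2 m i j j)) kappa.
    apply: pair_weight_add; first by rewrite /edges /upd2 /upd /= eqxx; lia.
    by case=> u v; rewrite /edges /upd2 /upd xpair_eqE -!val_eqE /=; do ?[case: ifP => ? /=]; lia.
  have W2 (kappa : {ffun 'I_n -> 'I_N}) : pair_weight (edges (upd2 m i j.+1 j.+1)) kappa =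
      edge_weight (kappa p) (kappa z) * pair_weight (edges (upd2 m i j j.+1)) kappa.
    apply: pair_weight_add.
      by rewrite /edges /upd2 /upd /= eqxx; case: ifP => ? /=; lia.
    by case=> u v; rewrite /edges /upd2 /upd xpair_eqE -!val_eqE /=; do ?[case: ifP => ? /=]; lia.
  rewrite !chromatic_coefE //; apply/eqP; rewrite -subr_eq0 opprD addrA.
  rewrite !mulr_sumr -!sumrB; apply/eqP.
  apply: (@swap_sum_zero n N p p') => kappa; rewrite content_swap !W2 !W1.
  have [||e n1 n2|R [-> ->]] := @pair_weight_twin n N p p' (edges (upd2 m i j j)) kappa.
  + by rewrite /edges /upd2 /upd /=; do ?[case: ifP => ? /=]; lia.
  + by rewrite /edges /upd2 /upd /=; lia.
  + case: e n1 n2 => u v; rewrite /edges !xpair_eqE -!val_eqE /=.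
    have := lo u; have := hi u; have := ltn_ord u; have := mi u.
    rewrite !val_tperm /p /p' /=; move: (ltn_ord v); rewrite /upd2 /upd /=.
    by do ?[case: ifP => ? /=]; lia.
  rewrite !ffunE perm.tpermL perm.tpermR perm.tpermD; try by rewrite -val_eqE /=; lia.
  have := twin_identity_col (kappa p) (kappa p') (kappa z).
  move: (mcoeff _ _) => c /(congr1 (fun w => c * R * w)); rewrite mulr0 => <-.
  by ring.
Qed.

End Chromatic.

(** * Colorings of disjoint complete graphs *)

Section CliqueColorings.
Variables (q N : nat).

Definition qnum (k : nat) : nat := (\sum_(j < k) q ^ j)%N.
Definition qfact (k : nat) : nat := (\prod_(i < k) qnum i.+1)%N.

(** The weights [h] carry the factors of the edges to vertices already removed, so that removing the
    first vertex gives a sum of the same form. *)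
Definition weighted_colorings n (m : nat -> nat) (h : nat -> 'I_N -> int) : {mpoly int[N]} :=
  \sum_(kappa : {ffun 'I_n -> 'I_N})
    (color_weight q m kappa * \prod_(i < n) h i (kappa i)) *: \prod_(i < n) 'X_(kappa i).

Lemma eq_weighted_colorings n m m' h h' :
  (forall i, (i < n)%N -> m i = m' i) ->
  (forall i c, (i < n)%N -> h i c = h' i c) ->
  weighted_colorings n m h = weighted_colorings n m' h'.
Proof.
move=> em eh; apply: eq_bigr => kappa _; congr ((_ * _) *: _).
  by apply: eq_bigr => i _; apply: eq_bigl => j; rewrite em.
by apply: eq_bigr => i _; rewrite eh.
Qed.

Lemma weighted_colorings_peel n m h :
  weighted_colorings n.+1 m h = \sum_(c : 'I_N) h 0%N c *: ('X_c *
    weighted_colorings n (fun i => (m i.+1).-1) (fun i c' =>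
      h i.+1 c' * (if (i.+1 <= m 0%N)%N then edge_weight q c c' else 1))).
Proof.
rewrite /weighted_colorings big_ffcons; apply: eq_bigr => c _.
rewrite mulr_sumr scaler_sumr; apply: eq_bigr => kappa _.
have -> : \prod_(i < n.+1) 'X_(ffcons c kappa i) =
    'X_c * \prod_(i < n) 'X_(kappa i) :> {mpoly int[N]}.
  by rewrite big_ord_recl ffcons0; congr (_ * _); apply: eq_bigr => i _; rewrite ffcons_lift.
have -> : \prod_(i < n.+1) h i (ffcons c kappa i) =
    h 0%N c * \prod_(i < n) h i.+1 (kappa i).
  by rewrite big_ord_recl ffcons0; congr (_ * _); apply: eq_bigr => i _; rewrite ffcons_lift.
have -> : color_weight q m (ffcons c kappa) =
    (\prod_(j < n) (if (j.+1 <= m 0%N)%N then edge_weight q c (kappa j) else 1)) *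
    color_weight q (fun i => (m i.+1).-1) kappa.
  rewrite /color_weight big_ord_recl; congr (_ * _).
    rewrite big_mkcond big_ord_recl /= mul1r; apply: eq_bigr => j _.
    by rewrite ffcons0 ffcons_lift.
  apply: eq_bigr => i _; rewrite big_mkcond big_ord_recl /= mul1r [RHS]big_mkcond.
  apply: eq_bigr => j _; rewrite !ffcons_lift /=.
  by have -> : (i.+1 < j.+1 <= m i.+1)%N = (i < j <= (m i.+1).-1)%N by lia.
rewrite big_split /= -scalerAr scalerA; congr (_ *: _).
by ring.
Qed.

Lemma Posz_exp (a k : nat) : (a ^ k)%N%:Z = a%:Z ^+ k.
Proof. by elim: k => [|k IH] //; rewrite expnS exprS PoszM IH. Qed.

Fixpoint block_poly (k : nat) (h : 'I_N -> int) : {mpoly int[N]} :=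
  if k is k'.+1 then
    \sum_(c : 'I_N) h c *: ('X_c * block_poly k' (fun c' => h c' * edge_weight q c c'))
  else 1.

Lemma weighted_colorings_cliques k l h :
  weighted_colorings (k + sumn l) (cliques (k :: l)) (fun i c => if (i < k)%N then h c else 1) =
  block_poly k h * weighted_colorings (sumn l) (cliques l) (fun _ _ => 1).
Proof.
elim: k h => [|k IH] h.
  rewrite mul1r add0n; apply: eq_weighted_colorings => // i _ /=.
  by rewrite subn0.
rewrite addSn weighted_colorings_peel mulr_suml; apply: eq_bigr => c _.
rewrite -scalerAl -mulrA -IH; congr (_ *: (_ * _)).
apply: eq_weighted_colorings => i => [_|c' _] /=.
  by rewrite ltnS subSS; case: ifP => ?; lia.
by rewrite ltnS; case: ifP; rewrite ?mulr1.
Qed.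

(** The exponents run through 0, ..., |A| - 1; the least element has the largest one and is split
    off. *)
Lemma sum_rank_weights (A : {set 'I_N}) :
  \sum_(c in A) q%:Z ^+ #|[set a in A | (c < a)%N]| = (qnum #|A|)%:Z.
Proof.
elim: {A}#|A| {-2}A (erefl #|A|) => [|k IH] A cA.
  by rewrite /qnum cA big_ord0 (cards0_eq cA) big_set0.
have [c cinA] : exists c, c \in A by apply/card_gt0P; rewrite cA.
have [/= b bA bmin] := @arg_minnP _ c (mem A) (fun i => i : nat) cinA.
rewrite (big_setD1 b) //= /qnum cA big_ord_recr /= PoszD addrC.
have cb : #|A :\ b| = k by have := cardsD1 b A; rewrite bA cA => -[].
congr (_ + _).
  transitivity (qnum #|A :\ b|)%:Z; last by rewrite cb.
  rewrite -IH //; apply: eq_bigr => x /setD1P[xb xA].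
  congr (_ ^+ _); apply: eq_card => y; rewrite !inE.
  case: eqP => //= ->; apply/andP => -[_]; have := bmin x xA; rewrite /=; lia.
rewrite Posz_exp.
congr (_ ^+ _); rewrite -cb; apply: eq_card => y; rewrite !inE andbC.
case yA: (y \in A); rewrite ?andbF ?andbT //.
by have := bmin y yA; rewrite ltn_neqAle /= => ->; rewrite andbT eq_sym.
Qed.

(* By induction on k, summing over the color c of the first vertex: each
   color of A that is larger than c contributes a factor q. *)
Lemma block_polyE k h : block_poly k h =
  (qfact k)%:Z *: \sum_(A : {set 'I_N} | #|A| == k) \prod_(a in A) (h a *: 'X_a).
Proof.
elim: k h => [|k IH] h /=.
  rewrite /qfact big_ord0 scale1r (big_pred1 set0) ?big_set0 // => A.
  by rewrite cards_eq0.
under eq_bigr => c _ do rewrite IH.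
transitivity (\sum_(c : 'I_N) \sum_(A : {set 'I_N} | (#|A| == k) && (c \notin A))
   (qfact k)%:Z *: ((q%:Z ^+ #|[set a in A | (c < a)%N]|) *:
     ((h c *: 'X_c) * \prod_(a in A) (h a *: 'X_a))) : {mpoly int[N]}).
  apply: eq_bigr => c _; rewrite -scalerAr scalerA mulrC -scalerA scalerAl mulr_sumr scaler_sumr.
  rewrite (bigID (fun A : {set 'I_N} => c \notin A)) /= [X in _ + X]big1 ?addr0.
    apply: eq_bigr => A /andP[_ cA]; congr (_ *: _).
    have -> : \prod_(a in A) ((h a * edge_weight q c a) *: 'X_a) =
       (q%:Z ^+ #|[set a in A | (c < a)%N]|) *: \prod_(a in A) (h a *: 'X_a) :> {mpoly int[N]}.
      transitivity (\prod_(a in A) ((if (c < a)%N then q%:Z else 1) *: (h a *: 'X_a : {mpoly int[N]}))).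
        apply: eq_bigr => a aA; rewrite scalerA /edge_weight mulrC.
        by case: ifP => // /eqP/val_inj e; rewrite e aA in cA.
      rewrite scaler_prod; congr (_ *: _).
      rewrite -big_mkcondr prodr_const; congr (_ ^+ _); apply: eq_card => a.
      by rewrite !inE.
    by rewrite -scalerAr.
  move=> A /andP[_]; rewrite negbK => cA.
  by rewrite (bigD1 c) //= /edge_weight eqxx mulr0 scale0r mul0r !mulr0 scaler0.
transitivity (\sum_(c : 'I_N) \sum_(B : {set 'I_N} | (#|B| == k.+1) && (c \in B))
   (qfact k)%:Z *: ((q%:Z ^+ #|[set a in B | (c < a)%N]|) *:
     \prod_(a in B) (h a *: 'X_a)) : {mpoly int[N]}).
  apply: eq_bigr => c _.
  rewrite (reindex_onto (fun B : {set 'I_N} => B :\ c) (fun A => c |: A)) /=; last first.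
    by move=> A /andP[_ cA]; rewrite setU1K.
  apply: eq_big => [B|B /andP[/andP[_ _] /eqP e]].
    rewrite !inE eqxx andbT.
    case cB: (c \in B).
      by rewrite setD1K // eqxx andbT (cardsD1 c B) cB andbT.
    rewrite andbF; apply/negbTE/nandP; right; apply/eqP => e.
    by move: cB; rewrite -e !inE eqxx.
  have cB : c \in B by rewrite -e !inE eqxx.
  congr (_ *: (_ ^+ _ *: _)); last by rewrite [RHS](big_setD1 c).
  apply: eq_card => a; rewrite !inE; case: eqP => //= ->.
  by rewrite ltnn !andbF.
rewrite (exchange_big_dep (fun A : {set 'I_N} => #|A| == k.+1)) /=; last by move=> c A _ /andP[].
rewrite scaler_sumr; apply: eq_bigr => B /eqP cB.
rewrite -scaler_sumr -scaler_suml (eq_bigl (mem B)) => [|c]; last by rewrite cB eqxx.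
by rewrite sum_rank_weights cB scalerA /qfact big_ord_recr PoszM.
Qed.

Lemma weighted_colorings_elem_sym n l : sumn l = n ->
  weighted_colorings n (cliques l) (fun _ _ => 1) =
  (\prod_(k <- l) qfact k)%N%:Z *: elem_sym l N.
Proof.
rewrite /elem_sym; elim: l n => [|k l IH] n <-.
  rewrite !big_nil scale1r /weighted_colorings (big_pred1 [ffun i : 'I_0 => False_rect _ (notF (ltn_ord i))]).
    by rewrite /color_weight !big_ord0 mulr1 scale1r.
  by move=> f; apply/esym/eqP/ffunP => -[].
rewrite /= (eq_weighted_colorings (m' := cliques (k :: l))
  (h' := fun i _ => if (i < k)%N then 1 else 1)) //; last by move=> i c _; case: ifP.
rewrite (weighted_colorings_cliques k l (fun=> 1)) (IH _ erefl) block_polyE.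
rewrite !big_cons PoszM -scalerAl -scalerAr scalerA; congr (_ *: (_ * _)).
by rewrite erecE; apply: eq_bigr => A _; apply: eq_bigr => a _; rewrite scale1r.
Qed.

Lemma specialize_chromatic_cliques n l : sumn l = n ->
  specialize q%:Z (chromatic_qsym (indifference_graph (@ord_fun n (cliques l)))) N =
  (\prod_(k <- l) qfact k)%N%:Z *: elem_sym l N.
Proof.
move=> ln; rewrite -(weighted_colorings_elem_sym ln) specialize_chromatic; last first.
  by rewrite -ln; apply: hess_cliques.
by apply: eq_bigr => kappa _; rewrite [\prod_i 1]big1 ?mulr1.
Qed.

End CliqueColorings.

(** * Flags and Hessenberg varieties *)

Section Subspaces.
Variables (F : finFieldType) (n : nat).
Implicit Types (U V W X Y L A B : {vspace 'rV[F]_n}) (T : 'End('rV[F]_n)).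

Lemma card_memv U : #|[pred v : 'rV[F]_n | v \in U]| = (#|F| ^ \dim U)%N.
Proof. exact: (card_vspace U). Qed.

Lemma qnum_mul (q k : nat) : (0 < q)%N -> ((q - 1) * qnum q k = q ^ k - 1)%N.
Proof.
move=> q0; elim: k => [|k IH]; first by rewrite /qnum big_ord0 muln0.
rewrite /qnum big_ord_recr /= -/(qnum q k) mulnDr IH mulnBl mul1n -expnS.
have : (0 < q ^ k)%N by rewrite expn_gt0 q0.
have : (q ^ k <= q ^ k.+1)%N by rewrite expnS leq_pmull.
by lia.
Qed.

Lemma dim_add_line X v : v \notin X -> \dim (X + <[v]>) = (\dim X).+1.
Proof.
move=> vX; have v0 : v != 0 by apply: contraNneq vX => ->; rewrite mem0v.
rewrite dimv_disjoint_sum ?dim_vline ?v0 ?addn1 //.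
apply/eqP; rewrite -subv0; apply/subvP => w; rewrite memv_cap memv0 => /andP[wX /vlineP[k wk]].
case: (eqVneq k 0) => [k0|k0]; first by rewrite wk k0 scale0r.
case/negP: vX; have -> : v = k^-1 *: w by rewrite wk scalerA mulVf ?scale1r.
exact: memvZ.
Qed.

(** Group the vectors [v] of [Y] outside [X] by the space that [X] and [v] span: each [L] is
    obtained from all its vectors outside [X]. *)
Lemma card_points X Y : (X <= Y)%VS ->
  #|[pred L : {vspace 'rV[F]_n} | [&& (X <= L)%VS, (L <= Y)%VS & \dim L == (\dim X).+1]]| =
  qnum #|F| (\dim Y - \dim X).
Proof.
move=> XY; set q := #|F|; have q1 : (1 < q)%N by apply: finRing_gt1.
set S := [pred L | _]; set x := \dim X.
have dXY := dimvS XY.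
have cD U : (X <= U)%VS -> #|[pred v : 'rV[F]_n | (v \in U) && (v \notin X)]| = (q ^ \dim U - q ^ x)%N.
  move=> XU; rewrite -!card_memv -(cardID [pred v | v \in X] [pred v | v \in U]).
  rewrite [X in (X + _ - _)%N](_ : _ = #|[pred v | v \in X]|); last first.
    by apply: eq_card => v; rewrite !inE andbC; case vX: (v \in X) => //=; rewrite (subvP XU).
  by rewrite addKn; apply: eq_card => v; rewrite !inE andbC.
have key : ((q ^ x.+1 - q ^ x) * #|S| = q ^ \dim Y - q ^ x)%N.
  rewrite -cD // -[RHS]sum1_card.
  rewrite (partition_big (fun v => X + <[v]>)%VS S) /=; last first.
    move=> v /andP[vY vX]; rewrite addvSl dim_add_line // eqxx andbT /=.
    by rewrite subv_add XY -memvE.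
  rewrite mulnC -sum_nat_const; apply: eq_bigr => L /and3P[XL LY /eqP dL].
  rewrite sum1_card -dL -cD //; apply: eq_card => v; rewrite [RHS]unfold_in /= !inE.
  case vX: (v \in X); rewrite ?andbF ?andbT //=.
  apply/idP/andP => [vL|[vY /eqP <-]]; last by rewrite memvE addvSr.
  split; first exact: (subvP LY).
  by rewrite eqEdim subv_add XL -memvE vL dim_add_line ?vX // dL leqnn.
have qx : (0 < q ^ x)%N by rewrite expn_gt0; lia.
apply/eqP; rewrite -(eqn_pmul2l (m := (q ^ x * (q - 1))%N)); last by rewrite muln_gt0 qx; lia.
have -> : (q ^ x * (q - 1) = q ^ x.+1 - q ^ x)%N by rewrite mulnBr muln1 -expnSr.
rewrite key (_ : (q ^ x.+1 - q ^ x = q ^ x * (q - 1))%N); last by rewrite mulnBr muln1 -expnSr.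
rewrite -mulnA qnum_mul; last lia.
by rewrite mulnBr muln1 -expnD subnKC.
Qed.

(** [T] embeds the quotient of [U] by the intersection into the one-dimensional [Y / X]; the
    dimensions are compared by rank and nullity. *)
Lemma dim_preim T U X Y : (X <= Y)%VS -> \dim Y = (\dim X).+1 -> (T @: U <= Y)%VS ->
  (\dim U <= (\dim (U :&: T @^-1: X)).+1)%N.
Proof.
move=> XY dY TU.
have e1 := limg_ker_dim T U; have e2 := limg_ker_dim T (U :&: T @^-1: X)%VS.
have le1 : (\dim (U :&: lker T) <= \dim (U :&: T @^-1: X :&: lker T))%N.
  apply: dimvS; apply/subvP => v; rewrite !memv_cap -memv_preim memv_ker => /andP[-> /eqP->].
  by rewrite mem0v eqxx.
have img : (T @: (U :&: T @^-1: X) = T @: U :&: X)%VS.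
  apply/vspaceP => w; apply/memv_imgP/idP => [[v]|].
    by rewrite !memv_cap -memv_preim => /andP[vU vX] ->; rewrite memv_img.
  rewrite memv_cap => /andP[/memv_imgP[v vU ->] wX].
  by exists v; rewrite // memv_cap vU -memv_preim.
have e3 := dimv_sum_cap (T @: U) X.
have : (\dim (T @: U + X) <= \dim Y)%N by apply: dimvS; rewrite subv_add TU.
rewrite img dY in e2 *.
have aux u k t d k' i s x : (k + t = u -> k' + i = d -> k <= k' -> s + i = t + x ->
  s <= x.+1 -> u <= d.+1)%N by lia.
exact: aux e1 e2 le1 e3.
Qed.

End Subspaces.

Section HessenbergCount.
Variables (F : finFieldType) (n : nat) (T : 'End('rV[F]_n)).
Notation vs := {vspace 'rV[F]_n}.
Notation flag := {ffun 'I_n -> vs}.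
Implicit Types (V U : flag) (L A B : vs) (m : nat -> nat).

(* The k-dimensional member of the flag. *)
Definition member V (k : nat) : vs :=
  if k is k'.+1 then (if insub k' is Some i then V i else fullv) else 0%VS.

Arguments member : simpl never.

Lemma member0 V : member V 0 = 0%VS. Proof. by []. Qed.

Lemma memberS V (i : 'I_n) : member V i.+1 = V i.
Proof. by rewrite /member valK. Qed.

Lemma member_mono V k l :
  (forall k, (k < n)%N -> (member V k <= member V k.+1)%VS) ->
  (k <= l)%N -> (l <= n)%N -> (member V k <= member V l)%VS.
Proof.
move=> Hi; elim: l => [|l IH]; first by rewrite leqn0 => /eqP->.
rewrite leq_eqVlt => /orP[/eqP-> //|kl ln].
exact: subv_trans (IH kl (ltnW ln)) (Hi l ln).
Qed.

Lemma hessenberg_varietyP m V : hess n m ->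
  reflect [/\ forall k, (k <= n)%N -> \dim (member V k) = k,
              forall k, (k < n)%N -> (member V k <= member V k.+1)%VS
            & forall k, (k < n)%N -> (T @: member V k.+1 <= member V (m k).+1)%VS]
          (V \in hessenberg_variety (@ord_fun n m) T).
Proof.
move=> hm; have [h1 h2] := hm; rewrite inE; apply: (iffP and3P).
  move=> [/forallP Hd /forallP Hi /forallP HT]; split=> [[|k] kn|[|k] kn|k kn].
  - by rewrite member0 dimv0.
  - by rewrite -[k]/(val (Ordinal kn)) memberS (eqP (Hd _)).
  - exact: sub0v.
  - rewrite -[k.+1]/(val (Ordinal kn)) memberS -[(val _)]/(val (Ordinal (ltnW kn))).+1 memberS.
    by have /forallP/(_ (Ordinal kn))/implyP := Hi (Ordinal (ltnW kn)); apply; rewrite /= leqnSn.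
  - rewrite -{1}[k]/(val (Ordinal kn)) memberS.
    have := HT (Ordinal kn); rewrite -(memberS V (ord_fun m (Ordinal kn))).
    by rewrite val_ord_fun.
move=> [Hd Hi HT]; have mono := member_mono Hi.
split.
- by apply/forallP => i; rewrite -memberS Hd.
- by apply/forallP => i; apply/forallP => j; apply/implyP => ij; rewrite -!memberS mono.
- by apply/forallP => i; rewrite -!memberS val_ord_fun // HT.
Qed.

Definition replace V (J : 'I_n) L : flag := [ffun i => if i == J then L else V i].

Lemma member_replace V J L k :
  member (replace V J L) k = if k == J.+1 then L else member V k.
Proof.
case: k => [|k] //; rewrite eqSS /member; case: insubP => [i _ <-|].
  by rewrite ffunE.
by rewrite -leqNgt => nk; rewrite ifF //; have := ltn_ord J; lia.
Qed.

(** Double counting through the involution that exchanges the member at [J] with [L]. Summing over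
    all families of subspaces avoids choosing representatives of flags that differ at [J]. *)
Lemma card_replace (P : pred flag) (J : 'I_n) :
  (\sum_(U : flag) #|[pred L | P (replace U J L)]| = #|[pred V | P V]| * #|{: vs}|)%N.
Proof.
pose h (p : flag * vs) := (replace p.1 J p.2, p.1 J).
have hK : involutive h.
  move=> [V L]; rewrite /h /=; congr pair; last by rewrite ffunE eqxx.
  by apply/ffunP => i; rewrite !ffunE; case: eqP => // ->.
transitivity (\sum_(p : flag * vs) P (h p).1)%N.
  rewrite -(pair_bigA _ (fun U L => P (h (U, L)).1 : nat)) /=.
  by apply: eq_bigr => U _; rewrite -sum1_card big_mkcond; apply: eq_bigr => L _; rewrite inE; case: (P _).
rewrite (reindex_inj (inv_inj hK)); under eq_bigr do rewrite hK.
rewrite -(pair_bigA _ (fun U (L : vs) => P U : nat)) /=.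
under eq_bigr do rewrite sum_nat_const.
rewrite -big_distrr /= mulnC; congr (_ * _)%N.
by rewrite -sum1_card [RHS]big_mkcond; apply: eq_bigr => V _; rewrite inE; case: (P V).
Qed.

(** A linear relation between the counts follows from the same relation with all members but one
    fixed. Fibers without a flag in [P2] contribute zero to all three terms. *)
Lemma card_modular (q : nat) (P0 P1 P2 : pred flag) (J : 'I_n) :
  (forall V, P0 V -> P2 V) -> (forall V, P1 V -> P2 V) ->
  (forall V, P2 V -> ((1 + q) * #|[pred L | P1 (replace V J L)]| =
     q * #|[pred L | P0 (replace V J L)]| + #|[pred L | P2 (replace V J L)]|)%N) ->
  ((1 + q) * #|[pred V | P1 V]| = q * #|[pred V | P0 V]| + #|[pred V | P2 V]|)%N.
Proof.
move=> P02 P12 h; have vs0 : (0 < #|{: vs}|)%N by apply/card_gt0P; exists 0%VS.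
apply/eqP; rewrite -(eqn_pmul2r vs0) [X in _ == X]mulnDl -!mulnA -!(card_replace _ J).
rewrite !big_distrr -big_split /=; apply/eqP; apply: eq_bigr => U _.
have [c0|[L0 P2L]] := set_0Vmem [set L | P2 (replace U J L)].
  have z (P : pred flag) : (forall V, P V -> P2 V) -> #|[pred L | P (replace U J L)]| = 0%N.
    move=> PP; apply: eq_card0 => L; rewrite inE; apply/negP => /PP h2.
    by have := in_set0 L; rewrite -c0 inE h2.
  by rewrite !z ?muln0.
rewrite inE in P2L; have := h _ P2L.
have rr L : replace (replace U J L0) J L = replace U J L.
  by apply/ffunP => i; rewrite !ffunE; case: eqP.
have e (P : pred flag) : #|[pred L | P (replace (replace U J L0) J L)]| =
   #|[pred L | P (replace U J L)]| by apply: eq_card => L; rewrite !inE rr.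
by rewrite !e.
Qed.

(** The image of [W] in the quotient by [A] comes from the one-dimensional [W / W'] and is
    nonzero. *)
Lemma add_line_between A W W' : (W' <= W)%VS -> \dim W = (\dim W').+1 ->
  (T @: W' <= A)%VS -> ~~ (T @: W <= A)%VS -> \dim (A + T @: W) = (\dim A).+1.
Proof.
move=> WW dW TA TnA.
have [w wW wnW] : exists2 w, w \in W & w \notin W'.
  by apply/subvPn; apply: contraTN isT => /dimvS; rewrite dW ltnn.
have eW : W = (W' + <[w]>)%VS.
  apply/esym/eqP; rewrite eqEdim subv_add WW -memvE wW /= dim_add_line // dW.
  by rewrite leqnn.
have Tw : T w \notin A.
  apply: contra TnA => TwA; rewrite eW limgD subv_add TA /= limg_line.
  by rewrite -memvE.
rewrite eW limgD addvA limg_line (_ : A + T @: W' = A)%VS ?dim_add_line //.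
by apply/addv_idPl.
Qed.

Definition hess_count m : int := #|hessenberg_variety (@ord_fun n m) T|%:Z.

Lemma card_lines A B : (A <= B)%VS -> \dim B = (\dim A).+2 ->
  #|[pred L : vs | [&& (A <= L)%VS, (L <= B)%VS & \dim L == (\dim A).+1]]| = #|F|.+1.
Proof.
move=> AB dB; rewrite card_points // dB -addn2 addKn /qnum !big_ord_recr big_ord0 /=.
by rewrite expn1 add1n.
Qed.

Lemma modular_hess_count : modular n #|F| hess_count.
Proof.
have to_int a b c : ((1 + #|F|) * b = #|F| * a + c)%N ->
    (1 + #|F|%:Z) * b%:Z = #|F|%:Z * a%:Z + c%:Z :> int.
  by move=> e; rewrite -!PoszM -PoszD -e.
have card_set m : hess_count m = #|[pred V | V \in hessenberg_variety (@ord_fun n m) T]|%:Z.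
  by [].
split.
- move=> m m' e; rewrite /hess_count.
  by have -> : @ord_fun n m = ord_fun m' by apply: functional_extensionality; apply: eq_ord_fun.
- move=> m i j iN R0 R2 mj; have R1 := hess_row_mid iN R0 R2.
  have [A0 B0] := R0; have [A2 B2] := R2.
  have Ai := A0 i iN; have Ai2 := A2 i iN; rewrite /upd eqxx in Ai Ai2.
  have j1 : (j.+1 < n)%N by lia.
  pose J := Ordinal j1.
  have lo u : (u < i)%N -> (m u <= j)%N.
    by move=> ui; have := B0 u i (ltnW ui) iN; rewrite /upd eqxx ifF //; lia.
  have hi u : (i < u)%N -> (u < n)%N -> (j.+2 <= m u)%N.
    by move=> ui un; have := B2 i u (ltnW ui) un; rewrite /upd eqxx ifF //; lia.
  rewrite !card_set; apply: to_int; apply: (card_modular (J := J)).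
  + move=> V /(hessenberg_varietyP _ R0)[Hd Hi HT]; apply/(hessenberg_varietyP _ R2); split=> // k kn.
    have := HT k kn; rewrite /upd; case: eqP => // _ h; apply: subv_trans h _.
    by apply: subv_trans (Hi j.+1 _) (Hi j.+2 _); lia.
  + move=> V /(hessenberg_varietyP _ R1)[Hd Hi HT]; apply/(hessenberg_varietyP _ R2); split=> // k kn.
    have := HT k kn; rewrite /upd; case: eqP => // _ h; apply: subv_trans h _.
    by apply: Hi; lia.
  move=> V /(hessenberg_varietyP _ R2)[Hd Hi HT].
  set A := member V j.+1; set B := member V j.+3; set W := member V i.+1.
  have AB : (A <= B)%VS by apply: subv_trans (Hi j.+1 _) (Hi j.+2 _); lia.
  have dA : \dim A = j.+1 by rewrite Hd //; lia.
  have dB : \dim B = j.+3 by rewrite Hd //; lia.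
  have dBA : \dim B = (\dim A).+2 by rewrite dA.
  have TWB : (T @: W <= B)%VS by have := HT i iN; rewrite /upd eqxx.
  have char v (C : vs -> vs) (R : hess n (upd m i v)) :
      (forall L, member (replace V J L) v.+1 = C L) ->
      [pred L | replace V J L \in hessenberg_variety (@ord_fun n (upd m i v)) T] =1
      [pred L | [&& (A <= L)%VS, (L <= B)%VS & \dim L == (\dim A).+1] && (T @: W <= C L)%VS].
    move=> CE L; rewrite /=; have eu : upd m i v i = v by rewrite /upd eqxx.
    apply/(hessenberg_varietyP _ R)/andP.
      move=> [Hd' Hi' HT']; have := HT' i iN; rewrite eu CE member_replace ifF; last by rewrite /=; lia.
      move=> ->; split=> //.
      have := Hi' j.+1 ltac:(lia); have := Hi' j.+2 ltac:(lia); have := Hd' j.+2 ltac:(lia).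
      rewrite !member_replace /= eqxx !ifF; try lia.
      by move=> dL -> ->; rewrite dL dA eqxx.
    move=> [/and3P[AL LB /eqP dL] TW]; split=> k kn.
    - by rewrite member_replace /=; case: eqP => [->|_]; rewrite ?Hd ?dL ?dA.
    - rewrite !member_replace /=; case: eqP => [->|n1]; first by rewrite ifF //; lia.
      case: eqP => [e|n2]; last exact: Hi.
      by have -> : k = j.+1 by lia.
    have [->|ki] := eqVneq k i.
      by rewrite eu CE member_replace ifF //=; lia.
    (* At row j + 1 the space [L] itself is mapped. The condition follows from that at row j + 2,
       because [L] lies in [B] and the twins have equal rows. *)
    rewrite !member_replace /upd (negPf ki) /=; case: eqP => [[->]|n1].
      rewrite ifF; last by have := hi j.+1; lia.
      apply: subv_trans (limgS _ LB) _.
      by have := HT j.+2 ltac:(lia); rewrite /upd ifF ?mj //; lia.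
    rewrite ifF; first by have := HT k kn; rewrite /upd (negPf ki).
    by have := lo k; have := hi k; lia.
  have E0 L : member (replace V J L) j.+1 = A by rewrite member_replace /= ifF //; lia.
  have E1 L : member (replace V J L) j.+2 = L by rewrite member_replace /= eqxx.
  have E2 L : member (replace V J L) j.+3 = B by rewrite member_replace /= ifF //; lia.
  rewrite (eq_card (char _ _ R0 E0)) (eq_card (char _ _ R1 E1)) (eq_card (char _ _ R2 E2)) /=.
  rewrite [X in (_ = _ + X)%N](eq_card (B := [pred L | [&& (A <= L)%VS, (L <= B)%VS & \dim L == (\dim A).+1]]));
    last by move=> L; rewrite !inE TWB andbT.
  rewrite [X in (_ = _ + X)%N]card_lines //.
  (* The three counts are all q + 1 if [T @: W] lies in [A]. Otherwise they are 0, 1 and q + 1, the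
     single space being [A + T @: W]. *)
  case TWA: (T @: W <= A)%VS.
    rewrite (eq_card (B := [pred L | [&& (A <= L)%VS, (L <= B)%VS & \dim L == (\dim A).+1]])).
      rewrite [X in (_ = _ * X + _)%N](eq_card (B := [pred L | [&& (A <= L)%VS, (L <= B)%VS & \dim L == (\dim A).+1]])).
        by rewrite card_lines // mulnDl mul1n addnC.
      by move=> L; rewrite !inE andbT.
    move=> L; rewrite !inE; case AL: (A <= L)%VS => //=.
    by rewrite (subv_trans TWA AL) andbT.
  rewrite [X in (_ = _ * X + _)%N]eq_card0; last by move=> L; rewrite !inE andbF.
  rewrite muln0 add0n (eq_card (B := pred1 (A + T @: W)%VS)) ?card1 ?muln1 //.
  have dAT : \dim (A + T @: W) = (\dim A).+1.
    have Wi : (member V i <= W)%VS by apply: Hi.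
    apply: (add_line_between Wi) => //; rewrite ?Hd ?TWA //; try exact: ltnW.
    case: i {Wi B0 B2 R0 R1 R2 Ai Ai2 W TWB TWA char A0 A2} iN lo hi HT => [|i] iN lo hi HT.
      by rewrite member0 limg0 sub0v.
    have := HT i (ltnW iN); rewrite /upd ifF; last by lia.
    move=> h; apply: subv_trans h _; apply: (member_mono Hi); last lia.
    by rewrite ltnS lo.
  move=> L; rewrite !inE; apply/andP/eqP => [[/and3P[AL LB /eqP dL] TW]|->].
    by apply/esym/eqP; rewrite eqEdim subv_add AL TW dAT dL leqnn.
  by rewrite addvSl addvSr subv_add AB TWB dAT eqxx.
- move=> m i j iN R0 R2 mi; have R1 := hess_col_mid iN R0 R2.
  have [A0 B0] := R0; have [A2 B2] := R2.
  have Ai := A0 i.+1 iN; have Ai2 := A2 i.+1 iN; rewrite /upd2 /upd eqxx in Ai Ai2.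
  have j1 : (j.+1 < n)%N by lia.
  pose J := Ordinal (ltnW iN).
  have lo u : (u < i)%N -> (m u <= j)%N.
    move=> ui; have := B0 u i (ltnW ui) (ltnW iN).
    by rewrite /upd2 /upd eqxx !ifF //; lia.
  rewrite !card_set; apply: to_int; apply: (card_modular (J := J)).
  + move=> V /(hessenberg_varietyP _ R0)[Hd Hi HT]; apply/(hessenberg_varietyP _ R2); split=> // k kn.
    have := HT k kn; rewrite /upd2 /upd; case: eqP => [_|_]; last case: eqP => // _.
      by move=> h; apply: subv_trans h (Hi _ _); lia.
    by move=> h; apply: subv_trans h (Hi _ _); lia.
  + move=> V /(hessenberg_varietyP _ R1)[Hd Hi HT]; apply/(hessenberg_varietyP _ R2); split=> // k kn.
    have := HT k kn; rewrite /upd2 /upd; case: eqP => [_|_] //; case: eqP => // _.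
    by move=> h; apply: subv_trans h (Hi _ _); lia.
  move=> V /(hessenberg_varietyP _ R2)[Hd Hi HT].
  set A := member V i; set B := member V i.+2; set D := member V j.+1; set E := member V j.+2.
  have AB : (A <= B)%VS by apply: subv_trans (Hi i _) (Hi i.+1 _); lia.
  have dA : \dim A = i by rewrite Hd //; lia.
  have dB : \dim B = i.+2 by rewrite Hd //; lia.
  have dBA : \dim B = (\dim A).+2 by rewrite dA.
  have TBE : (T @: B <= E)%VS by have := HT i.+1 iN; rewrite /upd2 /upd eqxx.
  have DE : (D <= E)%VS by apply: Hi.
  have TAD : (T @: A <= D)%VS.
    rewrite /A; have [i0|ip] := posnP i; first by rewrite i0 member0 limg0 sub0v.
    have := HT i.-1 ltac:(lia); rewrite prednK // /upd2 /upd !ifF; try lia.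
    move=> h; apply: subv_trans h _; apply: (member_mono Hi); last lia.
    by rewrite ltnS lo //; lia.
  have char u v (C : vs -> bool) (R : hess n (upd2 m i u v)) :
      (forall L, (L <= B)%VS -> (T @: L <= member V u.+1)%VS && (T @: B <= member V v.+1)%VS = C L) ->
      (i < u)%N -> (i < v)%N ->
      [pred L | replace V J L \in hessenberg_variety (@ord_fun n (upd2 m i u v)) T] =1
      [pred L | [&& (A <= L)%VS, (L <= B)%VS & \dim L == (\dim A).+1] && C L].
    move=> CE iu iv L; rewrite /=.
    have eu : upd2 m i u v i = u by rewrite /upd2 /upd eqxx ifF //; lia.
    have ev : upd2 m i u v i.+1 = v by rewrite /upd2 /upd eqxx.
    apply/(hessenberg_varietyP _ R)/andP.
      move=> [Hd' Hi' HT']; have := HT' i (ltnW iN); have := HT' i.+1 iN.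
      rewrite eu ev !member_replace /= eqxx !ifF; try lia.
      move=> TB TL.
      have := Hi' i ltac:(lia); have := Hi' i.+1 ltac:(lia); have := Hd' i.+1 ltac:(lia).
      rewrite !member_replace /= eqxx !ifF; try lia.
      by move=> dL LB AL; rewrite -CE // TB TL dL dA LB AL eqxx.
    move=> [/and3P[AL LB /eqP dL]]; rewrite -CE // => /andP[TL TB]; split=> k kn.
    - by rewrite member_replace /=; case: eqP => [->|_]; rewrite ?Hd ?dL ?dA.
    - rewrite !member_replace /=; case: eqP => [->|n1]; first by rewrite ifF //; lia.
      case: eqP => [e|n2]; last exact: Hi.
      by have -> : k = i by lia.
    have [->|ki] := eqVneq k i.
      by rewrite eu !member_replace /= eqxx ifF //; lia.
    have [->|ki1] := eqVneq k i.+1.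
      by rewrite ev !member_replace /= !ifF //; lia.
    rewrite !member_replace /= ifF; last by lia.
    have ek : upd2 m i u v k = m k by rewrite /upd2 /upd (negPf ki) (negPf ki1).
    (* By [mi] the varying member is not the target space of any other row. *)
    rewrite ek ifF; last by have := mi k kn ki ki1; lia.
    by have := HT k kn; rewrite /upd2 /upd (negPf ki) (negPf ki1).
  have TLE L : (L <= B)%VS -> (T @: L <= E)%VS.
    by move=> LB; apply: subv_trans (limgS _ LB) TBE.
  have C0 L : (L <= B)%VS -> (T @: L <= D)%VS && (T @: B <= D)%VS = (T @: B <= D)%VS.
    by move=> LB; case TB: (T @: B <= D)%VS; rewrite ?andbF // (subv_trans (limgS _ LB) TB).
  have C1 L : (L <= B)%VS -> (T @: L <= D)%VS && (T @: B <= E)%VS = (T @: L <= D)%VS.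
    by move=> LB; rewrite TBE andbT.
  have C2 L : (L <= B)%VS -> (T @: L <= E)%VS && (T @: B <= E)%VS = true.
    by move=> LB; rewrite TBE TLE.
  rewrite (eq_card (char _ _ _ R0 C0 _ _)) ?(eq_card (char _ _ _ R1 C1 _ _)) ?(eq_card (char _ _ _ R2 C2 _ _)) /=; try lia.
  rewrite [X in (_ = _ + X)%N](eq_card (B := [pred L | [&& (A <= L)%VS, (L <= B)%VS & \dim L == (\dim A).+1]]));
    last by move=> L; rewrite !inE andbT.
  rewrite [X in (_ = _ + X)%N]card_lines //.
  (* The counts are again all q + 1, or else 0, 1 and q + 1; the single space is now the part of [B]
     that [T] maps into [D]. *)
  case TBD: (T @: B <= D)%VS.
    rewrite (eq_card (B := [pred L | [&& (A <= L)%VS, (L <= B)%VS & \dim L == (\dim A).+1]])).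
      rewrite [X in (_ = _ * X + _)%N](eq_card (B := [pred L | [&& (A <= L)%VS, (L <= B)%VS & \dim L == (\dim A).+1]])).
        by rewrite card_lines // mulnDl mul1n addnC.
      by move=> L; rewrite !inE andbT.
    move=> L; rewrite !inE; case LB: (L <= B)%VS; rewrite ?andbF //.
    by rewrite (subv_trans (limgS _ LB) TBD) andbT.
  rewrite [X in (_ = _ * X + _)%N]eq_card0; last by move=> L; rewrite !inE andbF.
  have sub : (B :&: T @^-1: D <= B)%VS by apply: capvSl.
  have TP : (T @: (B :&: T @^-1: D) <= D)%VS.
    apply/subvP => w /memv_imgP[v]; rewrite memv_cap -memv_preim => /andP[_ vD] ->.
    exact: vD.
  have dP : \dim (B :&: T @^-1: D) = (\dim A).+1.
    have := dim_preim DE _ TBE; rewrite [\dim D]Hd ?[\dim E]Hd; try lia.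
    move=> /(_ erefl); have : (\dim (B :&: T @^-1: D) < \dim B)%N.
      rewrite ltn_neqAle dimvS // andbT; apply/eqP => e.
      have eB : (B :&: T @^-1: D = B)%VS by apply/eqP; rewrite eqEdim sub e leqnn.
      by rewrite eB TBD in TP.
    by lia.
  rewrite muln0 add0n (eq_card (B := pred1 (B :&: T @^-1: D)%VS)) ?card1 ?muln1 //.
  move=> L; rewrite !inE; apply/andP/eqP => [[/and3P[AL LB /eqP dL] TL]|->].
    apply/eqP; rewrite eqEdim dP dL leqnn andbT subv_cap LB.
    by apply/subvP => v vL; rewrite -memv_preim; apply: (subvP TL); apply: memv_img.
  rewrite sub dP eqxx TP subv_cap AB; split=> //; rewrite !andbT.
  by apply/subvP => v vA; rewrite -memv_preim; apply: (subvP TAD); apply: memv_img.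
Qed.

End HessenbergCount.

Lemma forall_ord_recl N (P : pred 'I_N.+1) :
  [forall i, P i] = P ord0 && [forall i : 'I_N, P (lift ord0 i)].
Proof.
apply/forallP/andP => [h|[h0 /forallP h] i]; first by split=> //; apply/forallP => i.
by case: (unliftP ord0 i) => [j ->|->].
Qed.

(** * Flags for disjoint complete graphs *)

Section CliqueFlags.
Variables (F : finFieldType) (n : nat) (T : 'End('rV[F]_n)).
Notation vs := {vspace 'rV[F]_n}.
Implicit Types (X Y W : vs) (l : seq nat).

Definition dim_step k X Y : bool := (X <= Y)%VS && (\dim Y == \dim X + k)%N.

Fixpoint invariant_chains l X : nat :=
  if l is k :: l' then
    (\sum_(Y : vs | dim_step k X Y && (T @: Y <= Y)%VS) invariant_chains l' Y)%N
  else 1.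

Lemma card_inv_chains_from l X :
  #|[pred W : {ffun 'I_(size l).+1 -> vs} | [&& W ord0 == X,
      [forall i, (T @: W i <= W i)%VS] &
      [forall i : 'I_(size l),
        dim_step (nth 0%N l i) (W (widen_ord (leqnSn _) i)) (W (lift ord0 i))]]]| =
  ((T @: X <= X)%VS * invariant_chains l X)%N.
Proof.
elim: l X => [|k l IH] X.
  rewrite muln1 -sum1_card big_mkcond big_ffcons (bigD1 X) //= [X in (_ + X)%N]big1 ?addn0.
    rewrite (big_pred1 [ffun i : 'I_0 => False_rect _ (notF (ltn_ord i))]) => [|f]; last first.
      by apply/esym/eqP/ffunP => -[].
    rewrite inE ffcons0 eqxx /=.
    have -> : [forall i : 'I_0, dim_step (nth 0%N [::] i) (ffcons X [ffun i0 : 'I_0 => False_rect vs (notF (ltn_ord i0))] (widen_ord (leqnSn 0) i))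
       (ffcons X [ffun i0 : 'I_0 => False_rect vs (notF (ltn_ord i0))] (lift ord0 i))] by apply/forallP => -[].
    rewrite andbT; case: forallP => [/(_ ord0)|h].
      by rewrite ffcons0 => ->.
    by case TX: (T @: X <= X)%VS => //; case: h => i; rewrite ord1 ffcons0.
  move=> Y /negPf YX; rewrite big1 // => f _.
  by rewrite inE ffcons0 YX.
rewrite -sum1_card big_mkcond big_ffcons (bigD1 X) //= [X in (_ + X)%N]big1 ?addn0; last first.
  by move=> Y /negPf YX; rewrite big1 // => f _; rewrite inE ffcons0 YX.
rewrite -big_mkcond /= (partition_big (fun f : {ffun 'I_(size l).+1 -> vs} => f ord0) xpredT) //=.
rewrite big_distrr [RHS]big_mkcond; apply: eq_bigr => Y _ /=.
have E (f : {ffun 'I_(size l).+1 -> vs}) : [&& ffcons X f ord0 == X,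
      [forall i, (T @: ffcons X f i <= ffcons X f i)%VS] &
      [forall i : 'I_(size (k :: l)), dim_step (nth 0%N (k :: l) i)
        (ffcons X f (widen_ord (leqnSn _) i)) (ffcons X f (lift ord0 i))]] && (f ord0 == Y) =
   ((T @: X <= X)%VS && dim_step k X Y) && [&& f ord0 == Y,
      [forall i, (T @: f i <= f i)%VS] &
      [forall i : 'I_(size l),
        dim_step (nth 0%N l i) (f (widen_ord (leqnSn _) i)) (f (lift ord0 i))]].
  have e1 : [forall i, (T @: ffcons X f i <= ffcons X f i)%VS] =
      (T @: X <= X)%VS && [forall i, (T @: f i <= f i)%VS].
    rewrite forall_ord_recl ffcons0; congr (_ && _).
    by apply: eq_forallb => i; rewrite ffcons_lift.
  have e2 : [forall i : 'I_(size (k :: l)), dim_step (nth 0%N (k :: l) i)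
        (ffcons X f (widen_ord (leqnSn _) i)) (ffcons X f (lift ord0 i))] =
      dim_step k X (f ord0) && [forall i : 'I_(size l),
        dim_step (nth 0%N l i) (f (widen_ord (leqnSn _) i)) (f (lift ord0 i))].
    rewrite forall_ord_recl; congr (dim_step _ _ _ && _).
    - by rewrite (_ : widen_ord _ ord0 = ord0) ?ffcons0 //; apply: val_inj.
    - by rewrite ffcons_lift.
    apply: eq_forallb => i.
    rewrite ffcons_lift (_ : widen_ord _ (lift ord0 i) = lift ord0 (widen_ord (leqnSn _) i)) ?ffcons_lift //.
    exact: val_inj.
  rewrite e1 e2 ffcons0 eqxx /=.
  case: (f ord0 =P Y) => [->|_]; rewrite ?andbT ?andbF //=.
  by rewrite -!andbA; do !bool_congr.
rewrite sum1_card.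
rewrite (eq_card (B := [pred f : {ffun 'I_(size l).+1 -> vs} | ((T @: X <= X)%VS && dim_step k X Y) && [&& f ord0 == Y,
      [forall i, (T @: f i <= f i)%VS] &
      [forall i : 'I_(size l),
        dim_step (nth 0%N l i) (f (widen_ord (leqnSn _) i)) (f (lift ord0 i))]]])); last first.
  by move=> f; rewrite [RHS]inE -E.
case: (T @: X <= X)%VS; case: (dim_step k X Y) => /=; rewrite ?mul0n ?if_same ?mul1n; try by apply: eq_card0.
by rewrite IH; case: (T @: Y <= Y)%VS; rewrite ?mul1n.
Qed.

Lemma card_inv_flags l : #|inv_flags T l| = invariant_chains l 0%VS.
Proof.
have := card_inv_chains_from l 0%VS; rewrite limg0 subvv mul1n => <-.
by apply: eq_card => W; rewrite !inE.
Qed.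

(** [member] with the zero space replaced by [X], as needed once the first members of a flag have
    been split off. *)
Definition member_from N X (V : {ffun 'I_N -> vs}) (k : nat) : vs :=
  if k is k'.+1 then (if insub k' is Some i then V i else fullv) else X.

Arguments member_from : simpl never.

Lemma member_from_ffcons N X Y (V : {ffun 'I_N -> vs}) k :
  member_from X (ffcons Y V) k.+1 = member_from Y V k.
Proof.
rewrite /member_from; case: insubP => [i _ <-|]; last first.
  rewrite -leqNgt; case: k => [|k] // kN; case: insubP => // i iN _.
  by move: iN; lia.
rewrite ffunE; case: unliftP => [j ->|->] //.
have -> : val (lift ord0 j) = j.+1 by [].
by rewrite valK.
Qed.

(** [m i == i] marks the last vertex of a block. For a union of complete graphs invariance at these
    places implies all Hessenberg conditions, since each member lies in the one at the end of its
    block. *)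
Definition clique_flag N (m : nat -> nat) X (V : {ffun 'I_N -> vs}) : bool :=
  [forall i : 'I_N, dim_step 1 (member_from X V i) (member_from X V i.+1) &&
     ((m i == i) ==> (T @: member_from X V i.+1 <= member_from X V i.+1)%VS)].

Definition card_clique_flags N m X : nat := #|[pred V : {ffun 'I_N -> vs} | clique_flag m X V]|.

Lemma card_clique_flags_peel N m X : (forall i, (i < N)%N -> (i.+1 <= m i.+1)%N) ->
  card_clique_flags N.+1 m X = (\sum_(Y : vs | dim_step 1 X Y &&
     ((m 0%N == 0%N) ==> (T @: Y <= Y)%VS)) card_clique_flags N (fun i => (m i.+1).-1) Y)%N.
Proof.
move=> hm; rewrite /card_clique_flags -sum1_card big_mkcond big_ffcons [RHS]big_mkcond.
apply: eq_bigr => Y _ /=; rewrite -big_mkcond sum1_card /=.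
have E (V : {ffun 'I_N -> vs}) : clique_flag m X (ffcons Y V) =
    dim_step 1 X Y && ((m 0%N == 0%N) ==> (T @: Y <= Y)%VS) &&
    clique_flag (fun i => (m i.+1).-1) Y V.
  rewrite /clique_flag forall_ord_recl !member_from_ffcons; congr (_ && _).
  apply: eq_forallb => i; rewrite lift0 !member_from_ffcons.
  have -> : (m i.+1 == i.+1) = ((m i.+1).-1 == i) by have := hm i (ltn_ord i); lia.
  by [].
transitivity #|[pred V : {ffun 'I_N -> vs} | dim_step 1 X Y && ((m 0%N == 0%N) ==> (T @: Y <= Y)%VS) &&
    clique_flag (fun i => (m i.+1).-1) Y V]|.
  by apply: eq_card => V; exact: E.
by case: ifP => // h; apply: eq_card0.
Qed.

Lemma eq_card_clique_flags N m m' X : eq_upto N m m' ->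
  card_clique_flags N m X = card_clique_flags N m' X.
Proof.
move=> e; apply: eq_card => V; rewrite !inE; apply: eq_forallb => i.
by rewrite e.
Qed.

(* The line through X of a flag below W is one of the [dim W - dim X]_q points
   of W / X. *)
Lemma card_clique_flags_block k l X :
  card_clique_flags (k.+1 + sumn l) (cliques (k.+1 :: l)) X =
  (qfact #|F| k.+1 * \sum_(W : vs | dim_step k.+1 X W && (T @: W <= W)%VS)
     card_clique_flags (sumn l) (cliques l) W)%N.
Proof.
elim: k X => [|k IH] X.
  rewrite /qfact big_ord_recl big_ord0 /qnum big_ord_recl big_ord0 mul1n.
  rewrite add1n card_clique_flags_peel => [|i iN]; last first.
    by have [h _] := hess_cliques l; have := h i iN; rewrite /= subn1 /=; lia.
  apply: eq_bigr => Y _; apply: eq_card_clique_flags => i iN /=.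
  by rewrite subn1 /=; lia.
rewrite addSn card_clique_flags_peel => [|i iN]; last first.
  by have [h _] := hess_cliques (k.+2 :: l); have := h i.+1; rewrite /= addSn ltnS; move/(_ iN); lia.
have e Y : card_clique_flags (k.+1 + sumn l) (fun i => (cliques (k.+2 :: l) i.+1).-1) Y =
    card_clique_flags (k.+1 + sumn l) (cliques (k.+1 :: l)) Y.
  apply: eq_card_clique_flags => i iN /=.
  by rewrite ltnS subSS; case: ifP => ?; lia.
under eq_bigr do rewrite e IH.
have -> : qfact #|F| k.+2 = (qfact #|F| k.+1 * qnum #|F| k.+2)%N by rewrite /qfact big_ord_recr.
rewrite -big_distrr /= -mulnA; congr (_ * _)%N.
rewrite (exchange_big_dep (fun W => dim_step k.+2 X W && (T @: W <= W)%VS)) /=; last first.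
  move=> Y W /andP[/andP[XY /eqP dY] _] /andP[/andP[YW /eqP dW] ->].
  by rewrite andbT /dim_step (subv_trans XY YW) dW dY; lia.
rewrite big_distrr /=; apply: eq_bigr => W /andP[/andP[XW /eqP dW] TW].
rewrite sum_nat_const; congr (_ * _)%N.
have -> : k.+2 = (\dim W - \dim X)%N by rewrite dW addKn.
rewrite -card_points //; apply: eq_card => Y; rewrite unfold_in /= inE TW andbT andbT /dim_step.
case XY: (X <= Y)%VS => //=; rewrite addn1; case: (\dim Y =P (\dim X).+1) => [dY|_]; last by rewrite !andbF.
by rewrite andbT dW dY addSnnS eqxx andbT.
Qed.

Lemma card_clique_flags_chains l X : all (ltn 0) l ->
  card_clique_flags (sumn l) (cliques l) X =
  ((\prod_(k <- l) qfact #|F| k) * invariant_chains l X)%N.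
Proof.
elim: l X => [|[|k] l IH] X //=.
  rewrite big_nil mul1n /card_clique_flags (eq_card (B := pred1 [ffun i : 'I_0 => 0%VS])) ?card1 // => V.
  rewrite !inE; have -> : V = [ffun i : 'I_0 => 0%VS] by apply/ffunP => -[].
  by rewrite eqxx; apply/forallP => -[].
move=> l0; rewrite card_clique_flags_block big_cons -mulnA; congr (_ * _)%N.
by rewrite big_distrr /=; apply: eq_bigr => W _; rewrite IH.
Qed.

Lemma cliques_idempotent l i : (i < sumn l)%N -> cliques l (cliques l i) = cliques l i.
Proof.
elim: l i => [|k l IH] i //= il; case: (ltnP i k) => ik.
  by have -> : (k.-1 < k)%N by lia.
by rewrite ltnNge leq_addr /= addKn IH //; lia.
Qed.

Lemma hess_count_cliques l : all (ltn 0) l -> sumn l = n ->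
  hess_count T (cliques l) = ((\prod_(k <- l) qfact #|F| k) * #|inv_flags T l|)%N%:Z.
Proof.
move=> l0 ln; rewrite card_inv_flags -card_clique_flags_chains // ln; congr Posz.
have hl : hess n (cliques l) by rewrite -ln; apply: hess_cliques.
have [h1 h2] := hl.
apply: eq_card => V; rewrite [RHS]inE /clique_flag.
apply/(hessenberg_varietyP T V hl)/forallP.
  move=> [Hd Hi HT] i; have iN := ltn_ord i.
  have st : dim_step 1 (member V i) (member V i.+1).
    by rewrite /dim_step (Hi i iN) (Hd _ iN) (Hd i (ltnW iN)) addn1 eqxx.
  apply/andP; split=> //.
  by apply/implyP => /eqP e; have := HT i iN; rewrite e.
move=> H.
have st k : (k < n)%N -> dim_step 1 (member V k) (member V k.+1).
  by move=> kn; have /andP[] := H (Ordinal kn).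
have Hi k : (k < n)%N -> (member V k <= member V k.+1)%VS by move=> /st/andP[].
have Hd k : (k <= n)%N -> \dim (member V k) = k.
  elim: k => [|k IHk] kn; first by rewrite dimv0.
  by have /andP[_ /eqP->] := st k kn; rewrite IHk ?addn1 // ltnW.
split=> // k kn; have mk := h1 k kn.
have mkn : (cliques l k < n)%N by lia.
have /andP[_ /implyP h] := H (Ordinal mkn).
have {}h : (T @: member V (cliques l k).+1 <= member V (cliques l k).+1)%VS.
  by apply: h; rewrite /= cliques_idempotent // ln.
by apply: subv_trans h; apply: limgS; apply: (member_mono Hi); lia.
Qed.

End CliqueFlags.

(** * Comparison of the two sides *)

Section LinearCombinations.
Variables n q : nat.

Lemma modularZ (a : int) (f : (nat -> nat) -> int) :
  modular n q f -> modular n q (fun m => a * f m).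
Proof.
move=> [f1 f2 f3]; split.
- by move=> m m' e; rewrite (f1 m m').
- by move=> m i j *; rewrite mulrCA f2 // mulrDr mulrCA.
- by move=> m i j *; rewrite mulrCA f3 // mulrDr mulrCA.
Qed.

Lemma modular_sum (I : finType) (f : I -> (nat -> nat) -> int) :
  (forall i, modular n q (f i)) -> modular n q (fun m => \sum_i f i m).
Proof.
move=> hf; split.
- by move=> m m' e; apply: eq_bigr => i _; apply: (modular_ext (hf i)).
- move=> m i j *; rewrite !mulr_sumr -big_split /=; apply: eq_bigr => k _.
  exact: (modular_row (hf k)).
- move=> m i j *; rewrite !mulr_sumr -big_split /=; apply: eq_bigr => k _.
  exact: (modular_col (hf k)).
Qed.

End LinearCombinations.

Section Assembly.
Variables (n q : nat).
Hypothesis q0 : (0 < q)%N.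

Let X m : series int := specialize q%:Z (chromatic_qsym (indifference_graph (@ord_fun n m))).
Let c m (l : partn n) := chromatic_coef q n (part_monomial l) m.

(** The coefficient of every monomial is modular in [m], so its agreement with the [msym] expansion
    can be tested on unions of complete graphs, where the function is a multiple of an [elem_sym]
    and thus a combination of the [msym]. *)
Lemma chromatic_msym m N : hess n m -> X m N = \sum_l c m l *: msym (parts l) N.
Proof.
move=> hm; apply/mpolyP => a; rewrite [RHS](raddf_sum (mcoeff a)) /=.
under [RHS]eq_bigr do rewrite mcoeffZ mulrC.
apply/eqP; rewrite -subr_eq0; apply/eqP.
have mod_f : modular n q (fun m => chromatic_coef q n a m -
    \sum_l (msym (parts l) N)@_a * c m l).
  apply: modularB; first exact: modular_chromatic.
  by apply: modular_sum => l; apply: modularZ; apply: modular_chromatic.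
apply: (modular_vanish q0 mod_f) hm => s s1 s0 sn.
have [l e] := partsP s1 s0 sn; have [B HB] := elem_sym_msym n.
have cl N' (b : 'X_{1..N'}) : chromatic_coef q n b (cliques s) =
    (\prod_(k <- s) qfact q k)%N%:Z * \sum_p B l p * (msym (parts p) N')@_b.
  rewrite /chromatic_coef specialize_chromatic_cliques // -e HB mcoeffZ.
  rewrite (raddf_sum (mcoeff b)) /=; congr (_ * _).
  by apply: eq_bigr => p _; rewrite mcoeffZ.
have cE p : c (cliques s) p = (\prod_(k <- s) qfact q k)%N%:Z * B l p.
  rewrite /c cl (bigD1 p) //= mcoeff_msym_part eqxx mulr1 [X in _ * (_ + X)]big1 ?addr0 // => p' /negPf p'p.
  by rewrite mcoeff_msym_part eq_sym p'p mulr0.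
by rewrite cl mulr_sumr -sumrB big1 // => p _; rewrite cE; ring.
Qed.

Variables (F : finFieldType) (T : 'End('rV[F]_n)).
Hypothesis card_F : #|F| = q.

Lemma hess_count_hall m : hess n m ->
  hess_count T m = hall n (inv_flag_gf T) (omega n (X m)).
Proof.
have [B HB] := msym_elem_sym n.
(* [B] does not depend on the graph, so the coefficients on the [elem_sym] are fixed linear
   combinations of modular functions. *)
pose d m p : int := \sum_l B l p * c m l.
have Xd m' N : hess n m' -> X m' N = \sum_p d m' p *: elem_sym (parts p) N.
  move=> hm'; rewrite chromatic_msym //; under eq_bigr do rewrite HB.
  rewrite sum_scale_exchange; apply: eq_bigr => p _; congr (_ *: _).
  by apply: eq_bigr => l _; apply: mulrC.
move=> hm.
rewrite (hall_omega_elem_sym (fun l : partn n => #|inv_flags T l|%:Z) (fun N => Xd m N hm)).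
apply/eqP; rewrite -subr_eq0; apply/eqP.
have mod_f : modular n q (fun m => hess_count T m - \sum_(l : partn n) #|inv_flags T l|%:Z * d m l).
  apply: modularB; first by rewrite -card_F; apply: modular_hess_count.
  apply: modular_sum => l; apply: modularZ; apply: modular_sum => p; apply: modularZ.
  exact: modular_chromatic.
apply: (modular_vanish q0 mod_f) hm => s s1 s0 sn.
have [l e] := partsP s1 s0 sn.
have hs : hess n (cliques s) by rewrite -sn; apply: hess_cliques.
pose E := (\prod_(k <- s) qfact q k)%N.
have dl p : d (cliques s) p = E%:Z * (p == l)%:R.
  apply/eqP; rewrite -subr_eq0; apply/eqP; move: p.
  apply: (elem_sym_independent (c := fun p => d (cliques s) p - E%:Z * (p == l)%:R)) => N.
  under eq_bigr do rewrite scalerBl -scalerA.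
  rewrite sumrB -Xd // -scaler_sumr /X specialize_chromatic_cliques // -/E -e.
  rewrite (bigD1 l) //= eqxx scale1r [X in _ *: (_ + X)]big1 ?addr0 ?subrr // => p /negPf->.
  by rewrite scale0r.
rewrite (bigD1 l) //= dl eqxx big1 => [|p /negPf pl]; last by rewrite dl pl !mulr0.
by rewrite hess_count_cliques // card_F -/E -e PoszM addr0 mulr1 mulrC subrr.
Qed.

End Assembly.

Theorem theorem1p1 (q n : nat) (F : finFieldType) (m : 'I_n -> 'I_n)
    (T : 'End('rV[F]_n)) (hq : #|F| = q) (hn : (1 <= n)%N)
    (hm : hessenberg_function m) :
  #|hessenberg_variety m T|%:Z =
  hall n (inv_flag_gf T)
    (omega n (specialize q%:Z (chromatic_qsym (indifference_graph m)))).
Proof.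
pose m' i := if insub i is Some o then val (m o) else i.
have m'E (i : 'I_n) : m' i = m i by rewrite /m' valK.
have hm' : hess n m'.
  split=> [i ni|i j ij nj].
    by rewrite (m'E (Ordinal ni)) ltn_ord andbT; apply: (hm.2 (Ordinal ni)).
  have ni : (i < n)%N by apply: leq_ltn_trans nj.
  by rewrite (m'E (Ordinal ni)) (m'E (Ordinal nj)); apply: hm.1.
have em : ord_fun m' = m.
  by apply: functional_extensionality => i; apply: ord_inj; rewrite val_ord_fun // m'E.
have q0 : (0 < q)%N by rewrite -hq; apply/card_gt0P; exists 0.
by have := hess_count_hall q0 T hq hm'; rewrite /hess_count em.
Qed.
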